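(* Let $N\in\mathbb{N}$, $p\in[0,1]$, $L>0$ and $y\in\Omega_N^{\mathbb Z}$. The process $\mathsf{Y}^{(L)}$ constructed by the acceptance-rejection type algorithm described in the context, with foresight $L$ and initial condition $y$, defines (almost surely) a process $\mathsf{Y}^{(L)}(t)$ for all $t\ge0$, which has the law of a system of myopic non-intersecting random walks (mRW) with foresight $L$ started at $y$.
   Context: $\Omega_N=\{x\in\mathbb{R}^N: x_1<\dots<x_N\}$, $\Omega_N^{\mathbb Z}=\Omega_N\cap\mathbb{Z}^N$, and $e_i$ is the $i$-th canonical vector. Let $\mathsf{Y}=(\mathsf{Y}_1,\dots,\mathsf{Y}_N)$ be a system of independent continuous-time random walks on $\mathbb{Z}$, each jumping by $+1$ at rate $p$ and by $-1$ at rate $1-p$, started from $y$ under $\mathbb{P}_y$. For $L>0$ let $h_L(y)=\mathbb{P}_y(\mathsf{Y}(t)\in\Omega_N\ \forall t\in[0,L])$. mRW with foresight $L$: the time-homogeneous Markov chain on $\Omega_N^{\mathbb Z}$ with generator $$\mathcal{L}^{(L)}F(y)=\sum_{i=1}^N\Big(p\,(F(y+e_i)-F(y))\frac{h_L(y+e_i)}{h_L(y)}+(1-p)(F(y-e_i)-F(y))\frac{h_L(y-e_i)}{h_L(y)}\Big).$$ Conditioned process: $\check{\mathsf{Y}}^{(L)}$ started at $y\in\Omega_N^{\mathbb Z}$ has the law of $\mathsf{Y}$ (on all of $[0,\infty)$) started at $y$ and conditioned on the event $\{\mathsf{Y}(t)\in\Omega_N\ \forall t\in[0,L]\}$. Algorithm.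 (1) Let $t_0=0$ and set $\mathsf{Y}^{(L)}(t_0)=y$. (2) For $n\ge0$, assume $\mathsf{Y}^{(L)}$ has been defined up to time $t_n$. Sample a copy $\check{\mathsf{Y}}^{(L,n+1)}$ of $\check{\mathsf{Y}}^{(L)}$ with initial condition $\mathsf{Y}^{(L)}(t_n)$, otherwise independent of the previous copies $\check{\mathsf{Y}}^{(L,1)},\dots,\check{\mathsf{Y}}^{(L,n)}$. Let $\tau_{n+1}=\inf\{t>0:\check{\mathsf{Y}}^{(L,n+1)}(t)\notin\Omega_N^{\mathbb Z}\}$ be its first collision time, let $t_{n+1}=t_n+\tau_{n+1}-L>t_n$, and set $\mathsf{Y}^{(L)}|_{[t_n,t_{n+1}]}=\check{\mathsf{Y}}^{(L,n+1)}|_{[0,t_{n+1}-t_n]}$ (i.e. $\mathsf{Y}^{(L)}(t_n+s)=\check{\mathsf{Y}}^{(L,n+1)}(s)$ for $0\le s\le t_{n+1}-t_n$). If $\tau_{n+1}=\infty$, then $t_{n+1}=\infty$ and the construction ends. That the process is defined for all $t\ge0$ means that $t_n\nearrow\infty$ (or some $t_n=\infty$). *)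

(* Defs.v *)
From HB Require Import structures.
From mathcomp Require Import all_boot all_order all_algebra.
From mathcomp Require Import all_classical all_reals all_analysis.

Set Implicit Arguments.
Unset Strict Implicit.
Unset Printing Implicit Defensive.

Import Order.TTheory GRing.Theory Num.Theory.
Import numFieldNormedType.Exports.

Local Open Scope classical_set_scope.
Local Open Scope ring_scope.

HB.instance Definition _ := isPointed.Build int 0.

HB.instance Definition _ := @isMeasurable.Build default_measure_display
  int discrete_measurable discrete_measurable0
  discrete_measurableC discrete_measurableU.

HB.instance Definition _ (N : nat) := @isMeasurable.Build default_measure_display
  'rV[int]_N discrete_measurable discrete_measurable0
  discrete_measurableC discrete_measurableU.

(* Time ranges over the whole of R; only the values at times t >= 0 of a path
   or of a process are meaningful. *)

(* Right-continuity and existence of left limits for the discrete topology. *)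
Definition cadlag (R : realType) (S : Type) (f : R -> S) : Prop :=
  forall t : R, 0 <= t ->
    (\forall u \near t^'+, f u = f t) /\
    (0 < t -> exists x : S, \forall u \near t^'-, f u = x).

Definition history (R : realType) (d d' : measure_display)
    (T : measurableType d) (S : measurableType d') (X : R -> T -> S)
    (I : set R) : set (set T) :=
  <<s [set C | exists (t : R) (A : set S),
         [/\ I t, 0 <= t, measurable A & C = X t @^-1` A]] >>.

Definition path_events (R : realType) (d : measure_display)
    (S : measurableType d) : set (set (R -> S)) :=
  <<s [set B | exists (t : R) (A : set S),
         [/\ 0 <= t, measurable A & B = [set f : R -> S | A (f t)]]] >>.

Definition transition_semigroup (R : realType) (d : measure_display)
    (S : measurableType d) (E : set S) (Pt : R -> R.-pker S ~> S) : Prop :=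
  [/\ forall (t : R) (x : S), 0 <= t -> E x -> Pt t x E = 1%E,
      forall (x : S) (A : set S), E x -> measurable A -> Pt 0 x A = \d_x A
    & forall (s t : R) (x : S) (A : set S),
        0 <= s -> 0 <= t -> E x -> measurable A ->
        Pt (s + t) x A = (\int[Pt s x]_z Pt t z A)%E].

Definition semigroup_generator (R : realType) (d : measure_display)
    (S : measurableType d) (E : set S) (Pt : R -> R.-pker S ~> S)
    (G : (S -> R) -> S -> R) : Prop :=
  forall F : S -> R, measurable_fun setT F ->
    (exists M : R, forall x, `|F x| <= M) ->
    forall x : S, E x ->
      ((\int[Pt t x]_z F z) - F x) / t @[t --> 0^'+] --> G F x.

(* X is a time-homogeneous Markov chain on E with generator G, started at x0,
   with almost surely cadlag paths. *)
Definition markov_chain (R : realType) (d d' : measure_display)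
    (T : measurableType d) (S : measurableType d') (P : probability T R)
    (E : set S) (G : (S -> R) -> S -> R) (x0 : S) (X : R -> T -> S) : Prop :=
  exists Pt : R -> R.-pker S ~> S,
    transition_semigroup E Pt /\
    semigroup_generator E Pt G /\
    (forall t : R, 0 <= t -> measurable_fun setT (X t)) /\
    P [set w | X 0 w = x0] = 1%E /\
    {ae P, forall w, cadlag (X ^~ w) /\ (forall t : R, 0 <= t -> E (X t w))} /\
    forall (s t : R) (C : set T) (A : set S),
      0 <= s -> 0 <= t -> history X `[0, s] C -> measurable A ->
      P (C `&` X (s + t) @^-1` A) = (\int[P]_(w in C) Pt t (X s w) A)%E.

Definition rw_generator (R : realType) (p : R) (F : int -> R) (k : int) : R :=
  p * (F (k + 1) - F k) + (1 - p) * (F (k - 1) - F k).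

Definition independent_processes (R : realType) (d d' : measure_display)
    (T : measurableType d) (S : measurableType d') (P : probability T R)
    (N : nat) (X : 'I_N -> R -> T -> S) : Prop :=
  forall A : 'I_N -> set T,
    (forall i, history (X i) setT (A i)) ->
    fine (P (\bigcap_(i in [set: 'I_N]) A i)) = \prod_(i < N) fine (P (A i)).

Definition independent_rws (R : realType) (d : measure_display)
    (T : measurableType d) (P : probability T R) (N : nat) (p : R)
    (y : 'rV[int]_N) (Y : R -> T -> 'rV[int]_N) : Prop :=
  (forall i : 'I_N,
     markov_chain P setT (rw_generator p) (y 0 i) (fun t w => Y t w 0 i)) /\
  independent_processes P (fun (i : 'I_N) t w => Y t w 0 i).

Definition Omega (N : nat) : set 'rV[int]_N :=
  [set x | forall i j : 'I_N, (i < j)%N -> x 0 i < x 0 j].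

Definition no_collision (R : realType) (N : nat) (L : R) :
    set (R -> 'rV[int]_N) :=
  [set f | forall t : R, 0 <= t <= L -> Omega (f t)].

(* P (Y \in B) for an event B in path space. *)
Definition prob_path (R : realType) (d : measure_display)
    (T : measurableType d) (S : Type) (P : probability T R) (Y : R -> T -> S)
    (B : set (R -> S)) : R :=
  fine (P [set w | B (Y ^~ w)]).

Definition cond_prob_path (R : realType) (d : measure_display)
    (T : measurableType d) (S : Type) (P : probability T R) (Y : R -> T -> S)
    (B A : set (R -> S)) : R :=
  prob_path P Y (B `&` A) / prob_path P Y A.

Definition mrw_generator (R : realType) (N : nat) (p : R)
    (h : 'rV[int]_N -> R) (F : 'rV[int]_N -> R) (y : 'rV[int]_N) : R :=
  let e (i : 'I_N) : 'rV[int]_N := delta_mx 0 i in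
  \sum_(i < N) (p * (F (y + e i) - F y) * (h (y + e i) / h y)
              + (1 - p) * (F (y - e i) - F y) * (h (y - e i) / h y)).

(* +oo when the path never leaves Omega. *)
Definition collision_time (R : realType) (N : nat) (f : R -> 'rV[int]_N) :
    \bar R :=
  ereal_inf [set t%:E | t in [set t : R | 0 < t /\ ~ Omega (f t)]].

(* [stage L y c n] is the pair of t_n and a path that agrees with Y^(L) on
   [0, t_n]; [c n] is the (n+1)-st copy.  If t_n = +oo, then t_(n+1) = +oo and
   the path no longer changes. *)
Fixpoint stage (R : realType) (N : nat) (L : R) (y : 'rV[int]_N)
    (c : nat -> R -> 'rV[int]_N) (n : nat) : \bar R * (R -> 'rV[int]_N) :=
  match n with
  | 0 => (0%:E, fun=> y)
  | m.+1 =>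
      let: (t, Y) := stage L y c m in
      ((t + (collision_time (c m) - L%:E))%E,
       fun s : R => if (s%:E <= t)%E then Y s else c m (s - fine t))
  end.

Definition renewal_time (R : realType) (N : nat) (L : R) (y : 'rV[int]_N)
    (c : nat -> R -> 'rV[int]_N) (n : nat) : \bar R := (stage L y c n).1.

(* Y^(L)(t_n), as known after n steps. *)
Definition renewal_state (R : realType) (N : nat) (L : R) (y : 'rV[int]_N)
    (c : nat -> R -> 'rV[int]_N) (n : nat) : 'rV[int]_N :=
  (stage L y c n).2 (fine (renewal_time L y c n)).

(* Y^(L)(s) is read off the first stage n such that s <= t_n; it takes the
   irrelevant value y if there is none. *)
Definition algorithm_path (R : realType) (N : nat) (L : R) (y : 'rV[int]_N)
    (c : nat -> R -> 'rV[int]_N) (s : R) : 'rV[int]_N :=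
  let n := xget 0%N [set n : nat | (s%:E <= renewal_time L y c n)%E /\
      forall m : nat, (m < n)%N -> (renewal_time L y c m < s%:E)%E] in
  (stage L y c n).2 s.

(* The sigma-algebra generated by the first n copies. *)
Definition copies_events (R : realType) (d d' : measure_display)
    (T : measurableType d) (S : measurableType d') (Yc : nat -> R -> T -> S)
    (n : nat) : set (set T) :=
  <<s \bigcup_(k in `I_n) history (Yc k) setT >>.

(* The copies used by the algorithm: conditionally on the first n copies and on
   t_n < +oo, the next copy has law [law z], where z = Y^(L)(t_n). *)
Definition sampled_copies (R : realType) (d : measure_display)
    (T : measurableType d) (P : probability T R) (N : nat) (L : R)
    (y : 'rV[int]_N) (law : 'rV[int]_N -> set (R -> 'rV[int]_N) -> R)
    (Yc : nat -> R -> T -> 'rV[int]_N) : Prop :=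
  (forall (n : nat) (t : R), 0 <= t -> measurable_fun setT (Yc n t)) /\
  (forall (n : nat) (w : T), cadlag (Yc n ^~ w)) /\
  forall (n : nat) (z : 'rV[int]_N) (C : set T) (B : set (R -> 'rV[int]_N)),
    Omega z -> copies_events Yc n C -> @path_events R _ 'rV[int]_N B ->
    let D := C `&` [set w |
      (renewal_time L y (fun k s => Yc k s w) n < +oo)%E /\
      renewal_state L y (fun k s => Yc k s w) n = z] in
    P (D `&` [set w | B (Yc n ^~ w)]) = (P D * (law z B)%:E)%E.

(* Main.v *)
(* A process on a countable set whose probability of each transition in a short
   time e, given its past, is bounded below by the first-order expansion of a
   jump chain with bounded rates, up to O(e^2), has the law of that chain: the
   lower bounds over all targets add up to 1 - O(e^2), so they are sharp.

   For the algorithm, fix a time v and condition on the stage n such that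
   t_n <= v < t_(n+1), on the past, and on the present state z.  Since
   v < t_(n+1) means that the copy in use does not collide before time
   v - t_n + L, its continuation after v is distributed as the walks started at z
   and conditioned not to collide on [0, L]; in particular the elapsed time
   v - t_n is forgotten.  With h_s the survival probability up to time s, the path
   jumps to a neighbour z' before v + e with probability at least
   e r h_L(z') / h_L(z) - O(e^2), where r is the rate of the free walks.  It stays
   at z if the copy rests and survives until e + L, with probability
   a = 1 - O(e), or if it rests, fails to survive, and the next copy rests, with
   probability a^2 (h_(L-e)(z) / h_L(z) - 1); comparing h_L with h_(L-e), the sum is
   at least 1 - e c(z) - O(e^2), with c(z) the total rate of the mRW.

   The times t_n tend to infinity because each copy survives for a fixed time
   beyond L with probability at least 1/2, whatever its starting point. *)

Require Import Defs.
From HB Require Import structures.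
From mathcomp Require Import all_boot all_order all_algebra.
From mathcomp Require Import all_classical all_reals all_analysis.
From mathcomp Require Import measurable_realfun ring lra zify.

Set Implicit Arguments.
Unset Strict Implicit.
Unset Printing Implicit Defensive.

Import Order.TTheory GRing.Theory Num.Theory.
Import numFieldNormedType.Exports.

Local Open Scope classical_set_scope.
Local Open Scope ring_scope.

(** The times [t_n] are random, while the law of a copy is prescribed only through events of its
    path, given the earlier copies. The delay of the copy in use is therefore discretized from
    below: this splits the conditioning event into countably many cells on which all reading times
    are deterministic. The passage to the limit rests on right-continuity, and restricts the events
    of the future to those that are stable under small shifts to the right. Survival involves
    uncountably many times; on right-continuous paths it agrees with an event built from dyadic
    grids.

    No differentiability of h_s in s is established: a one-sided bound on increments, summed over a
    fine subdivision, compares h_(L-e) with h_L. The rates of the mRW are bounded because a jump to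
    a neighbour within a fixed time, followed by survival, is one way to survive; its semigroup is
    then an explicit Poisson mixture of a discrete chain. The same short-time argument is applied to
    each single walk, whose kernel is known only through its generator. *)

Section probability_of_events.
Context (R : realType) (d : measure_display) (T : measurableType d) (P : probability T R).
Implicit Types A B C : set T.

Definition pr A : R := fine (P A).

Lemma prE A : measurable A -> P A = (pr A)%:E.
Proof. by move=> mA; rewrite /pr fineK// fin_num_measure. Qed.

Lemma pr_ge0 A : 0 <= pr A.
Proof. exact: fine_ge0. Qed.

Lemma prT : pr setT = 1.
Proof. by rewrite /pr probability_setT. Qed.

Lemma pr0 : pr set0 = 0.
Proof. by rewrite /pr measure0. Qed.

Lemma pr_le A B : measurable A -> measurable B -> A `<=` B -> pr A <= pr B.
Proof.
by move=> mA mB AB; rewrite -lee_fin -!prE// le_measure ?inE.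
Qed.

Lemma pr_le1 A : measurable A -> pr A <= 1.
Proof. by move=> mA; rewrite -prT; exact: pr_le. Qed.

Lemma prU A B : measurable A -> measurable B -> [disjoint A & B] ->
  pr (A `|` B) = pr A + pr B.
Proof.
move=> mA mB /disj_set2P AB0; apply: EFin_inj; rewrite EFinD -!prE//; last exact: measurableU.
by rewrite measureU.
Qed.

Lemma prIC A B : measurable A -> measurable B -> pr A = pr (A `&` B) + pr (A `&` ~` B).
Proof.
move=> mA mB; rewrite -prU; last 3 first.
- exact: measurableI.
- by apply: measurableI => //; exact: measurableC.
- by apply/disj_set2P; rewrite setIACA setICr setI0.
by rewrite -setIUr setUCr setIT.
Qed.

Lemma prI1 A B : measurable A -> measurable B -> pr B = 1 -> pr (A `&` B) = pr A.
Proof.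
move=> mA mB B1; rewrite [RHS](prIC mA mB) [X in _ = _ + X](_ : _ = 0) ?addr0//.
apply/eqP; rewrite eq_le pr_ge0 andbT.
have mC : measurable (~` B) by exact: measurableC.
rewrite (le_trans (pr_le _ mC _))//; first exact: measurableI.
have := prIC measurableT mB; rewrite !setTI prT B1; lra.
Qed.

Lemma pr_bigsetU (I : choiceType) (s : seq I) (F : I -> set T) :
  uniq s -> (forall i, measurable (F i)) ->
  (forall i j w, F i w -> F j w -> i = j) ->
  pr (\big[setU/set0]_(i <- s) F i) = \sum_(i <- s) pr (F i).
Proof.
move=> us mF dF; elim: s us => [_|i s IH /= /andP[ins us]]; first by rewrite !big_nil pr0.
rewrite !big_cons prU ?IH//; first exact: bigsetU_measurable.
apply/disj_set2P/seteqP; split=> // w [Fiw].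
rewrite -bigcup_seq => -[j /= js Fjw].
by move: ins; rewrite (dF _ _ _ Fiw Fjw) js.
Qed.

Lemma pr_sum_le (I : finType) (F : I -> set T) A :
  measurable A -> (forall i, measurable (F i)) ->
  (forall i j w, F i w -> F j w -> i = j) -> (forall i, F i `<=` A) ->
  \sum_i pr (F i) <= pr A.
Proof.
move=> mA mF dF FA; rewrite -pr_bigsetU ?index_enum_uniq//; apply: pr_le => //.
  exact: bigsetU_measurable.
by rewrite -bigcup_seq => w [i _ Fiw]; exact: FA Fiw.
Qed.

(** The part of [A] outside the disjoint events [F i] is bounded by all the mass that they leave. *)
Lemma pr_le_sum (I : finType) (F : I -> set T) A :
  measurable A -> (forall i, measurable (F i)) ->
  (forall i j w, F i w -> F j w -> i = j) ->
  pr A <= \sum_i pr (F i `&` A) + 1 - \sum_i pr (F i).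
Proof.
move=> mA mF dF; have us := index_enum_uniq I.
have mU : measurable (\big[setU/set0]_(i <- index_enum I) F i) by exact: bigsetU_measurable.
rewrite -(pr_bigsetU us)//; last 2 first.
- by move=> i; exact: measurableI.
- by move=> i j w [h1 _] [h2 _]; exact: dF h1 h2.
rewrite -(pr_bigsetU us)// -big_distrl/= (prIC mA mU) setIC -addrA lerD2l.
rewrite -prT (prIC measurableT mU) !setTI addrC addKr.
apply: pr_le; last exact: subIsetr.
- by apply: measurableI => //; exact: measurableC.
- exact: measurableC.
Qed.

End probability_of_events.

(** * Measures and integrals along a countably valued map *)

Section fibres.
Context (R : realType) (S : Type) (enc : S -> nat).
Hypothesis enc_inj : injective enc.

(** Indexing by codes keeps countable sums over the naturals; a number that is no code contributes
    an empty set. *)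
Lemma fibreE (T : Type) (g : T -> S) n :
  (exists z, [set w | enc (g w) = n] = [set w | g w = z]) \/
  [set w | enc (g w) = n] = set0.
Proof.
have [[z zn]|nz] := pselect (exists z, enc z = n).
  left; exists z; apply/seteqP; split=> w /=; last by move=> ->.
  by rewrite -zn => /enc_inj.
by right; apply/seteqP; split=> w //= gw; apply: nz; exists (g w).
Qed.

Lemma bigcup_fibres (T : Type) (g : T -> S) (A : set T) :
  A = \bigcup_n (A `&` [set w | enc (g w) = n]).
Proof.
by apply/seteqP; split=> [w Aw|w [n _ []]//]; exists (enc (g w)).
Qed.

Lemma trivIset_fibres (T : Type) (g : T -> S) (A : set T) :
  trivIset setT (fun n => A `&` [set w | enc (g w) = n]).
Proof. by move=> i j _ _ [w [[_ /= <-] [_ /= <-]]]. Qed.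

Lemma measurable_fibre d (T : measurableType d) (g : T -> S) (A : set T) n :
  measurable A -> (forall z, measurable [set w | g w = z]) ->
  measurable (A `&` [set w | enc (g w) = n]).
Proof.
move=> mA mg; apply: measurableI => //.
by have [[z ->]|->] := fibreE g n.
Qed.

Lemma measure_fibres d (T : measurableType d) (mu : {measure set T -> \bar R})
    (g : T -> S) (A : set T) :
  measurable A -> (forall z, measurable [set w | g w = z]) ->
  mu A = (\sum_(0 <= n <oo) mu (A `&` [set w | enc (g w) = n]))%E.
Proof.
move=> mA mg; rewrite {1}(bigcup_fibres g A) measure_semi_bigcup//.
- by move=> n; exact: measurable_fibre.
- exact: trivIset_fibres.
- by apply: bigcupT_measurable => n; exact: measurable_fibre.
Qed.

Lemma integral_fibres d (T : measurableType d) (mu : {measure set T -> \bar R})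
    (g : T -> S) (A : set T) (f : T -> \bar R) :
  measurable A -> (forall z, measurable [set w | g w = z]) ->
  measurable_fun A f -> (forall w, 0 <= f w)%E ->
  (\int[mu]_(w in A) f w =
   \sum_(0 <= n <oo) \int[mu]_(w in A `&` [set w | enc (g w) = n]) f w)%E.
Proof.
move=> mA mg mf f0; rewrite {1}(bigcup_fibres g A) ge0_integral_bigcup//.
- by move=> n; exact: measurable_fibre.
- by rewrite -bigcup_fibres.
- exact: trivIset_fibres.
Qed.

Lemma le_integral_fibres d (T : measurableType d) (mu : {measure set T -> \bar R})
    (g : T -> S) (A : set T) (f f' : T -> \bar R) :
  measurable A -> (forall z, measurable [set w | g w = z]) ->
  measurable_fun A f -> (forall w, 0 <= f w)%E ->
  measurable_fun A f' -> (forall w, 0 <= f' w)%E ->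
  (forall z, \int[mu]_(w in A `&` [set w | g w = z]) f w <=
             \int[mu]_(w in A `&` [set w | g w = z]) f' w)%E ->
  (\int[mu]_(w in A) f w <= \int[mu]_(w in A) f' w)%E.
Proof.
move=> mA mg mf f0 mf' f0' le.
rewrite (integral_fibres mu mA mg mf f0) (integral_fibres mu mA mg mf' f0').
apply: lee_nneseries => n _; first by move=> _; exact: integral_ge0.
by have [[z ->]|->] := fibreE g n; [exact: le | rewrite setI0 !integral_set0].
Qed.

Lemma measurable_fibres d (T : measurableType d) (g : T -> S) (A : set T) :
  (forall z, measurable (A `&` [set w | g w = z])) -> measurable A.
Proof.
move=> h; rewrite (bigcup_fibres g A); apply: bigcupT_measurable => n.
by have [[z ->]//|->] := fibreE g n; rewrite setI0.
Qed.

Lemma measurable_countable_preimage d (T : measurableType d) (g : T -> S) (A : set S) :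
  (forall z, measurable [set w | g w = z]) -> measurable (g @^-1` A).
Proof.
move=> mg; apply: (measurable_fibres (g := g)) => z.
have [Az|nAz] := pselect (A z).
  rewrite (_ : _ `&` _ = [set w | g w = z]); first exact: mg.
  by apply/seteqP; split=> w /= [] // ->.
rewrite (_ : _ `&` _ = set0)//.
by apply/seteqP; split=> w //= [] /[swap] ->.
Qed.

Lemma le_measure_fibres d (T : measurableType d) (mu nu : {measure set T -> \bar R})
    (g : T -> S) (A A' : set T) :
  measurable A -> measurable A' -> (forall z, measurable [set w | g w = z]) ->
  (forall z, mu (A `&` [set w | g w = z]) <= nu (A' `&` [set w | g w = z]))%E ->
  (mu A <= nu A')%E.
Proof.
move=> mA mA' mg le; rewrite (measure_fibres mu mA mg) (measure_fibres nu mA' mg).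
apply: lee_nneseries => n _; first by move=> _; exact: measure_ge0.
by have [[z ->]|->] := fibreE g n; rewrite // !setI0 !measure0.
Qed.

End fibres.

(** The constants are absorbed into scaled copies of [P], so that the comparisons on the fibres add
    up over the countably many values of [g]. *)
Lemma le_pr_fibres (R : realType) d (T : measurableType d) (P : probability T R)
    (S : countType) (g : T -> S) (A A' : set T) (c c' : R) : 0 <= c -> 0 <= c' ->
  measurable A -> measurable A' -> (forall z, measurable [set w | g w = z]) ->
  (forall z, c * pr P (A `&` [set w | g w = z]) <= c' * pr P (A' `&` [set w | g w = z])) ->
  c * pr P A <= c' * pr P A'.
Proof.
move=> c0 c'0 mA mA' mg h.
pose mu : {measure set T -> \bar R} := mscale (NngNum c0) P.
pose mu' : {measure set T -> \bar R} := mscale (NngNum c'0) P.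
have muE (e : R) (e0 : 0 <= e) B : measurable B ->
    (mscale (NngNum e0) P : {measure set T -> \bar R}) B = (e * pr P B)%:E.
  by move=> mB; rewrite /= /mscale /= prE.
have : (mu A <= mu' A')%E.
  apply: (@le_measure_fibres R S pickle (pcan_inj pickleK) _ _ mu mu' g) => // z.
  by rewrite !muE ?lee_fin//; exact: measurableI.
by rewrite !muE// lee_fin.
Qed.


(** * Uniformization of a jump chain with bounded rates *)

Section finite_mixture.
Context (R : realType) (d : measure_display) (S : measurableType d) (I : finType).
Variables (w : I -> {nonneg R}) (m : I -> {measure set S -> \bar R}).

(** [msum] takes a sequence of measures, hence the enumeration of [I]; the zero measure fills the
    indices beyond its cardinal. *)
Definition mixture : {measure set S -> \bar R} :=
  msum (fun k => match insub k : option 'I_#|I| with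
    | Some o => mscale (w (enum_val o)) (m (enum_val o)) : {measure set S -> \bar R}
    | None => mzero
    end) #|I|.

Lemma mixtureE A : mixture A = (\sum_i (w i)%:num%:E * m i A)%E.
Proof.
rewrite /mixture /= /msum /=.
rewrite (reindex (@enum_val I I)) /=; last first.
  by apply: onW_bij; exact: enum_val_bij.
by apply: eq_bigr => i _; rewrite valK.
Qed.

Lemma integral_mixture (F : S -> \bar R) : measurable_fun setT F ->
  (forall x, 0 <= F x)%E ->
  (\int[mixture]_x F x = \sum_i (w i)%:num%:E * \int[m i]_x F x)%E.
Proof.
move=> mF F0.
rewrite ge0_integral_measure_sum//.
rewrite (reindex (@enum_val I I)) /=; last first.
  by apply: onW_bij; exact: enum_val_bij.
by apply: eq_bigr => i _; rewrite valK ge0_integral_mscale.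
Qed.

End finite_mixture.

Section poisson_weight.
Context (R : realType).
Implicit Types (u v : R) (n : nat).

Definition pois u n : R := expR (- u) * (u ^+ n / n`!%:R).

Lemma pois_ge0 u n : 0 <= u -> 0 <= pois u n.
Proof. by move=> u0; rewrite mulr_ge0 ?expR_ge0// divr_ge0 ?exprn_ge0. Qed.

Lemma pois0 n : pois 0 n = (n == 0)%:R.
Proof.
rewrite /pois oppr0 expR0 mul1r expr0n; case: n => [|n]/=; first by rewrite fact0 divr1.
by rewrite mul0r.
Qed.

Lemma nneseries_pois u : 0 <= u -> (\sum_(0 <= n <oo) (pois u n)%:E = 1)%E.
Proof.
move=> u0.
transitivity ((expR (- u))%:E * \sum_(0 <= n <oo) (u ^+ n / n`!%:R)%:E)%E.
  rewrite -nneseriesZl/=.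
    by apply: eq_eseriesr => n _; rewrite /pois EFinM.
  by move=> n _; rewrite lee_fin divr_ge0 ?exprn_ge0.
rewrite [X in (_ * X)%E](_ : _ = (expR u)%:E).
  by rewrite -EFinM -expRD addNr expR0.
rewrite expRE -EFin_lim.
  apply/congr_lim/funext => n/=; rewrite /pseries/= /series/= -sumEFin//.
  by apply: eq_bigr => i _; rewrite mulrC.
rewrite /pseries/=; under eq_fun do rewrite mulrC.
exact: is_cvg_series_exp_coeff.
Qed.

(** Binomial formula: independent Poisson counts of parameters [u] and [v] add up to one of
    parameter [u + v]. *)
Lemma poisD u v k :
  pois (u + v) k = \sum_(n < k.+1) pois u n * pois v (k - n).
Proof.
rewrite /pois opprD expRD addrC exprDn mulr_suml mulr_sumr.
apply: eq_bigr => i _; have ik : (i <= k)%N by rewrite -ltnS.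
rewrite -(bin_fact ik) -mulr_natr !natrM.
have k0 : ((i`!)%:R : R) != 0 by rewrite pnatr_eq0 -lt0n fact_gt0.
have k1 : (((k - i)`!)%:R : R) != 0 by rewrite pnatr_eq0 -lt0n fact_gt0.
have k2 : (('C(k, i))%:R : R) != 0 by rewrite pnatr_eq0 -lt0n bin_gt0.
field.
by rewrite k0 k1 k2.
Qed.

End poisson_weight.

(* Cauchy product *)
Lemma nneseries_diag (R : realType) (f : nat -> nat -> \bar R) :
  (forall n k, 0 <= f n k)%E ->
  (\sum_(0 <= n <oo) \sum_(0 <= m <oo) f n (n + m)%N =
   \sum_(0 <= k <oo) \sum_(n < k.+1) f n k)%E.
Proof.
move=> f0.
transitivity (\sum_(0 <= n <oo) \sum_(0 <= k <oo) (if (n <= k)%N then f n k else 0))%E.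
  apply: eq_eseriesr => n _.
  rewrite [RHS](nneseries_split 0 n); last by move=> k _; case: ifP => // _; exact: f0.
  rewrite big1_seq ?add0e; last first.
    by move=> k /andP[_]; rewrite mem_index_iota add0n => /andP[_ kn]; rewrite leqNgt kn.
  rewrite add0n -[RHS]nneseries_addn; last by move=> k; case: ifP => // _; exact: f0.
  by apply: eq_eseriesr => k _; rewrite leq_addl addnC.
rewrite (nneseries_interchange xpredT xpredT); last by move=> n k; case: ifP => // _; exact: f0.
apply: eq_eseriesr => k _.
rewrite [LHS](nneseries_split 0 k.+1); last by move=> j _; case: ifP => // _; exact: f0.
rewrite add0n big_mkord eseries0 ?adde0.
  by apply: eq_bigr => j _; rewrite -ltnS ltn_ord.
by move=> j kj _; rewrite leqNgt kj.
Qed.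

Section uniformization.
Context (R : realType) (d : measure_display) (S : measurableType d).
Hypothesis allm : forall A : set S, measurable A.
Context (J : finType) (mv : J -> S -> S) (c : J -> S -> R) (Lam : R).
Hypothesis c_ge0 : forall j x, 0 <= c j x.
Hypothesis Lam_gt0 : 0 < Lam.
Hypothesis c_le : forall x, \sum_j c j x <= Lam.

Lemma discrete_measurable_fun d' (U : measurableType d') (f : S -> U) (D : set S) :
  measurable_fun D f.
Proof. by move=> mD B mB; exact: allm. Qed.

Definition jump_generator (F : S -> R) (x : S) : R :=
  \sum_j c j x * (F (mv j x) - F x).

(** One tick of a Poisson clock of rate [Lam]: [None] is the dummy step that uses up the rate left
    over by the moves, so that the clock does not depend on the state. *)
Definition jump_weight (o : option J) (x : S) : R :=
  if o is Some j then c j x / Lam else 1 - (\sum_j c j x) / Lam.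

Definition jump_target (o : option J) (x : S) : S :=
  if o is Some j then mv j x else x.

Lemma jump_weight_ge0 o x : 0 <= jump_weight o x.
Proof.
case: o => [j|] /=; first by rewrite divr_ge0// ltW.
by rewrite subr_ge0 ler_pdivrMr// mul1r.
Qed.

Lemma sum_jump_weight x : \sum_o jump_weight o x = 1.
Proof.
rewrite (bigD1 None)//= (reindex_omap Some id); last by case.
rewrite [X in _ + X](eq_bigl xpredT); last by move=> j; rewrite eqxx.
by rewrite -mulr_suml subrK.
Qed.

Fixpoint jump_measure (n : nat) (x : S) : {measure set S -> \bar R} :=
  if n is n'.+1 then
    mixture (fun o => NngNum (jump_weight_ge0 o x))
            (fun o => jump_measure n' (jump_target o x))
  else \d_x.

Lemma jump_measureS n x A : jump_measure n.+1 x A =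
  (\sum_o (jump_weight o x)%:E * jump_measure n (jump_target o x) A)%E.
Proof. exact: mixtureE. Qed.

Lemma jump_measureT n x : jump_measure n x setT = 1%E.
Proof.
elim: n x => [|n IH] x; first by rewrite /= diracT.
rewrite jump_measureS; under eq_bigr do rewrite IH mule1.
by rewrite sumEFin sum_jump_weight.
Qed.

Lemma jump_measure_closed (E : set S) n x :
  (forall y j, E y -> c j y != 0 -> E (mv j y)) -> E x ->
  jump_measure n x E = 1%E.
Proof.
move=> hE; elim: n x => [|n IH] x Ex; first by rewrite /= diracE mem_set.
rewrite jump_measureS -[RHS](_ : (\sum_o jump_weight o x)%:E = _); last by rewrite sum_jump_weight.
rewrite -sumEFin; apply: eq_bigr => -[j|] _ /=; last by rewrite IH ?mule1.
have [->|cj] := eqVneq (c j x) 0; first by rewrite mul0r mul0e.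
by rewrite IH ?mule1//; exact: hE.
Qed.

Lemma integral_jump_measureS n x (F : S -> \bar R) : (forall z, 0 <= F z)%E ->
  (\int[jump_measure n.+1 x]_z F z =
   \sum_o (jump_weight o x)%:E * \int[jump_measure n (jump_target o x)]_z F z)%E.
Proof.
by move=> F0; rewrite integral_mixture//; exact: discrete_measurable_fun.
Qed.

Lemma jump_measureD n m x A :
  (\int[jump_measure n x]_z jump_measure m z A = jump_measure (n + m) x A)%E.
Proof.
elim: n x => [|n IH] x.
  by rewrite integral_dirac ?diracT ?mul1e//; exact: discrete_measurable_fun.
rewrite integral_jump_measureS; last by move=> z; exact: measure_ge0.
by rewrite addSn jump_measureS; apply: eq_bigr => o _; rewrite IH.
Qed.

(** Kernels are indexed by all reals; the truncation at 0 keeps the Poisson parameter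
    nonnegative. *)
Lemma rate_ge0 (t : R) : 0 <= Lam * Num.max 0 t.
Proof. by rewrite mulr_ge0 ?(ltW Lam_gt0)// le_max lexx. Qed.

(* exp (t G) as the mixture of the jump chain over a Poisson number of jumps
   of parameter Lam * t. *)
Definition unif_measure (t : R) (x : S) : {measure set S -> \bar R} :=
  mseries (fun n => mscale (NngNum (pois_ge0 n (rate_ge0 t))) (jump_measure n x)
    : {measure set S -> \bar R}) 0.

Lemma unif_measureE t x A : unif_measure t x A =
  (\sum_(0 <= n <oo) (pois (Lam * Num.max 0 t) n)%:E * jump_measure n x A)%E.
Proof. by []. Qed.

Lemma integral_unif_measure t x (F : S -> \bar R) : (forall z, 0 <= F z)%E ->
  (\int[unif_measure t x]_z F z =
   \sum_(0 <= n <oo) (pois (Lam * Num.max 0 t) n)%:E * \int[jump_measure n x]_z F z)%E.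
Proof.
move=> F0; rewrite ge0_integral_measure_series//.
apply: eq_eseriesr => n _.
by rewrite ge0_integral_mscale//; exact: discrete_measurable_fun.
Qed.

Lemma measurable_unif_measure t (U : set S) :
  measurable U -> measurable_fun setT (unif_measure t ^~ U).
Proof. by move=> _; exact: discrete_measurable_fun. Qed.

HB.instance Definition _ (t : R) :=
  isKernel.Build _ _ S S R (unif_measure t) (measurable_unif_measure t).

Lemma unif_measureT t x : unif_measure t x setT = 1%E.
Proof.
rewrite unif_measureE -[RHS](nneseries_pois (rate_ge0 t)).
by apply: eq_eseriesr => n _; rewrite jump_measureT mule1.
Qed.

HB.instance Definition _ (t : R) :=
  Kernel_isProbability.Build _ _ S S R (unif_measure t) (unif_measureT t).

Definition unif_kernel (t : R) : R.-pker S ~> S := unif_measure t.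

Lemma unif_kernel0 x A : unif_kernel 0 x A = \d_x A.
Proof.
rewrite /unif_kernel /= unif_measureE maxxx mulr0 (nneseries_split 0 1); last first.
  by move=> k _; rewrite mule_ge0// lee_fin pois_ge0.
rewrite add0n big_nat1 pois0 eqxx mul1e eseries0 ?adde0//.
by move=> k k0 _; rewrite pois0; case: k k0 => // k _; rewrite mul0e.
Qed.

(** The numbers of ticks in the two periods add up to a Poisson variable ([poisD]), the steps of the
    discrete chain compose ([jump_measureD]), and [nneseries_diag] regroups the double series by the
    total number of ticks. *)
Lemma unif_kernelD s t x A : 0 <= s -> 0 <= t ->
  (unif_kernel (s + t) x A = \int[unif_kernel s x]_z unif_kernel t z A)%E.
Proof.
move=> s0 t0; rewrite /unif_kernel /= integral_unif_measure; last first.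
  by move=> z; exact: measure_ge0.
under eq_eseriesr.
  move=> n _; rewrite integral_nneseries//; [|by move=> m; exact: discrete_measurable_fun].
  rewrite -nneseriesZl; last first.
    move=> m _; apply: integral_ge0 => z _.
    by rewrite mule_ge0// lee_fin pois_ge0 ?rate_ge0.
  under eq_eseriesr.
    move=> m _; rewrite ge0_integralZl_EFin ?pois_ge0 ?rate_ge0//.
    rewrite jump_measureD muleA -EFinM.
    over.
  over.
have -> : Num.max 0 s = s by exact/max_idPr.
have Ls : 0 <= Lam * s by rewrite mulr_ge0// ltW.
have Lt : 0 <= Lam * t by rewrite mulr_ge0// ltW.
rewrite /= -[RHS]/(\sum_(0 <= i <oo) \sum_(0 <= i0 <oo)
        ((pois (Lam * s) i * pois (Lam * Num.max 0 t) i0)%:E *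
           jump_measure (i + i0) x A))%E.
have -> : Num.max 0 t = t by exact/max_idPr.
pose f n k := ((pois (Lam * s) n * pois (Lam * t) (k - n))%:E * jump_measure k x A)%E.
have f0 n k : (0 <= f n k)%E by rewrite mule_ge0// lee_fin mulr_ge0// pois_ge0.
transitivity (\sum_(0 <= n <oo) \sum_(0 <= m <oo) f n (n + m)%N)%E; last first.
  by apply: eq_eseriesr => n _; apply: eq_eseriesr => m _; rewrite /f addKn.
rewrite (nneseries_diag f0).
rewrite unif_measureE.
have -> : Num.max 0 (s + t) = s + t by apply/max_idPr; rewrite addr_ge0.
apply: eq_eseriesr => k _.
rewrite mulrDr poisD -sumEFin ge0_sume_distrl//.
by move=> i _; rewrite lee_fin mulr_ge0 ?pois_ge0.
Qed.

Lemma jump_measure1E x (F : S -> R) : (forall z, 0 <= F z) ->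
  (\int[jump_measure 1 x]_z (F z)%:E = (F x + jump_generator F x / Lam)%:E)%E.
Proof.
move=> F0; rewrite integral_jump_measureS//.
under eq_bigr => o _.
  rewrite integral_dirac ?diracT ?mul1e// -EFinM; over.
rewrite sumEFin; congr EFin.
rewrite (bigD1 None)//= (reindex_omap Some id); last by case.
rewrite [X in _ + X](eq_bigl xpredT); last by move=> j; rewrite eqxx.
rewrite /jump_generator !mulr_suml mulrBl mul1r -addrA; congr (_ + _).
rewrite mulr_suml -sumrN -big_split; apply: eq_bigr => j _ /=; ring.
Qed.

(** No tick or one tick of the clock gives the first-order expansion; two or more ticks have a
    probability of second order, and [F] is bounded by 1. *)
Lemma unif_kernel_approx t x (F : S -> R) : 0 <= t ->
  (forall z, 0 <= F z <= 1) ->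
  exists2 r : R, (\int[unif_kernel t x]_z (F z)%:E = r%:E)%E &
    `|r - (F x + t * jump_generator F x)| <= (Lam * t) ^+ 2.
Proof.
move=> t0 F01; have F0 z : 0 <= F z by case/andP: (F01 z).
have F1 z : F z <= 1 by case/andP: (F01 z).
set I := (\int[_]_z _)%E.
set K := F x + jump_generator F x / Lam.
set u := Lam * t; have u0 : 0 <= u by rewrite mulr_ge0// ltW.
have int_ge0 n : (0 <= \int[jump_measure n x]_z (F z)%:E)%E.
  by apply: integral_ge0 => z _; rewrite lee_fin.
have int_le1 n : (\int[jump_measure n x]_z (F z)%:E <= 1)%E.
  rewrite -(jump_measureT n x) -[leRHS]mul1e -integral_cst//.
  apply: ge0_le_integral => //.
  - by move=> z _; rewrite lee_fin.
  - by move=> z _ /=; rewrite lee_fin.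
have K01 : 0 <= K <= 1.
  have := int_ge0 1; have := int_le1 1.
  by rewrite jump_measure1E// !lee_fin => -> ->.
set rest := (\sum_(2 <= n <oo) (pois u n)%:E * \int[jump_measure n x]_z (F z)%:E)%E.
set tail := (\sum_(2 <= n <oo) (pois u n)%:E)%E.
have IE : I = ((pois u 0 * F x + pois u 1 * K)%:E + rest)%E.
  rewrite /I /unif_kernel /= integral_unif_measure; last by move=> z; rewrite lee_fin.
  have -> : Num.max 0 t = t by exact/max_idPr.
  rewrite (nneseries_split 0 2); last first.
    by move=> k _; rewrite mule_ge0// lee_fin pois_ge0.
  rewrite !add0n /index_iota/= !big_cons big_nil adde0 jump_measure1E//.
  by rewrite integral_dirac ?diracT ?mul1e.
have tailE : (1 = (pois u 0 + pois u 1)%:E + tail)%E.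
  rewrite -(nneseries_pois u0) (nneseries_split 0 2); last first.
    by move=> k _; rewrite lee_fin pois_ge0.
  by rewrite !add0n /index_iota/= !big_cons big_nil adde0.
have rest0 : (0 <= rest)%E.
  by apply: nneseries_ge0 => n _ _; rewrite mule_ge0// lee_fin pois_ge0.
have restle : (rest <= tail)%E.
  apply: lee_nneseries => n _; first by rewrite mule_ge0// lee_fin pois_ge0.
  by rewrite -[leRHS]mule1 lee_wpmul2l// lee_fin pois_ge0.
have tailr : tail = (1 - (pois u 0 + pois u 1))%:E.
  by rewrite EFinB tailE addeAC subee ?add0e.
have [r restr] : exists r, rest = r%:E.
  exists (fine rest); rewrite fineK// ge0_fin_numE// (le_lt_trans restle)//.
  by rewrite tailr ltry.
move: rest0 restle; rewrite tailr restr !lee_fin => r0 rle.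
exists (pois u 0 * F x + pois u 1 * K + r); first by rewrite IE restr.
have -> : t * jump_generator F x = u * (K - F x).
  by rewrite /K /u addrC addKr; field; rewrite gt_eqF.
(* What remains is polynomial in [e], of which only 1 - u <= e <= 1 is used; the products formed
   below are the certificates for [nra]. *)
move: rle; rewrite /pois !expr0 expr1 fact0 /= divr1 divr1 mulr1.
set e := expR (- u) => rle.
have e1 : 1 - u <= e by rewrite /e; exact: expR_ge1Dx.
have e2 : e <= 1 by rewrite /e -expR0 ler_expR oppr_le0.
have /andP[K0 K1] := K01.
have Fx0 := F0 x; have Fx1 := F1 x.
have h1 := mulr_ge0 u0 K0.
have h2 : 0 <= u * (1 - K) by rewrite mulr_ge0// subr_ge0.
rewrite ler_norml; apply/andP; split.
  have h3 : (1 - u) * F x <= e * F x by rewrite ler_wpM2r.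
  have h4 : (1 - u) * (u * K) <= e * (u * K) by rewrite ler_wpM2r.
  have h5 : 0 <= u * (u * (1 - K)) by rewrite mulr_ge0.
  nra.
have h3 : (1 - u) * (1 - F x) <= e * (1 - F x) by rewrite ler_wpM2r// subr_ge0.
have h4 : (1 - u) * (u * (1 - K)) <= e * (u * (1 - K)) by rewrite ler_wpM2r.
have h5 : 0 <= u * (u * K) by rewrite mulr_ge0.
nra.
Qed.

(** An affine change turns a bounded [F] into one with values in [0, 1], to which the quadratic
    error bound applies; divided by [t], the error vanishes. *)
Lemma unif_kernel_generator (F : S -> R) x :
  (exists M : R, forall z, `|F z| <= M) ->
  ((\int[unif_kernel t x]_z F z) - F x) / t @[t --> 0^'+] --> jump_generator F x.
Proof.
move=> [M0 FM0]; pose M := Num.max 1 M0.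
have M_gt0 : 0 < M by rewrite lt_max ltr01.
have FM z : `|F z| <= M by rewrite le_max FM0 orbT.
pose F' z := (F z + M) / (M *+ 2).
have M2 : 0 < M *+ 2 by rewrite pmulrn_rgt0.
have F'01 z : 0 <= F' z <= 1.
  have := FM z; rewrite ler_norml => /andP[h1 h2].
  rewrite /F' divr_ge0 ?(ltW M2)//= ?ler_pdivrMr ?mul1r//; last by lra.
  by rewrite mulr2n lerD2r.
have FE z : F z = M *+ 2 * F' z - M by rewrite /F' mulrC divfK ?addrK// gt_eqF.
have genE : jump_generator F x = M *+ 2 * jump_generator F' x.
  rewrite /jump_generator mulr_sumr; apply: eq_bigr => j _; rewrite !FE; ring.
have key (t : R) : 0 < t ->
  `|((\int[unif_kernel t x]_z F z) - F x) / t - jump_generator F x| <= M *+ 2 * Lam ^+ 2 * t.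
  move=> t0; have [r rE rle] := unif_kernel_approx x (ltW t0) F'01.
  have -> : \int[unif_kernel t x]_z F z = M *+ 2 * r - M.
    have ib (f : S -> R) (b : R) : (forall z, `|f z| <= b) ->
        (unif_kernel t x).-integrable setT (EFin \o f).
      move=> fb; apply: measurable_bounded_integrable => //.
      - by rewrite prob_kernel ltry.
      - by exists b; split=> // [|b' bb' z _ /=]; rewrite ?num_real// (le_trans (fb z))// ltW.
    have iF' : (unif_kernel t x).-integrable setT (EFin \o F').
      by apply: (ib _ 1) => z; rewrite ger0_norm; case/andP: (F'01 z).
    rewrite (_ : F = fun z => M *+ 2 * F' z + - M); last by apply/funext => z; rewrite FE.
    rewrite RintegralD//; last 2 first.
    - apply: (ib _ (M *+ 2)) => z; have /andP[f0 f1] := F'01 z.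
      rewrite ger0_norm; first by rewrite ler_piMr ?(ltW M2).
      exact: mulr_ge0 (ltW M2) f0.
    - by apply: (ib (fun=> - M) M) => z; rewrite normrN gtr0_norm.
    rewrite RintegralZl// Rintegral_cst// prob_kernel/= mulr1.
    by rewrite /Rintegral rE.
  rewrite genE FE.
  have -> : (M *+ 2 * r - M - (M *+ 2 * F' x - M)) / t - M *+ 2 * jump_generator F' x
     = (M *+ 2 / t) * (r - (F' x + t * jump_generator F' x)).
    by field; rewrite gt_eqF.
  rewrite normrM gtr0_norm ?divr_gt0//.
  rewrite (le_trans (ler_wpM2l (divr_ge0 (ltW M2) (ltW t0)) rle))//.
  rewrite le_eqVlt; apply/orP; left; apply/eqP; field; by rewrite gt_eqF.
apply: (@squeeze_cvgr _ _ _ _ (fun t => jump_generator F x - M *+ 2 * Lam ^+ 2 * t)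
  (fun t => jump_generator F x + M *+ 2 * Lam ^+ 2 * t)).
- near=> t; have t0 : 0 < t by near: t; exact: nbhs_right_gt.
  have := key t t0; rewrite ler_norml; set a := _ / t; set b := _ * t; lra.
- apply: cvg_at_right_filter; rewrite -[X in _ --> X]subr0.
  apply: cvgB; first exact: cvg_cst.
  rewrite -[X in _ --> X](mulr0 (M *+ 2 * Lam ^+ 2)).
  by apply: cvgM; [exact: cvg_cst|exact: cvg_id].
- apply: cvg_at_right_filter; rewrite -[X in _ --> X]addr0.
  apply: cvgD; first exact: cvg_cst.
  rewrite -[X in _ --> X](mulr0 (M *+ 2 * Lam ^+ 2)).
  by apply: cvgM; [exact: cvg_cst|exact: cvg_id].
Unshelve. all: by end_near.
Qed.

Lemma unif_kernel_closed (E : set S) t x :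
  (forall y j, E y -> c j y != 0 -> E (mv j y)) -> E x ->
  unif_kernel t x E = 1%E.
Proof.
move=> hE Ex; rewrite /unif_kernel /= unif_measureE.
rewrite -[RHS](nneseries_pois (rate_ge0 t)).
by apply: eq_eseriesr => n _; rewrite (jump_measure_closed _ hE)// mule1.
Qed.

Lemma unif_kernel_semigroup (E : set S) :
  (forall y j, E y -> c j y != 0 -> E (mv j y)) ->
  transition_semigroup E unif_kernel /\ semigroup_generator E unif_kernel jump_generator.
Proof.
move=> hE; split.
  split.
  - by move=> t x _ Ex; exact: unif_kernel_closed.
  - by move=> x A _ _; exact: unif_kernel0.
  - by move=> s t x A s0 t0 _ _; exact: unif_kernelD.
by move=> F _ FM x _; exact: unif_kernel_generator.
Qed.

End uniformization.

(** * A short-time characterization of the Markov property *)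

Lemma leeD_EFin (R : realType) (x y : \bar R) (a b : R) :
  (x <= y + a%:E -> x + b%:E <= y + (a + b)%:E)%E.
Proof. by move=> xy; rewrite EFinD addeA; apply: leeD2r. Qed.

Section local_characterization.
Context (R : realType) (d d' : measure_display) (T : measurableType d)
  (S : measurableType d') (P : probability T R).
Hypothesis allm : forall A : set S, measurable A.
Context (enc : S -> nat).
Hypothesis enc_inj : injective enc.
Context (J : finType) (mv : J -> S -> S) (c : J -> S -> R) (Lam : R).
Hypothesis c_ge0 : forall j x, 0 <= c j x.
Hypothesis Lam_gt0 : 0 < Lam.
Hypothesis c_le : forall x, \sum_j c j x <= Lam.
Hypothesis target_inj : forall x, injective (jump_target mv ^~ x).
Local Notation Pt := (unif_kernel allm mv c_ge0 Lam_gt0 c_le).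
Local Notation target := (jump_target mv).

Context (X : R -> T -> S) (C : set T) (u K eps0 : R).
Hypothesis mX : forall t, 0 <= t -> measurable_fun setT (X t).
Hypothesis mC : measurable C.
Hypothesis u_ge0 : 0 <= u.
Hypothesis K_ge0 : 0 <= K.
Hypothesis eps0_gt0 : 0 < eps0.

Definition jump_lower_bound (eps : R) (o : option J) (z : S) : R :=
  (if o is Some j then eps * c j z else 1 - eps * \sum_j c j z) - K * eps ^+ 2.

Hypothesis local_bound : forall v z eps o, u <= v -> 0 <= eps <= eps0 ->
  pr P (C `&` [set w | X v w = z]) * jump_lower_bound eps o z <=
  pr P (C `&` [set w | X v w = z] `&` [set w | X (v + eps) w = target o z]).

Lemma measurable_state t z : 0 <= t -> measurable [set w | X t w = z].
Proof.
by move=> t0; rewrite -[X in measurable X]setTI; exact: (mX t0 measurableT (allm [set z])).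
Qed.

Lemma measurable_observable (G : S -> R) t : 0 <= t ->
  measurable_fun setT (fun w => (G (X t w))%:E).
Proof.
move=> t0; apply/measurable_EFinP.
by apply: (measurableT_comp (discrete_measurable_fun allm (D:=setT) G)); exact: mX.
Qed.

(** Error constant of one step: [K] for each target, and [Lam ^+ 2] from the expansion of the
    uniformized kernel. *)
Let K' := K * #|{: option J}|%:R + Lam ^+ 2.

(** Distinct targets give disjoint events, so the lower bounds, weighted by the values of [G], may
    be added; they sum to the first-order expansion of the semigroup. *)
Lemma integral_state_ge (G : S -> R) v z eps : u <= v -> 0 <= eps <= eps0 ->
  (forall x, 0 <= G x <= 1) ->
  ((pr P (C `&` [set w | X v w = z]) * (G z + eps * jump_generator mv c G z
     - K * #|{: option J}|%:R * eps ^+ 2))%:E <=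
  \int[P]_(w in C `&` [set w | X v w = z]) (G (X (v + eps) w))%:E)%E.
Proof.
move=> uv /andP[e0 e1] G01.
have v0 : 0 <= v := le_trans u_ge0 uv.
have ve0 : 0 <= v + eps by rewrite addr_ge0.
set D := C `&` [set w | X v w = z].
have mD : measurable D by apply: measurableI => //; exact: measurable_state.
pose E o := D `&` [set w | X (v + eps) w = target o z].
have mE o : measurable (E o) by apply: measurableI => //; exact: measurable_state.
have G0 x : 0 <= G x by case/andP: (G01 x).
have G1 x : G x <= 1 by case/andP: (G01 x).
apply: (@le_trans _ _ (\int[P]_(w in \big[setU/set0]_(o <- enum {: option J}) E o)
    (G (X (v + eps) w))%:E)%E); last first.
  apply: ge0_subset_integral => //.
  - by apply: bigsetU_measurable => o _.
  - by apply: measurable_funTS; exact: measurable_observable.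
  - by move=> w _; rewrite lee_fin.
  - by apply: (big_ind (fun A => A `<=` D)) => [|A B AD BD|o _]; [exact: sub0set|rewrite subUset|exact: subIsetl].
rewrite ge0_integral_bigsetU//; last 4 first.
- exact: enum_uniq.
- by move=> o o' _ _ [w [[_ /= h1] [_ /= h2]]]; apply: (@target_inj z); rewrite -h1 -h2.
- by apply: measurable_funTS; exact: measurable_observable.
- by move=> w _; rewrite lee_fin.
have intE o : (\int[P]_(w in E o) (G (X (v + eps) w))%:E = (G (target o z) * pr P (E o))%:E)%E.
  under eq_integral => w.
    rewrite inE => -[_ /= ->]; over.
  by rewrite integral_cst// EFinM -prE.
under eq_bigr do rewrite intE.
rewrite sumEFin lee_fin big_enum/=.
apply: (@le_trans _ _ (\sum_o G (target o z) * (pr P D * jump_lower_bound eps o z))); last first.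
  by apply: ler_sum => o _; rewrite ler_wpM2l// local_bound// e0.
under eq_bigr do rewrite mulrCA.
rewrite -mulr_sumr ler_wpM2l ?pr_ge0//.
rewrite [leRHS](_ : _ = G z + eps * jump_generator mv c G z
   - K * eps ^+ 2 * \sum_o G (target o z)).
  rewrite lerD2l lerN2 [K * _ * eps ^+ 2]mulrAC ler_wpM2l//; first by rewrite mulr_ge0// sqr_ge0.
  apply: (le_trans (ler_sum _ (fun o _ => G1 (target o z)))).
  by rewrite sumr_const.
rewrite /jump_lower_bound.
under eq_bigr do rewrite mulrBr.
rewrite sumrB -mulr_suml [X in _ - X = _]mulrC; congr (_ - _).
rewrite (bigD1 None)//= (reindex_omap Some id); last by case.
rewrite [X in _ + X](eq_bigl xpredT); last by move=> j; rewrite eqxx.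
rewrite /jump_generator /= mulrBr mulr1 -addrA; congr (_ + _).
rewrite mulrCA mulr_sumr !mulr_sumr -sumrN -big_split; apply: eq_bigr => j _ /=; ring.
Qed.

(** To first order, both [r] and the lower bound of [integral_state_ge] are [G] plus [eps] times its
    generator. The second-order errors add up to a multiple of P C <= 1. *)
Lemma integral_step (G r : S -> R) v eps : u <= v -> 0 <= eps <= eps0 ->
  (forall x, 0 <= G x <= 1) ->
  (forall z, \int[Pt eps z]_x (G x)%:E = (r z)%:E)%E ->
  (\int[P]_(w in C) (r (X v w))%:E <=
   \int[P]_(w in C) (G (X (v + eps) w))%:E + (K' * eps ^+ 2)%:E)%E.
Proof.
move=> uv e01 G01 rE; have /andP[e0 e1] := e01.
have v0 : 0 <= v := le_trans u_ge0 uv.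
have ve0 : 0 <= v + eps by rewrite addr_ge0.
have G0 x : 0 <= G x by case/andP: (G01 x).
have r0 x : 0 <= r x by rewrite -lee_fin -rE; apply: integral_ge0 => z _; rewrite lee_fin.
have K'0 : 0 <= K' * eps ^+ 2.
  by rewrite mulr_ge0 ?sqr_ge0// addr_ge0 ?sqr_ge0// mulr_ge0.
(* The error is put under the integral so that the comparison can be made on each fibre of [X v]. *)
apply: (@le_trans _ _ (\int[P]_(w in C) ((G (X (v + eps) w))%:E + (K' * eps ^+ 2)%:E))%E).
  apply: (@le_integral_fibres _ _ enc enc_inj _ _ P (X v)) => //.
  - by move=> z; exact: measurable_state.
  - by apply: measurable_funTS; exact: measurable_observable.
  - by move=> w; rewrite lee_fin.
  - apply: emeasurable_funD => //; apply: measurable_funTS; exact: measurable_observable.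
  - by move=> w; rewrite -EFinD lee_fin addr_ge0.
  move=> z; set D := C `&` _.
  have mD : measurable D by apply: measurableI => //; exact: measurable_state.
  rewrite ge0_integralD//; last 2 first.
  - by move=> w _; rewrite lee_fin.
  - by apply: measurable_funTS; exact: measurable_observable.
  have -> : (\int[P]_(_ in D) (K' * eps ^+ 2)%:E = (K' * eps ^+ 2 * pr P D)%:E)%E.
    by rewrite integral_cst// [RHS]EFinM -prE.
  have -> : (\int[P]_(w in D) (r (X v w))%:E = (r z * pr P D)%:E)%E.
    under eq_integral => w.
      rewrite inE => -[_ /= ->]; over.
    by rewrite integral_cst// EFinM -prE.
  have := integral_state_ge z uv e01 G01; rewrite -/D => h.
  have [r' r'E] := unif_kernel_approx allm mv c_ge0 Lam_gt0 c_le z e0 G01.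
  rewrite rE in r'E; case: r'E => <-; rewrite ler_distl => /andP[_ r'le].
  apply: (@le_trans _ _ ((pr P D * (G z + eps * jump_generator mv c G z -
          K * #|{: option J}|%:R * eps ^+ 2))%:E + (K' * eps ^+ 2 * pr P D)%:E)%E); last first.
    by rewrite leeD2r.
  rewrite -EFinD lee_fin [K' * _ * _]mulrC -mulrDr mulrC ler_wpM2l ?pr_ge0//.
  rewrite (le_trans r'le)// /K' exprMn; lra.
rewrite ge0_integralD//; last 2 first.
- by move=> w _; rewrite lee_fin.
- by apply: measurable_funTS; exact: measurable_observable.
rewrite leeD2l// integral_cst// -[leRHS]mule1 lee_wpmul2l// ?lee_fin//.
exact: probability_le1.
Qed.

Lemma unif_kernel_fin t x A : unif_kernel allm mv c_ge0 Lam_gt0 c_le t x A =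
  (fine (Pt t x A))%:E.
Proof.
rewrite fineK// ge0_fin_numE// (@le_lt_trans _ _ 1%E) ?ltry//.
by rewrite -(unif_measureT mv c_ge0 Lam_gt0 c_le t x) le_measure ?inE.
Qed.

(** Interpolation: the kernel over the remaining time is traded for the process, one step of length
    t / (m + 1) after the other, at the same cost each time. Chapman-Kolmogorov writes the kernel
    before a step as the image of the kernel after it. *)
Lemma integral_telescope t A m i : 0 <= t -> t <= m.+1%:R * eps0 -> (i <= m.+1)%N ->
  (\int[P]_(w in C) Pt t (X u w) A <=
   \int[P]_(w in C) Pt (t - i%:R * (t / m.+1%:R)) (X (u + i%:R * (t / m.+1%:R)) w) A
   + (i%:R * (K' * (t / m.+1%:R) ^+ 2))%:E)%E.
Proof.
move=> t0 tm; set eta := t / m.+1%:R.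
have eta0 : 0 <= eta by rewrite divr_ge0.
elim: i => [|i IH] im; first by rewrite !mul0r subr0 !addr0.
apply: (le_trans (IH (ltnW im))).
pose G z := fine (Pt (t - i.+1%:R * eta) z A).
pose r z := fine (Pt (t - i%:R * eta) z A).
have rest0 : 0 <= t - i.+1%:R * eta.
  by rewrite subr_ge0 /eta mulrCA ler_piMr// ler_pdivrMr// mul1r ler_nat.
under eq_integral do rewrite unif_kernel_fin.
under [X in (_ <= X + _)%E]eq_integral do rewrite unif_kernel_fin.
have -> : u + i.+1%:R * eta = u + i%:R * eta + eta by rewrite -natr1; ring.
have -> : i.+1%:R * (K' * eta ^+ 2) = K' * eta ^+ 2 + i%:R * (K' * eta ^+ 2).
  by rewrite -natr1; ring.
apply: leeD_EFin.
apply: (@integral_step G r).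
- by rewrite lerDl mulr_ge0.
- by rewrite eta0 /eta ler_pdivrMr// mulrC.
- move=> x; rewrite fine_ge0//= -lee_fin -unif_kernel_fin.
  by rewrite -(unif_measureT mv c_ge0 Lam_gt0 c_le (t - i.+1%:R * eta) x) le_measure ?inE.
- move=> z; rewrite -unif_kernel_fin.
  have -> : t - i%:R * eta = eta + (t - i.+1%:R * eta) by rewrite -natr1; ring.
  rewrite unif_kernelD//; apply: eq_integral => x _.
  by rewrite -unif_kernel_fin.
Qed.

(** After all m + 1 steps the remaining kernel is the identity, and the total error K' t^2 / (m + 1)
    vanishes as m grows. *)
Lemma integral_unif_kernel_le t A : 0 <= t ->
  (\int[P]_(w in C) Pt t (X u w) A <= P (C `&` X (u + t) @^-1` A))%E.
Proof.
move=> t0; apply/lee_addgt0Pr => e e0.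
(* Beyond the first bound the steps are at most [eps0], beyond the second the error is at most
   [e]. *)
pose b := Num.max (t / eps0) (K' * t ^+ 2 / e).
have K'0 : 0 <= K' by rewrite addr_ge0 ?sqr_ge0// mulr_ge0.
have b0 : 0 <= b by rewrite le_max divr_ge0// ltW.
pose m := Num.truncn b.
have mb : b < m.+1%:R by rewrite -truncn_lt_nat.
have m0 : 0 < m.+1%:R :> R by [].
have tm : t <= m.+1%:R * eps0.
  rewrite -ler_pdivrMr//; apply: ltW; apply: le_lt_trans mb.
  by rewrite le_max lexx.
apply: (le_trans (integral_telescope A t0 tm (leqnn _))).
have -> : m.+1%:R * (t / m.+1%:R) = t by rewrite mulrC divfK// gt_eqF.
rewrite subrr.
under eq_integral do rewrite unif_kernel0.
have mXA : measurable (X (u + t) @^-1` A).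
  by rewrite -[X in measurable X]setTI; apply: mX; rewrite ?addr_ge0.
rewrite [X in (X + _ <= _)%E](_ : _ = P (C `&` X (u + t) @^-1` A)); last first.
  rewrite -integral_indic// 1?setIC// integral_mkcond [RHS]integral_mkcond.
  apply: eq_integral => w _; rewrite /patch diracE/= indicE.
  have -> : (w \in X (u + t) @^-1` A) = (X (u + t) w \in A) by apply/idP/idP; rewrite !inE.
  by do 2 case: (_ \in _).
rewrite leeD2l// lee_fin.
have -> : m.+1%:R * (K' * (t / m.+1%:R) ^+ 2) = K' * t ^+ 2 / m.+1%:R.
  by field; rewrite gt_eqF.
rewrite ler_pdivrMr// [e * _]mulrC -ler_pdivrMr//; apply: ltW; apply: le_lt_trans mb.
by rewrite le_max lexx orbT.
Qed.

(* The lower bounds for [A] and for its complement add up to [P C], so that both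
   are equalities. *)
Lemma markov_of_local_bound t A : 0 <= t ->
  (P (C `&` X (u + t) @^-1` A) = \int[P]_(w in C) Pt t (X u w) A)%E.
Proof.
move=> t0.
have mXA B : measurable (X (u + t) @^-1` B).
  by rewrite -[X in measurable X]setTI; apply: mX; rewrite ?addr_ge0.
have mI B : measurable_fun C (fun w => Pt t (X u w) B).
  rewrite (_ : (fun w => _) = (fun w => (fine (Pt t (X u w) B))%:E)); last first.
    by apply/funext => w; rewrite -unif_kernel_fin.
  by apply: measurable_funTS; exact: (measurable_observable (fun x => fine (Pt t x B))).
have h1 := integral_unif_kernel_le A t0.
have h2 := integral_unif_kernel_le (~` A) t0.
have : (\int[P]_(w in C) Pt t (X u w) A + \int[P]_(w in C) Pt t (X u w) (~` A) =
        P (C `&` X (u + t) @^-1` A) + P (C `&` X (u + t) @^-1` (~` A)))%E.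
  rewrite -ge0_integralD//.
  rewrite (eq_integral (fun=> 1%E)); last first.
    move=> w _; rewrite -measureU//; last by rewrite setICr.
    by rewrite setUCr; exact: unif_measureT.
  rewrite integral_cst// mul1e -measureU.
  - by rewrite -setIUr -preimage_setU setUCr preimage_setT setIT.
  - exact: measurableI.
  - exact: measurableI.
  - by apply/seteqP; split=> w // [[_ h] [_ /= h']]; exact: h'.
have pm B : measurable (C `&` X (u + t) @^-1` B) by exact: measurableI.
have fi B : exists r, (\int[P]_(w in C) Pt t (X u w) B = r%:E)%E.
  exists (fine (\int[P]_(w in C) Pt t (X u w) B)); rewrite fineK// ge0_fin_numE.
    by rewrite (le_lt_trans (integral_unif_kernel_le B t0))// (prE P (pm B)) ltry.
  by apply: integral_ge0.
move: h1 h2; have [r1 ->] := fi A; have [r2 ->] := fi (~` A).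
rewrite !(prE P (pm _)) -!EFinD !lee_fin => h1 h2 [h3].
congr EFin; lra.
Qed.

End local_characterization.

(** * Generated sigma-algebras and histories *)

Section generated_sigma_algebra.
Context (T : pointedType) (G : set (set T)).

Lemma g_sigmaI A B : <<s G >> A -> <<s G >> B -> <<s G >> (A `&` B).
Proof. exact: (@measurableI _ (g_sigma_algebraType G)). Qed.

Lemma g_sigmaC A : <<s G >> A -> <<s G >> (~` A).
Proof. exact: (@measurableC _ (g_sigma_algebraType G)). Qed.

Lemma g_sigmaT : <<s G >> setT.
Proof. exact: (@measurableT _ (g_sigma_algebraType G)). Qed.

Lemma g_sigma_bigcup (F : (set T)^nat) :
  (forall n, <<s G >> (F n)) -> <<s G >> (\bigcup_n F n).
Proof. exact: (@bigcupT_measurable _ (g_sigma_algebraType G)). Qed.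

Lemma g_sigma_bigcap (F : (set T)^nat) :
  (forall n, <<s G >> (F n)) -> <<s G >> (\bigcap_n F n).
Proof. exact: (@bigcapT_measurable _ (g_sigma_algebraType G)). Qed.

Lemma g_sigma_gen A : G A -> <<s G >> A.
Proof. exact: sub_gen_smallest. Qed.

Lemma g_sigma_sub (H : set (set T)) : G `<=` <<s H >> -> <<s G >> `<=` <<s H >>.
Proof. by move=> GH; apply: smallest_sub => //; exact: smallest_sigma_algebra. Qed.

End generated_sigma_algebra.

Section history_theory.
Context (R : realType) (d d' : measure_display) (T : measurableType d)
  (S : measurableType d') (X : R -> T -> S).

Lemma history_state (I : set R) t A : I t -> 0 <= t -> measurable A ->
  history X I (X t @^-1` A).
Proof. by move=> It t0 mA; apply: g_sigma_gen; exists t, A. Qed.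

Lemma history_mono (I I' : set R) : I `<=` I' -> history X I `<=` history X I'.
Proof.
move=> II'; apply: g_sigma_sub => _ [t [A [It t0 mA ->]]].
by apply: history_state => //; exact: II'.
Qed.

Lemma history_measurable (I : set R) C :
  (forall t, 0 <= t -> measurable_fun setT (X t)) -> history X I C -> measurable C.
Proof.
move=> mX; apply: smallest_sub; first exact: sigma_algebra_measurable.
by move=> _ [t [A [_ t0 mA ->]]]; rewrite -[X in measurable X]setTI; exact: mX.
Qed.

End history_theory.

Lemma cvg_right0P (R : realType) (f : R -> R) (l e : R) :
  f t @[t --> 0^'+] --> l -> 0 < e ->
  exists2 del, 0 < del & forall t, 0 < t < del -> `|f t - l| < e.
Proof.
move=> fl e0; have [del /= del0 h] : \forall t \near 0^'+, `|f t - l| < e.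
  by move/cvgrPdist_lt : fl => /(_ _ e0); apply: filterS => t; rewrite distrC.
exists del => // t /andP[t0 tdel]; apply: h => //=.
by rewrite sub0r normrN gtr0_norm.
Qed.

Lemma indic_set1 (R : realType) (S : eqType) (x y : S) :
  \1_[set y] x = (x == y)%:R :> R.
Proof. by rewrite indicE; congr ((_ : bool)%:R); apply/idP/eqP; rewrite inE. Qed.

Lemma bernoulli_ineq (R : realType) (b : R) m : b <= 1 -> 1 - m%:R * b <= (1 - b) ^+ m.
Proof.
move=> b1; elim: m => [|m IH]; first by rewrite mul0r subr0 expr0.
rewrite exprS; apply: (@le_trans _ _ ((1 - b) * (1 - m%:R * b))); last first.
  by rewrite ler_wpM2l// subr_ge0.
have : 0 <= m%:R * b ^+ 2 by rewrite mulr_ge0// sqr_ge0.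
by rewrite -natr1; nra.
Qed.

(** * Short-time bounds for a semigroup with a given jump generator *)

Section small_time.
Context (R : realType) (d : measure_display) (S : measurableType d).
Hypothesis allm : forall A : set S, measurable A.
Context (J : finType) (mv : J -> S -> S) (c : J -> S -> R) (Lam : R).
Hypothesis c_ge0 : forall j x, 0 <= c j x.
Hypothesis Lam_gt0 : 0 < Lam.
Hypothesis c_le : forall x, \sum_j c j x <= Lam.
Hypothesis target_inj : forall x, injective (jump_target mv ^~ x).
Context (Q : R -> R.-pker S ~> S).
Hypothesis Q_semigroup : transition_semigroup setT Q.
Hypothesis Q_generator : semigroup_generator setT Q (jump_generator mv c).

Definition trans (t : R) (x y : S) : R := fine (Q t x [set y]).

Lemma transE t x y : Q t x [set y] = (trans t x y)%:E.
Proof.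
rewrite /trans fineK// ge0_fin_numE// (@le_lt_trans _ _ 1%E) ?ltry//.
by rewrite -(@prob_kernel _ _ _ _ _ (Q t) x) le_measure ?inE//; exact: allm.
Qed.

Lemma trans_ge0 t x y : 0 <= trans t x y.
Proof. exact: fine_ge0. Qed.

Lemma trans_chapman_ge s t x y (zs : seq S) : 0 <= s -> 0 <= t -> uniq zs ->
  \sum_(z <- zs) trans s x z * trans t z y <= trans (s + t) x y.
Proof.
move=> s0 t0 uzs; have [_ _ /(_ s t x [set y] s0 t0 I (allm _)) h] := Q_semigroup.
rewrite -lee_fin -transE h.
apply: (@le_trans _ _ (\int[Q s x]_(z in \big[setU/set0]_(z <- zs) [set z]) Q t z [set y])%E).
  rewrite ge0_integral_bigsetU//.
  - rewrite -sumEFin; apply: lee_sum => z _.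
    rewrite (eq_integral (fun=> (trans t z y)%:E)); last first.
      by move=> w; rewrite inE => /= ->; rewrite transE.
    by rewrite integral_cst//= transE -EFinM mulrC.
  - by move=> a b _ _ [w [/= -> ->]].
by apply: ge0_subset_integral => //; apply: allm.
Qed.

Lemma integral_trans t x y : \int[Q t x]_z (\1_[set y] z) = trans t x y.
Proof. by rewrite /Rintegral integral_indic// setIT. Qed.

Lemma trans_derivative x y :
  (trans t x y - \1_[set y] x) / t @[t --> 0^'+] --> jump_generator mv c \1_[set y] x.
Proof.
rewrite (_ : (fun t => _) = (fun t => (\int[Q t x]_z (\1_[set y] z) - \1_[set y] x) / t)).
  apply: Q_generator => //; exists 1 => z; rewrite indicE; case: (_ \in _); by rewrite ?normr1 ?normr0.
by apply/funext => t; rewrite integral_trans.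
Qed.

(** The derivative at 0 comes with no explicit rate of convergence. So [t] is cut into steps short
    enough for it, the chain is kept at [x] in each, and the inequality of Bernoulli bounds the
    product by a quantity free of their number. *)
Lemma trans_stay_ge t x : 0 <= t -> 1 - t * \sum_j c j x <= trans t x x.
Proof.
rewrite le_eqVlt => /orP[/eqP <-|t0].
  have [_ /(_ x [set x] I (allm _)) h _] := Q_semigroup.
  by rewrite mul0r subr0 /trans h diracE mem_set.
have der := @trans_derivative x x.
have gE : jump_generator mv c \1_[set x] x = - \sum_j c j x.
  rewrite -sumrN; apply: eq_bigr => j _; rewrite !indic_set1 eqxx.
  have /negbTE -> : mv j x != x by apply/eqP => h; have := @target_inj x (Some j) None h.
  by rewrite sub0r mulrN1.
rewrite gE indic_set1 eqxx -[_%:R]/(1 : R) in der.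
set a := \sum_j c j x in der *.
have a0 : 0 <= a by apply: sumr_ge0.
apply/ler_addgt0Pr => e e0; rewrite -lerBlDr.
pose e' := e / t; have e'0 : 0 < e' by rewrite divr_gt0.
have [del del0 hdel] := cvg_right0P der e'0.
pose b := Num.max (t / del) (t * (a + e')).
have b0 : 0 <= b by rewrite le_max divr_ge0// ltW.
pose m := Num.truncn b.
have mb : b < m.+1%:R by rewrite -truncn_lt_nat.
have m0 : 0 < m.+1%:R :> R by [].
pose eta := t / m.+1%:R; have eta0 : 0 < eta by rewrite divr_gt0.
have etadel : eta < del.
  rewrite ltr_pdivrMr// mulrC -ltr_pdivrMr//; apply: le_lt_trans mb.
  by rewrite le_max lexx.
have eta1 : eta * (a + e') <= 1.
  rewrite /eta mulrAC ler_pdivrMr// mul1r; apply: ltW; apply: le_lt_trans mb.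
  by rewrite le_max lexx orbT.
have step : 1 - eta * (a + e') <= trans eta x x.
  have := hdel eta; rewrite eta0 etadel => /(_ isT); rewrite ltr_distl => /andP[h _].
  by move: h; rewrite ltr_pdivlMr//; nra.
have iter n : (1 - eta * (a + e')) ^+ n.+1 <= trans (n.+1%:R * eta) x x.
  elim: n => [|n IH]; first by rewrite expr1 mul1r.
  have := @trans_chapman_ge (n.+1%:R * eta) eta x x [:: x].
  have -> : n.+2%:R * eta = n.+1%:R * eta + eta by rewrite -[n.+2%:R]natr1 mulrDl mul1r.
  rewrite big_seq1 => /(_ _ _ isT) h.
  apply: le_trans (h _ _); [|by rewrite mulr_ge0// ltW|exact: ltW].
  by rewrite exprSr ler_pM// ?exprn_ge0// subr_ge0.
have tE : m.+1%:R * eta = t by rewrite /eta mulrC divfK// gt_eqF.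
have := iter m; rewrite tE; apply: le_trans.
apply: le_trans (bernoulli_ineq m.+1 eta1).
by rewrite mulrA tE mulrDr /e' [t * (e / t)]mulrC divfK ?gt_eqF//; lra.
Qed.

Lemma c_le1 j x : c j x <= Lam.
Proof.
apply: le_trans (c_le x); rewrite (bigD1 j)//= lerDl; exact: sumr_ge0.
Qed.

(** The jump is placed in one of m + 1 short steps, with rest before and after: m + 1 disjoint ways
    of probability about [eta * c j x], each reduced by a rest probability of at least 1 - Lam t. *)
Lemma trans_jump_ge t j x : 0 <= t -> Lam * t <= 1 ->
  (1 - Lam * t) * (t * c j x) <= trans t x (mv j x).
Proof.
rewrite le_eqVlt => /orP[/eqP <-|t0 t1]; first by rewrite mul0r !mulr0 trans_ge0.
set y := mv j x.
have xy : x != y.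
  by apply/eqP => h; have := @target_inj x (Some j) None (esym h).
have der := @trans_derivative x y.
have gE : jump_generator mv c \1_[set y] x = c j x.
  rewrite /jump_generator (bigD1 j)//= big1 ?addr0.
    by rewrite !indic_set1 eqxx (negbTE xy) subr0 mulr1.
  move=> i ij; rewrite !indic_set1 (negbTE xy).
  have /negbTE -> : mv i x != y; last by rewrite subr0 mulr0.
  by apply/eqP => h; have [/eqP] := @target_inj x (Some i) (Some j) h; rewrite (negbTE ij).
rewrite gE indic_set1 (negbTE xy) -[_%:R]/(0 : R) in der.
apply/ler_addgt0Pr => e e0.
pose e' := e / t; have e'0 : 0 < e' by rewrite divr_gt0.
have [del del0 hdel] := cvg_right0P der e'0.
pose m := Num.truncn (t / del).
have mb : t / del < m.+1%:R by rewrite -truncn_lt_nat// divr_ge0// ltW.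
have m0 : 0 < m.+1%:R :> R by [].
pose eta := t / m.+1%:R; have eta0 : 0 < eta by rewrite divr_gt0.
have etadel : eta < del by rewrite ltr_pdivrMr// mulrC -ltr_pdivrMr.
have step : eta * (c j x - e') <= trans eta x y.
  have := hdel eta; rewrite eta0 etadel => /(_ isT); rewrite ltr_distl subr0 => /andP[h _].
  by move: h; rewrite ltr_pdivlMr//; lra.
have tE : m.+1%:R * eta = t by rewrite /eta mulrC divfK// gt_eqF.
have stay s z : 0 <= s -> 1 - Lam * s <= trans s z z.
  move=> s0; apply: le_trans (trans_stay_ge z s0).
  by rewrite lerD2l lerN2 mulrC ler_wpM2r.
have iter n : (n < m.+1)%N ->
    n.+1%:R * (1 - Lam * (n.+1%:R * eta)) * trans eta x y <= trans (n.+1%:R * eta) x y.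
  elim: n => [|n IH] nm.
    rewrite !mul1r ler_piMl ?trans_ge0// gerBl mulr_ge0// ltW//.
  have {}IH := IH (ltnW nm).
  (* After n + 1 steps the chain is still at [x] and jumps next, or is already at [y] and stays. *)
  have := @trans_chapman_ge (n.+1%:R * eta) eta x y [:: x; y].
  have -> : n.+2%:R * eta = n.+1%:R * eta + eta by rewrite -[n.+2%:R]natr1 mulrDl mul1r.
  rewrite big_cons big_seq1 /= inE xy /= -[n.+2%:R]natr1.
  have neta0 : 0 <= n.+1%:R * eta by rewrite mulr_ge0// ltW.
  move=> /(_ neta0 (ltW eta0) isT); apply: le_trans.
  have nt : Lam * (n.+1%:R * eta) <= 1.
    apply: le_trans t1; rewrite ler_pM2l// -tE ler_wpM2r ?(ltW eta0)// ler_nat; exact: ltnW.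
  have a0 := trans_ge0 eta x y.
  have h1 := stay _ x neta0.
  have h2 := stay _ y (ltW eta0).
  have Le : Lam * eta <= 1.
    apply: le_trans t1; rewrite ler_pM2l// -tE -[leLHS]mul1r ler_wpM2r ?(ltW eta0)//.
    by rewrite ler1n.
  apply: (@le_trans _ _ ((1 - Lam * (n.+1%:R * eta)) * trans eta x y +
    n.+1%:R * (1 - Lam * (n.+1%:R * eta)) * trans eta x y * (1 - Lam * eta))); last first.
    apply: lerD; first by rewrite ler_wpM2r.
    by rewrite ler_pM// ?subr_ge0// !mulr_ge0// subr_ge0.
  rewrite -subr_ge0.
  have -> : (1 - Lam * (n.+1%:R * eta)) * trans eta x y +
    n.+1%:R * (1 - Lam * (n.+1%:R * eta)) * trans eta x y * (1 - Lam * eta) -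
    (n.+1%:R + 1) * (1 - Lam * (n.+1%:R * eta + eta)) * trans eta x y =
    trans eta x y * (Lam * eta + (n.+1%:R * (Lam * eta)) ^+ 2) by ring.
  by rewrite mulr_ge0// addr_ge0 ?sqr_ge0// mulr_ge0// ltW.
have := iter m (leqnn _); rewrite tE => h.
rewrite -lerBlDr; apply: le_trans h.
have h1 : 0 <= m.+1%:R * (1 - Lam * t) by rewrite mulr_ge0// subr_ge0.
apply: le_trans (ler_wpM2l h1 step).
have -> : m.+1%:R * (1 - Lam * t) * (eta * (c j x - e')) =
    (1 - Lam * t) * (m.+1%:R * eta * (c j x - e')) by ring.
have -> : (1 - Lam * t) * (m.+1%:R * eta * (c j x - e')) =
    (1 - Lam * t) * (t * c j x) - (1 - Lam * t) * e.
  by rewrite tE /e'; field; rewrite gt_eqF.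
rewrite lerD2l lerN2 ler_piMl ?(ltW e0)// gerBl mulr_ge0// ltW//.
Qed.

End small_time.

(** * One random walk *)

Section markov_chain_kernel.
Context (R : realType) (d d' : measure_display) (T : measurableType d)
  (S : measurableType d') (P : probability T R).
Hypothesis allm : forall A : set S, measurable A.
Context (enc : S -> nat).
Hypothesis enc_inj : injective enc.
Context (J : finType) (mv : J -> S -> S) (c : J -> S -> R) (Lam : R).
Hypothesis c_ge0 : forall j x, 0 <= c j x.
Hypothesis Lam_gt0 : 0 < Lam.
Hypothesis c_le : forall x, \sum_j c j x <= Lam.
Hypothesis target_inj : forall x, injective (jump_target mv ^~ x).
Local Notation Pt := (unif_kernel allm mv c_ge0 Lam_gt0 c_le).

(** The kernel of [X] is known only through its generator. Its short-time bounds feed the local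
    characterization, which identifies it along [X] with the uniformized kernel; no uniqueness
    theorem for semigroups is invoked. *)
Lemma markov_chain_unif_kernel (X : R -> T -> S) (x0 : S) (u t : R) (C : set T) (A : set S) :
  markov_chain P setT (jump_generator mv c) x0 X ->
  0 <= u -> 0 <= t -> history X `[0, u] C ->
  (P (C `&` X (u + t)%R @^-1` A) = \int[P]_(w in C) Pt t (X u w) A)%E.
Proof.
move=> [Q [Qs [Qg [mX [_ [_ mkv]]]]]] u0 t0 hC.
have mC : measurable C := history_measurable mX hC.
(* The factor 1 - Lam eps in the bound for a jump costs at most Lam^2 eps^2, and eps <= 1 / Lam
   keeps it nonnegative. *)
apply: (@markov_of_local_bound _ _ _ _ _ _ allm enc enc_inj _ _ _ _ c_ge0 Lam_gt0 c_le
  target_inj X C u (Lam ^+ 2) Lam^-1) => //; rewrite ?sqr_ge0 ?invr_gt0//.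
move=> v z eps o uv /andP[e0 e1].
have v0 : 0 <= v := le_trans u0 uv.
have Le1 : Lam * eps <= 1 by rewrite -ler_pdivlMl// mulr1.
have hD : history X `[0, v] (C `&` [set w | X v w = z]).
  apply: g_sigmaI.
    by apply: history_mono hC => s /=; rewrite !in_itv/= => /andP[-> /le_trans ->].
  by apply: (history_state _ v0 (allm [set z])); rewrite /= in_itv/= v0 lexx.
have mD := history_measurable mX hD.
set y := jump_target mv o z.
have -> : pr P (C `&` [set w | X v w = z] `&` [set w | X (v + eps) w = y]) =
    pr P (C `&` [set w | X v w = z]) * trans Q eps z y.
  apply: EFin_inj; rewrite -prE; last first.
    apply: measurableI => //.
    by apply: (measurable_state allm mX); rewrite addr_ge0.
  have := mkv v eps _ [set y] v0 e0 hD (allm _).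
  rewrite [X in P X](_ : _ = (C `&` [set w | X v w = z]) `&` [set w | X (v + eps) w = y])// => ->.
  rewrite (eq_integral (fun=> (trans Q eps z y)%:E)); last first.
    by move=> w; rewrite inE => -[_ /= ->]; rewrite transE.
  by rewrite integral_cst// EFinM -prE// muleC.
rewrite ler_wpM2l ?pr_ge0// /jump_lower_bound.
have h1 := trans_stay_ge allm c_ge0 target_inj Qs Qg z e0.
case: o @y => [j|] y.
  have h2 := trans_jump_ge allm c_ge0 Lam_gt0 c_le target_inj Qs Qg j z e0 Le1.
  apply: le_trans h2.
  have := c_le1 c_ge0 c_le j z; have := c_ge0 j z.
  have := Lam_gt0; set a := c j z => L0 a0 aL.
  have : 0 <= Lam * eps ^+ 2 * (Lam - a).
    by rewrite mulr_ge0 ?subr_ge0// mulr_ge0 ?sqr_ge0// ltW.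
  by nra.
by apply: le_trans h1; rewrite gerBl mulr_ge0// sqr_ge0.
Qed.

End markov_chain_kernel.

Lemma measurable_int (A : set int) : measurable A.
Proof. by []. Qed.

Lemma measurable_rV N (A : set 'rV[int]_N) : measurable A.
Proof. by []. Qed.

Definition walk_move (b : bool) (k : int) : int := if b then k + 1 else k - 1.

Lemma walk_target_inj k : injective (jump_target walk_move ^~ k).
Proof. by move=> [[]|] [[]|] //=; lia. Qed.

Section walk.
Context (R : realType) (p : R).
Hypothesis p01 : 0 <= p <= 1.

Definition walk_rate (b : bool) (k : int) : R := if b then p else 1 - p.

Lemma walk_rate_ge0 b k : 0 <= walk_rate b k.
Proof. by case: b => //=; rewrite ?subr_ge0; case/andP: p01. Qed.

Lemma walk_rate_sum k : \sum_b walk_rate b k <= 1.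
Proof. by rewrite big_bool /= addrC subrK. Qed.

Lemma walk_generatorE : rw_generator p = jump_generator walk_move walk_rate.
Proof. by apply/funext => F; apply/funext => k; rewrite /jump_generator big_bool. Qed.

(** One explicit kernel for all coordinates and starting points, each of which has a kernel of its
    own in [markov_chain]. *)
Definition walk_trans (t : R) (k l : int) : R :=
  trans (unif_kernel measurable_int walk_move walk_rate_ge0 ltr01 walk_rate_sum) t k l.

Lemma walk_trans_ge0 t k l : 0 <= walk_trans t k l.
Proof. exact: trans_ge0. Qed.

Lemma walk_trans_bound t k o : 0 <= t <= 1 ->
  (1 - t) * (if o is Some b then t * walk_rate b k else 1) <=
  walk_trans t k (jump_target walk_move o k).
Proof.
move=> /andP[t0 t1].
have cl : forall (y : int) (j : bool), [set: int] y -> walk_rate j y != 0 ->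
  [set: int] (walk_move j y) by [].
have [Qs Qg] := unif_kernel_semigroup measurable_int walk_rate_ge0 (@ltr01 R) walk_rate_sum cl.
case: o => [b|] /=.
  have := trans_jump_ge measurable_int walk_rate_ge0 ltr01 walk_rate_sum walk_target_inj Qs Qg b k t0.
  by rewrite mul1r => /(_ t1).
rewrite mulr1; apply: le_trans (trans_stay_ge measurable_int walk_rate_ge0 walk_target_inj Qs Qg k t0).
by rewrite lerD2l lerN2 ler_piMr// walk_rate_sum.
Qed.

Lemma walk_markov d (T : measurableType d) (P : probability T R) (X : R -> T -> int)
    (x0 : int) u t (C : set T) k l :
  markov_chain P setT (rw_generator p) x0 X -> 0 <= u -> 0 <= t ->
  history X `[0, u] C ->
  pr P (C `&` [set w | X u w = k] `&` [set w | X (u + t) w = l]) =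
  pr P (C `&` [set w | X u w = k]) * walk_trans t k l.
Proof.
move=> mc u0 t0 hC.
have mX : forall t, 0 <= t -> measurable_fun setT (X t).
  by case: mc => Q [_ [_ []]].
have hD : history X `[0, u] (C `&` [set w | X u w = k]).
  apply: g_sigmaI => //.
  by apply: (history_state (A := [set k])) => //=; rewrite in_itv/= u0 lexx.
have mD := history_measurable mX hD.
have mDt : measurable (C `&` [set w | X u w = k] `&` [set w | X (u + t) w = l]).
  apply: measurableI => //.
  by apply: (@measurable_state _ _ _ _ _ measurable_int X mX); rewrite addr_ge0.
apply: EFin_inj; rewrite -prE//.
rewrite walk_generatorE in mc.
have := @markov_chain_unif_kernel _ _ _ _ _ P measurable_int _ (pcan_inj pickleK)
  _ _ _ _ walk_rate_ge0 ltr01 walk_rate_sum walk_target_inj X x0 u t _ [set l] mc u0 t0 hD.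
rewrite [X in P X](_ : _ = C `&` [set w | X u w = k] `&` [set w | X (u + t) w = l])// => ->.
rewrite (eq_integral (fun=> (walk_trans t k l)%:E)); last first.
  by move=> w; rewrite inE => -[_ /= ->]; exact: unif_kernel_fin.
by rewrite integral_cst// EFinM -prE// muleC.
Qed.

End walk.

(** * The system of independent walks *)

Section paths.
Context (R : realType).

Definition cylinder (S : eqType) (U : Type) (X : R -> U -> S) (l : seq (R * S)) : set U :=
  [set w | forall tz, tz \in l -> X tz.1 w = tz.2].

Lemma cylinder_cons (S : eqType) (U : Type) (X : R -> U -> S) tz l :
  cylinder X (tz :: l) = [set w | X tz.1 w = tz.2] `&` cylinder X l.
Proof.
apply/seteqP; split=> w.
  by move=> h; split=> [|tz' tzl]; apply: h; rewrite inE ?eqxx ?tzl ?orbT.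
by move=> [h1 h2] tz'; rewrite inE => /orP[/eqP ->//|]; exact: h2.
Qed.

Lemma cylinder_nil (S : eqType) (U : Type) (X : R -> U -> S) : cylinder X [::] = setT.
Proof. by apply/seteqP; split. Qed.

Lemma cylinder_cat (S : eqType) (U : Type) (X : R -> U -> S) l l' :
  cylinder X (l ++ l') = cylinder X l `&` cylinder X l'.
Proof.
elim: l => [|tz l IH]; first by rewrite cylinder_nil setTI.
by rewrite cat_cons !cylinder_cons IH setIA.
Qed.

Lemma cylinder_perm (S : eqType) (U : Type) (X : R -> U -> S) l l' : l =i l' ->
  cylinder X l = cylinder X l'.
Proof.
by move=> ll'; apply/seteqP; split=> w h tz tzl; apply: h; rewrite ?ll'// -ll'.
Qed.

Definition nonneg_times (S : Type) (l : seq (R * S)) : bool := all (fun tz => 0 <= tz.1) l.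

Section path_space.
Context (d : measure_display) (S : measurableType d).
Hypothesis allm : forall A : set S, measurable A.

Let path_generators : set (set (R -> S)) :=
  [set B | exists (t : R) (A : set S),
     [/\ 0 <= t, measurable A & B = [set f : R -> S | A (f t)]]].

Local Notation path_space := (g_sigma_algebraType path_generators).

Lemma path_event_state t A : 0 <= t -> path_events [set f : R -> S | A (f t)].
Proof. by move=> t0; apply: g_sigma_gen; exists t, A. Qed.

Lemma measurable_path_map d' (T : measurableType d') (Z : R -> T -> S) :
  (forall t, 0 <= t -> measurable_fun setT (Z t)) ->
  measurable_fun setT (fun w => Z ^~ w : path_space).
Proof.
move=> mZ; apply: (@measurability _ _ _ path_space setT _ path_generators) => //.
by move=> _ [_ [t [A [t0 mA ->]] <-]]; exact: mZ.
Qed.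

Lemma measurable_path_event d' (T : measurableType d') (Z : R -> T -> S) B :
  (forall t, 0 <= t -> measurable_fun setT (Z t)) -> @path_events R _ S B ->
  measurable [set w | B (Z ^~ w)].
Proof.
move=> mZ hB; rewrite -[X in measurable X]setTI.
exact: (measurable_path_map mZ measurableT hB).
Qed.

Let cylinders : set (set path_space) :=
  [set B | exists2 l : seq (R * S), nonneg_times l & B = cylinder (fun t (f : R -> S) => f t) l].

Let cylinders_measurable : cylinders `<=` measurable.
Proof.
move=> _ [l l0 ->]; elim: l l0 => [|tz l IH] /=; first by rewrite cylinder_nil.
move=> /andP[t0 /IH ml]; rewrite cylinder_cons; apply: measurableI => //.
exact: (@path_event_state tz.1 [set tz.2]).
Qed.

(** Cylinders over single states are stable under intersection and, the states being countable,
    generate the path events. Two processes and two measures are allowed, so that the shifted walks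
    can be compared with restarted ones. *)
Lemma path_law_unique d1 d2 (T1 : measurableType d1) (T2 : measurableType d2)
    (m1 : {measure set T1 -> \bar R}) (m2 : {measure set T2 -> \bar R})
    (Z1 : R -> T1 -> S) (Z2 : R -> T2 -> S) (enc : S -> nat) B :
  injective enc ->
  (forall t, 0 <= t -> measurable_fun setT (Z1 t)) ->
  (forall t, 0 <= t -> measurable_fun setT (Z2 t)) ->
  (m1 setT < +oo)%E ->
  (forall l, nonneg_times l -> m1 (cylinder Z1 l) = m2 (cylinder Z2 l)) ->
  @path_events R _ S B ->
  m1 [set w | B (Z1 ^~ w)] = m2 [set w | B (Z2 ^~ w)].
Proof.
move=> enc_inj mZ1 mZ2 m1T m12 hB.
have mP1 := measurable_path_map mZ1; have mP2 := measurable_path_map mZ2.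
pose M1 : {measure set path_space -> \bar R} := pushforward m1 (fun w => Z1 ^~ w : path_space).
pose M2 : {measure set path_space -> \bar R} := pushforward m2 (fun w => Z2 ^~ w : path_space).
have C0 : cylinders setT by exists [::] => //; rewrite cylinder_nil.
rewrite -[LHS]/(M1 mP1 B) -[RHS]/(M2 mP2 B).
apply: (@g_sigma_algebra_measure_unique _ _ _ cylinders cylinders_measurable
  (fun=> setT) (fun=> C0)).
- by apply/seteqP; split=> // w _; exists 0%N.
- by move=> _ _ [l l0 ->] [l' l'0 ->]; exists (l ++ l');
    rewrite ?cylinder_cat// /nonneg_times all_cat; apply/andP; split.
- by move=> _ [l l0 ->]; exact: m12.
- by move=> _; rewrite /M1 /= /pushforward preimage_setT.
apply: smallest_sub hB; first exact: smallest_sigma_algebra.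
move=> _ [t [A [t0 _ ->]]].
apply: (@measurable_countable_preimage S enc enc_inj _ (g_sigma_algebraType cylinders)
  (fun f => f t) A) => z.
apply: g_sigma_gen; exists [:: (t, z)]; first by rewrite /nonneg_times /= t0.
by rewrite cylinder_cons cylinder_nil setIT.
Qed.

End path_space.
End paths.

(** * Markov property of the joint walks *)

Section walks.
Context (R : realType) (p : R) (N : nat).
Hypothesis p01 : 0 <= p <= 1.
Local Notation V := ('rV[int]_N).

Definition walks_trans (t : R) (x z : V) : R :=
  \prod_(i < N) walk_trans p01 t (x 0 i) (z 0 i).

Lemma walks_trans_ge0 t x z : 0 <= walks_trans t x z.
Proof. by apply: prodr_ge0 => i _; exact: walk_trans_ge0. Qed.

Context (d : measure_display) (T : measurableType d).

Section one_start.
Context (P : probability T R) (x0 : V) (Y : R -> T -> V).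
Hypothesis hY : independent_rws P p x0 Y.
Local Notation Yi := (fun (i : 'I_N) t w => Y t w 0 i).

Lemma measurable_coordinate i t : 0 <= t -> measurable_fun setT (Yi i t).
Proof. by move=> t0; have [/(_ i) [Q [_ [_ [m _]]]] _] := hY; exact: m. Qed.

Lemma walks_stateE t z :
  [set w | Y t w = z] = \bigcap_(i in [set: 'I_N]) [set w | Yi i t w = z 0 i].
Proof.
apply/seteqP; split=> [w <- i _ //|w h]; apply/rowP => i; exact: h.
Qed.

Lemma bigcap_ordI (A B : 'I_N -> set T) :
  (\bigcap_(i in [set: 'I_N]) A i) `&` (\bigcap_(i in [set: 'I_N]) B i) =
  \bigcap_(i in [set: 'I_N]) (A i `&` B i).
Proof.
by apply/seteqP; split=> [w [h1 h2] i _|w h]; split; [exact: h1|exact: h2|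
  move=> i /h []|move=> i /h []].
Qed.

Lemma measurable_walks t : 0 <= t -> measurable_fun setT (Y t).
Proof.
move=> t0 _ A _; rewrite setTI.
apply: (@measurable_countable_preimage _ _ (pcan_inj pickleK)) => z.
rewrite walks_stateE; apply: fin_bigcap_measurable => // i _.
by rewrite -[X in measurable X]setTI; exact: (measurable_coordinate i t0 measurableT (measurable_int [set z 0 i])).
Qed.

Lemma pr_independent (A : 'I_N -> set T) : (forall i, history (Yi i) setT (A i)) ->
  pr P (\bigcap_(i in [set: 'I_N]) A i) = \prod_(i < N) pr P (A i).
Proof. by have [_] := hY; apply. Qed.

Lemma walks_start : pr P [set w | Y 0 w = x0] = 1.
Proof.
rewrite walks_stateE pr_independent; last first.
  by move=> i; apply: (history_state (A := [set x0 0 i])).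
rewrite big1// => i _; rewrite /pr.
by have [/(_ i) [Q [_ [_ [_ [-> _]]]]] _] := hY.
Qed.

(** Rectangles of single-coordinate histories: a pi-system on which independence applies
    directly. *)
Let coordinate_events (u : R) : set (set T) :=
  [set C | exists2 A : 'I_N -> set T, forall i, history (Yi i) `[0, u] (A i) &
    C = \bigcap_(i in [set: 'I_N]) A i].

Let coordinate_events_measurable u : coordinate_events u `<=` measurable.
Proof.
move=> _ [A hA ->]; apply: fin_bigcap_measurable => // i _.
by apply: history_measurable (hA i) => t; exact: measurable_coordinate.
Qed.

Let history_coordinate u : history Y `[0, u] `<=` <<s coordinate_events u>>.
Proof.
apply: smallest_sub; first exact: smallest_sigma_algebra.
move=> _ [t [A [tu t0 _ ->]]].
apply: (@measurable_countable_preimage _ _ (pcan_inj pickleK) _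
  (g_sigma_algebraType (coordinate_events u)) (Y t) A) => z.
apply: g_sigma_gen; exists (fun i => [set w | Yi i t w = z 0 i]); last exact: walks_stateE.
by move=> i; apply: (history_state (A := [set z 0 i])).
Qed.

(** Both sides are finite measures in [C]. On rectangles they factor by independence into the Markov
    property of each coordinate, and the rectangles generate the history of the joint walk. *)
Lemma walks_markov u t (C : set T) x z : 0 <= u -> 0 <= t -> history Y `[0, u] C ->
  pr P (C `&` [set w | Y u w = x] `&` [set w | Y (u + t) w = z]) =
  pr P (C `&` [set w | Y u w = x]) * walks_trans t x z.
Proof.
move=> u0 t0 hC.
have ut0 : 0 <= u + t by rewrite addr_ge0.
have mS s y : 0 <= s -> measurable [set w | Y s w = y].
  by move=> s0; exact: (@measurable_state _ _ _ _ _ (@measurable_rV N) Y measurable_walks).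
have mx := mS u x u0; have mxz := measurableI _ _ mx (mS _ z ut0).
have k0 := walks_trans_ge0 t x z.
pose m1 : {measure set T -> \bar R} := mrestr P mxz.
pose m2 : {measure set T -> \bar R} := mscale (NngNum k0) (mrestr P mx).
suff : m1 C = m2 C.
  rewrite /m1 /m2 /= /mscale/= /mrestr/= setIA => h.
  have mC : measurable C by apply: history_measurable hC; exact: measurable_walks.
  apply: EFin_inj; rewrite [RHS]EFinM -!prE; [by rewrite muleC h| |].
  - exact: measurableI.
  - by apply: measurableI; [exact: measurableI|exact: mS].
have G0 : coordinate_events u setT.
  exists (fun=> setT) => [i|]; first exact: g_sigmaT.
  by apply/seteqP; split.
apply: (@g_sigma_algebra_measure_unique _ _ _ (coordinate_events u)
  (@coordinate_events_measurable u) (fun=> setT) (fun=> G0)).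
- by apply/seteqP; split=> // w _; exists 0%N.
- move=> _ _ [A hA ->] [B hB ->]; exists (fun i => A i `&` B i).
    by move=> i; exact: g_sigmaI (hA i) (hB i).
  exact: bigcap_ordI.
- move=> _ [A hA ->]; rewrite /m1 /m2 /= /mscale/= /mrestr/= setIA.
  rewrite !walks_stateE !bigcap_ordI.
  have hA' i : history (Yi i) setT (A i `&` [set w | Yi i u w = x 0 i]).
    apply: g_sigmaI; first by apply: history_mono (hA i).
    exact: (history_state (A := [set x 0 i])).
  have hA'' i : history (Yi i) setT (A i `&` [set w | Yi i u w = x 0 i] `&`
     [set w | Yi i (u + t) w = z 0 i]).
    apply: (g_sigmaI (hA' i)).
    exact: (@history_state _ _ _ _ _ (fun t w => Y t w 0 i) setT (u + t) [set z 0 i]).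
  have mh i B : history (Yi i) setT B -> measurable B.
    by apply: history_measurable => s; exact: measurable_coordinate.
  rewrite !prE; last 2 first.
  - by apply: fin_bigcap_measurable => // i _; exact: mh (hA' i).
  - by apply: fin_bigcap_measurable => // i _; exact: mh (hA'' i).
  rewrite -EFinM; congr EFin.
  rewrite !pr_independent// /walks_trans -big_split; apply: eq_bigr => i _ /=.
  rewrite mulrC; have [mc _] := hY.
  exact: (walk_markov p01 _ _ (mc i) u0 t0 (hA i)).
- move=> _; rewrite /m1/= /mrestr setTI (prE P mxz); exact: ltry.
- exact: history_coordinate.
Qed.

End one_start.

(** Meant for lists sorted in time, with the walks at [x] at time [s]. *)
Fixpoint walks_fdd (s : R) (x : V) (l : seq (R * V)) : R :=
  if l is (t, z) :: l' then walks_trans (t - s) x z * walks_fdd t z l' else 1.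

Definition time_le (S : Type) : rel (R * S) := fun a b => a.1 <= b.1.

Section path_markov.
Context (Pr : V -> probability T R) (Y : R -> T -> V).
Hypothesis hY : forall x, independent_rws (Pr x) p x Y.

Let mY t : 0 <= t -> measurable_fun setT (Y t) := @measurable_walks _ _ _ (hY 0) t.

Lemma measurable_walk_state s y : 0 <= s -> measurable [set w | Y s w = y].
Proof. by move=> s0; exact: (@measurable_state _ _ _ _ _ (@measurable_rV N) Y mY). Qed.

Lemma measurable_cylinder r l : 0 <= r -> nonneg_times l ->
  measurable (cylinder (fun s => Y (r + s)) l).
Proof.
move=> r0; elim: l => [|tz l IH] /=; first by rewrite cylinder_nil.
move=> /andP[t0 /IH ml]; rewrite cylinder_cons; apply: measurableI => //.
by apply: measurable_walk_state; rewrite addr_ge0.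
Qed.

Lemma walks_sorted_cylinder x0 r s x l C : 0 <= r -> 0 <= s ->
  all (fun tz => s <= tz.1) l -> sorted (@time_le V) l ->
  history Y `[0, r + s] C ->
  pr (Pr x0) (C `&` [set w | Y (r + s) w = x] `&` cylinder (fun s => Y (r + s)) l) =
  pr (Pr x0) (C `&` [set w | Y (r + s) w = x]) * walks_fdd s x l.
Proof.
move=> r0; elim: l C s x => [|[t z] l IH] C s x s0 /=.
  by rewrite cylinder_nil setIT mulr1.
move=> /andP[st sl] tl hC.
have t0 : 0 <= t by rewrite (le_trans s0).
have rs0 : 0 <= r + s by rewrite addr_ge0.
rewrite cylinder_cons /= setIA IH//; last 3 first.
- by apply: order_path_min tl => a b c; exact: le_trans.
- exact: path_sorted tl.
- apply: g_sigmaI.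
    apply: history_mono hC => v /=; rewrite !in_itv/= => /andP[-> /le_trans ->]//.
    by rewrite lerD2l.
  by apply: (history_state (A := [set x])) => //=; rewrite in_itv/= rs0 lerD2l.
have -> : r + t = r + s + (t - s) by ring.
rewrite (walks_markov (hY x0))// ?subr_ge0//.
by rewrite mulrA.
Qed.

Lemma pr_cylinder x l : nonneg_times l -> sorted (@time_le V) l ->
  pr (Pr x) (cylinder Y l) = walks_fdd 0 x l.
Proof.
move=> l0 sl.
have := @walks_sorted_cylinder x 0 0 x l setT (lexx _) (lexx _) l0 sl (@g_sigmaT _ _).
rewrite !setTI addr0 (walks_start (hY x)) mul1r => <-.
have -> : (fun s => Y (0 + s)) = Y by apply/funext => s; rewrite add0r.
rewrite setIC prI1//; last exact: walks_start.
- by have := measurable_cylinder (lexx 0) l0; under eq_fun do rewrite add0r.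
- exact: measurable_walk_state.
Qed.

(** A cylinder does not depend on the order of its constraints, so they may be sorted in time. *)
Lemma walks_markov_cylinder x0 r x l C : 0 <= r -> nonneg_times l ->
  history Y `[0, r] C ->
  pr (Pr x0) (C `&` [set w | Y r w = x] `&` cylinder (fun s => Y (r + s)) l) =
  pr (Pr x0) (C `&` [set w | Y r w = x]) * pr (Pr x) (cylinder Y l).
Proof.
move=> r0 l0 hC.
pose l' := sort (@time_le V) l.
have l'l : l' =i l by move=> tz; rewrite mem_sort.
have sl' : sorted (@time_le V) l' by apply: sort_sorted => a b; exact: le_total.
have l'0 : nonneg_times l' by rewrite /nonneg_times (eq_all_r l'l).
rewrite -(cylinder_perm _ l'l) -(cylinder_perm _ l'l) pr_cylinder//.
have := @walks_sorted_cylinder x0 r 0 x l' C r0 (lexx _) l'0 sl'.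
by rewrite addr0; apply.
Qed.

(** The law of the shifted walks on the past event and a multiple of the law under [Pr x] agree on
    cylinders, hence on all path events. *)
Lemma walks_path_markov x0 r x C (B : set (R -> V)) : 0 <= r -> history Y `[0, r] C ->
  path_events B ->
  pr (Pr x0) (C `&` [set w | Y r w = x] `&` [set w | B (fun s => Y (r + s) w)]) =
  pr (Pr x0) (C `&` [set w | Y r w = x]) * pr (Pr x) [set w | B (Y ^~ w)].
Proof.
move=> r0 hC hB.
have mD : measurable (C `&` [set w | Y r w = x]).
  apply: measurableI; last exact: measurable_walk_state.
  exact: history_measurable mY hC.
have c0 := pr_ge0 (Pr x0) (C `&` [set w | Y r w = x]).
pose m1 : {measure set T -> \bar R} := mrestr (Pr x0) mD.
pose m2 : {measure set T -> \bar R} := mscale (NngNum c0) (Pr x).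
have mYr s : 0 <= s -> measurable_fun setT (Y (r + s)).
  by move=> s0; apply: mY; rewrite addr_ge0.
have mB := measurable_path_event mY hB.
have mBr := measurable_path_event mYr hB.
suff : m1 [set w | B (fun s => Y (r + s) w)] = m2 [set w | B (Y ^~ w)].
  rewrite /m1 /m2 /= /mscale/= /mrestr/= setIC => h.
  apply: EFin_inj; rewrite [RHS]EFinM -(prE (Pr x) mB) -h -prE//.
  exact: measurableI.
apply: (@path_law_unique R _ _ (@measurable_rV N) _ _ T T m1 m2 _ _ _ _ (pcan_inj pickleK)) => //.
- by rewrite /m1/= /mrestr setTI (prE _ mD) ltry.
- move=> l l0; rewrite /m1 /m2 /= /mscale/= /mrestr/= setIC.
  have h := walks_markov_cylinder x0 x r0 l0 hC.
  have ml := measurable_cylinder r0 l0.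
  have ml' : measurable (cylinder Y l).
    by have := measurable_cylinder (lexx 0) l0; under eq_fun do rewrite add0r.
  rewrite (prE _ ml') -EFinM -h -prE//; exact: measurableI.
Qed.

End path_markov.

End walks.

(** * Right-continuous paths *)

Section right_continuity.
Context (R : realType) (S : Type).
Implicit Types (f : R -> S) (A : set S).

(** Right-continuity for the discrete topology. Values in [Prop] occur as well, to follow the truth
    of an event along time. *)
Definition right_cont f : Prop := forall t, 0 <= t ->
  exists2 del, 0 < del & forall s, t <= s < t + del -> f s = f t.

Lemma near_right (Q : R -> Prop) (t : R) :
  (\forall u \near t^'+, Q u) -> exists2 del, 0 < del & forall s, t < s < t + del -> Q s.
Proof.
move=> [del /= del0 h]; exists del => // s /andP[ts sdel].
by apply: h => //=; rewrite distrC gtr0_norm ?subr_gt0//; lra.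
Qed.

Lemma near_rightI (Q : R -> Prop) (t : R) :
  (exists2 del, 0 < del & forall s, t < s < t + del -> Q s) -> \forall u \near t^'+, Q u.
Proof.
move=> [del del0 h]; exists del => //= s.
by move=> /[swap] ts /=; rewrite distrC gtr0_norm ?subr_gt0// => sd; apply: h; rewrite ts /=; lra.
Qed.

Lemma near_left (Q : R -> Prop) (t : R) :
  (\forall u \near t^'-, Q u) -> exists2 del, 0 < del & forall s, t - del < s < t -> Q s.
Proof.
move=> [del /= del0 h]; exists del => // s /andP[sdel ts].
by apply: h => //=; rewrite gtr0_norm ?subr_gt0//; lra.
Qed.

Lemma near_leftI (Q : R -> Prop) (t : R) :
  (exists2 del, 0 < del & forall s, t - del < s < t -> Q s) -> \forall u \near t^'-, Q u.
Proof.
move=> [del del0 h]; exists del => //= s.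
by move=> /[swap] ts /=; rewrite gtr0_norm ?subr_gt0// => sd; apply: h; rewrite ts andbT; lra.
Qed.

Lemma cadlag_right_cont f : cadlag f -> right_cont f.
Proof.
move=> cf t t0; have [/near_right[del del0 h] _] := cf t t0.
exists del => // s /andP[]; rewrite le_eqVlt => /orP[/eqP <-//|ts] sdel.
by apply: h; rewrite ts.
Qed.

Lemma right_cont_shift f r : 0 <= r -> right_cont f -> right_cont (fun s => f (r + s)).
Proof.
move=> r0 rf t t0; have [del del0 h] := rf _ (addr_ge0 r0 t0).
exists del => // s /andP[ts sdel]; apply: h; rewrite lerD2l ts /=; lra.
Qed.

Definition stay A e : set (R -> S) := [set f | forall t, 0 <= t <= e -> A (f t)].

Definition grid A e m : set (R -> S) :=
  [set f | forall j, (j <= m)%N -> A (f (j%:R * (e / m%:R)))].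

Lemma stay_le A e e' f : e <= e' -> stay A e' f -> stay A e f.
Proof. by move=> ee' h t /andP[t0 te]; apply: h; rewrite t0 (le_trans te). Qed.

Lemma stayD A e e' f : 0 <= e -> 0 <= e' ->
  stay A (e + e') f <-> stay A e f /\ stay A e' (fun s => f (e + s)).
Proof.
move=> e0 e'0; split=> [h|[h1 h2] t /andP[t0 te]].
  split; first by apply: stay_le h; rewrite lerDl.
  by move=> t /andP[t0 te]; apply: h; rewrite addr_ge0//= lerD2l.
have [te'|et] := leP t e; first by apply: h1; rewrite t0.
have -> : t = e + (t - e) by ring.
by apply: h2; rewrite subr_ge0 (ltW et) /=; lra.
Qed.

(** Dyadic grids are nested, so the grid events decrease and continuity from above applies to
    them. *)
Lemma grid_nonincreasing A e k f : 0 <= e ->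
  grid A e (2 ^ k.+1) f -> grid A e (2 ^ k) f.
Proof.
move=> e0 h j jk; have := h (j * 2)%N.
rewrite expnS mulnC leq_pmul2l// natrM natrM => /(_ jk).
suff -> : 2 * j%:R * (e / (2 * (2 ^ k)%:R)) = j%:R * (e / (2 ^ k)%:R) :> R by [].
by field; rewrite pnatr_eq0 expn_eq0.
Qed.

(** A path outside [A] at time [t] remains there for a while, and a fine dyadic grid has a point in
    that interval. Uncountably many conditions thus reduce to countably many. *)
Lemma stay_gridP A e f : 0 <= e -> right_cont f ->
  stay A e f <-> forall k, grid A e (2 ^ k) f.
Proof.
move=> e0 rf; split.
  move=> h k j jk; apply: h; rewrite mulr_ge0 ?divr_ge0//=.
  rewrite mulrCA ler_piMr// ler_pdivrMr ?ltr0n ?expn_gt0// mul1r ler_nat//.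
move=> h t /andP[t0]; rewrite le_eqVlt => /orP[/eqP ->|te].
  (* At t = e no grid point lies to the right, but [e] itself is the last point of the coarsest
     grid. *)
  by have := h 0%N 1%N isT; rewrite expn0 mul1r divr1.
have {}e0 : 0 < e := le_lt_trans t0 te.
have [del del0 hdel] := rf t t0.
(* Since e / del < k + 1 <= 2^k, the mesh e / 2^k is below [del]. *)
pose k := Num.truncn (e / del).
have kdel : e / (2 ^ k)%:R < del.
  rewrite ltr_pdivrMr ?ltr0n ?expn_gt0// mulrC -ltr_pdivrMr//.
  have : e / del < k.+1%:R by rewrite -truncn_lt_nat// divr_ge0// ltW.
  by move=> /lt_le_trans; apply; rewrite ler_nat; exact: ltn_expl.
set M := (2 ^ k)%N in kdel *.
have M0 : 0 < M%:R :> R by rewrite ltr0n expn_gt0.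
pose x := t * M%:R / e.
have x0 : 0 <= x by rewrite divr_ge0 ?mulr_ge0// ltW.
pose j := Num.truncn x.
have /andP[jx xj] : j%:R <= x < j.+1%:R by exact: truncn_itv.
have jM : (j < M)%N.
  by rewrite truncn_lt_nat// /x ltr_pdivrMr// mulrC ltr_pM2l.
have := h k j.+1 jM; rewrite -/M hdel//.
have eM0 : 0 < e / M%:R by rewrite divr_gt0.
have tE : t = x * (e / M%:R).
  by rewrite /x; field; rewrite !gt_eqF.
rewrite tE; apply/andP; split; first by rewrite ler_pM2r// ltW.
apply: le_lt_trans (_ : x * (e / M%:R) + e / M%:R < _); last by rewrite ltrD2l.
by rewrite -natr1 mulrDl mul1r lerD2r ler_pM2r.
Qed.

End right_continuity.

Lemma pr_bigcap_ge (R : realType) d (T : measurableType d) (P : probability T R)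
    (F : (set T)^nat) (b : R) :
  (forall k, measurable (F k)) -> (forall k, F k.+1 `<=` F k) ->
  (forall k, b <= pr P (F k)) -> b <= pr P (\bigcap_k F k).
Proof.
move=> mF dF bF.
have mI : measurable (\bigcap_k F k) by exact: bigcapT_measurable.
rewrite -lee_fin -prE//.
have dF' : {homo F : n m / (n <= m)%N >-> (m <= n)%O}.
  by apply: homo_leq => [A|B A C AB BC|k]; rewrite ?lexx//;
    [exact: le_trans BC AB|exact/subsetPset].
have PF0 : (P (F 0%N) < +oo)%E by rewrite prE// ltry.
have cF := nonincreasing_cvg_mu PF0 mF mI dF'.
rewrite -(cvg_lim _ cF)//.
apply: lime_ge; first by apply/cvg_ex; exists (P (\bigcap_k F k)).
by apply: nearW => k /=; rewrite prE// lee_fin.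
Qed.

Section path_event_classes.
Context (R : realType) (d : measure_display) (S : measurableType d).
Hypothesis allm : forall A : set S, measurable A.
Implicit Types B : set (R -> S).

(* The events of path space that are measurable on right-continuous paths. *)
Definition rc_event B : Prop :=
  exists2 B' : set (R -> S), path_events B' & forall f, right_cont f -> (B f <-> B' f).

Lemma rc_event_state t A : 0 <= t -> rc_event [set f : R -> S | A (f t)].
Proof. by move=> t0; exists [set f : R -> S | A (f t)] => //; exact: path_event_state. Qed.

Lemma rc_eventT : rc_event setT.
Proof. by exists setT => //; exact: g_sigmaT. Qed.

Lemma rc_eventI B1 B2 : rc_event B1 -> rc_event B2 -> rc_event (B1 `&` B2).
Proof.
move=> [B1' m1 h1] [B2' m2 h2]; exists (B1' `&` B2'); first exact: g_sigmaI.
by move=> f rf; split=> -[/(h1 _ rf) ? /(h2 _ rf) ?].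
Qed.

Lemma rc_eventC B : rc_event B -> rc_event (~` B).
Proof.
move=> [B' m h]; exists (~` B'); first exact: g_sigmaC.
by move=> f rf; split=> /= nB /(h _ rf).
Qed.

Lemma path_event_grid A e m : 0 <= e -> path_events (grid A e m : set (R -> S)).
Proof.
move=> e0.
have -> : grid A e m = \bigcap_j
    (if (j <= m)%N then [set f : R -> S | A (f (j%:R * (e / m%:R)))] else setT).
  apply/seteqP; split=> [f h j _|f h j jm]; first by case: ifP => // /h.
  by have := h j Logic.I; rewrite jm.
apply: g_sigma_bigcap => j; case: ifP => _; last exact: g_sigmaT.
by apply: path_event_state => //; rewrite mulr_ge0// divr_ge0.
Qed.

Lemma rc_event_stay A e : 0 <= e -> rc_event (stay A e).
Proof.
move=> e0; exists (\bigcap_k grid A e (2 ^ k)).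
  by apply: g_sigma_bigcap => k; exact: path_event_grid.
move=> f rf; rewrite (stay_gridP A e0 rf); split=> h k; first by move=> _; exact: h.
exact: h.
Qed.

Lemma rc_event_shift B r : 0 <= r -> rc_event B -> rc_event [set f | B (fun s => f (r + s))].
Proof.
move=> r0 [B' hB' BB']; exists [set f | B' (fun s => f (r + s))]; last first.
  by move=> f rf; apply: BB'; exact: right_cont_shift.
have := @measurable_path_event R _ S _
  (g_sigma_algebraType [set B | exists (t : R) (A : set S),
     [/\ 0 <= t, measurable A & B = [set f : R -> S | A (f t)]]])
  (fun t f => f (r + t)) B' _ hB'; apply => t t0 _ A mA; rewrite setTI.
by apply: path_event_state => //; rewrite addr_ge0.
Qed.

Context (d' : measure_display) (T : measurableType d') (Z : R -> T -> S).
Hypothesis mZ : forall t, 0 <= t -> measurable_fun setT (Z t).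
Hypothesis rZ : forall w, right_cont (Z ^~ w).

Lemma measurable_rc_event B : rc_event B -> measurable [set w | B (Z ^~ w)].
Proof.
move=> [B' hB' BB']; have := measurable_path_event mZ hB'.
rewrite (_ : [set w | B (Z ^~ w)] = [set w | B' (Z ^~ w)])//.
by apply/seteqP; split=> w /=; move/(BB' _ (rZ w)).
Qed.

Lemma history_stay (I : set R) A e : 0 <= e -> `[0, e] `<=` I ->
  history Z I [set w | stay A e (Z ^~ w)].
Proof.
move=> e0 eI.
have -> : [set w | stay A e (Z ^~ w)] =
    \bigcap_k \bigcap_j (if (j <= 2 ^ k)%N
       then [set w | A (Z (j%:R * (e / (2 ^ k)%:R)) w)] else setT).
  apply/seteqP; split=> w /=.
    by move/(stay_gridP A e0 (rZ w)) => h k _ j _; case: ifP => // /h.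
  move=> h; apply/(stay_gridP A e0 (rZ w)) => k j jk.
  by have := h k Logic.I j Logic.I; rewrite jk.
apply: g_sigma_bigcap => k; apply: g_sigma_bigcap => j; case: ifP => jk; last exact: g_sigmaT.
have t0 : 0 <= j%:R * (e / (2 ^ k)%:R) by rewrite mulr_ge0// divr_ge0.
apply: (history_state (A := A)) => //; apply: eI; rewrite /= in_itv/= t0.
by rewrite mulrCA ler_piMr// ler_pdivrMr ?ltr0n ?expn_gt0// mul1r ler_nat.
Qed.

End path_event_classes.

(** * Survival probabilities of the walks *)

Lemma ler_prod_const (R : realType) (I : finType) (F : I -> R) (a : R) (P : pred I) :
  0 <= a -> (forall i, P i -> a <= F i) -> a ^+ #|P| <= \prod_(i | P i) F i.
Proof.
move=> a0 aF; rewrite -prodr_const; apply: ler_prod => i Pi.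
by rewrite a0 aF.
Qed.

Section walks_estimates.
Context (R : realType) (p : R) (N : nat).
Hypothesis p01 : 0 <= p <= 1.
Local Notation V := ('rV[int]_N).
Local Notation Om := (@Omega N).

Definition neighbour (ib : 'I_N * bool) (x : V) : V :=
  if ib.2 then x + delta_mx 0 ib.1 else x - delta_mx 0 ib.1.

Definition neighbour_rate (ib : 'I_N * bool) : R := if ib.2 then p else 1 - p.

Lemma neighbour_rate_ge0 ib : 0 <= neighbour_rate ib.
Proof. by case/andP: p01 => p0 p1; rewrite /neighbour_rate; case: ib.2; rewrite ?subr_ge0. Qed.

Lemma sum_neighbour_rate : \sum_ib neighbour_rate ib = N%:R.
Proof.
rewrite -(pair_bigA _ (fun i b => neighbour_rate (i, b))) /=.
under eq_bigr do rewrite big_bool /neighbour_rate /= addrC subrK.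
by rewrite sumr_const card_ord.
Qed.

Lemma neighbourE ib x i : neighbour ib x 0 i =
  if i == ib.1 then walk_move ib.2 (x 0 i) else x 0 i.
Proof.
rewrite /neighbour /walk_move; case: ib => j [] /=; rewrite !mxE eqxx /= eq_sym;
  case: eqP => _ /=; by rewrite ?oppr0 ?addr0.
Qed.

Lemma neighbour_target_inj x : injective (jump_target neighbour ^~ x).
Proof.
have h (o : option ('I_N * bool)) i : jump_target neighbour o x 0 i =
    if o is Some ib then (if i == ib.1 then walk_move ib.2 (x 0 i) else x 0 i) else x 0 i.
  by case: o => [ib|] //=; exact: neighbourE.
move=> o o' /rowP oo'.
case: o o' oo' => [[i b]|] [[i' b']|] // oo'.
- have := oo' i; have := oo' i'; rewrite !h !eqxx /=.
  have [->|ii'] := eqVneq i i'.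
    by move=> /(@walk_target_inj (x 0 i') (Some b) (Some b')) [->].
  by move=> /(@walk_target_inj (x 0 i') None (Some b')).
- by have := oo' i; rewrite !h eqxx /= => /(@walk_target_inj (x 0 i) (Some b) None).
- by have := oo' i'; rewrite !h eqxx /= => /(@walk_target_inj (x 0 i') None (Some b')).
Qed.

Lemma walks_trans_bound t x o : 0 <= t <= 1 ->
  (1 - N%:R * t) * (if o is Some ib then t * neighbour_rate ib else 1) <=
  walks_trans p01 t x (jump_target neighbour o x).
Proof.
move=> /andP[t0 t1].
have t1' : 0 <= 1 - t by rewrite subr_ge0.
have t01 : 0 <= t <= 1 by rewrite t0.
have stay k : 1 - t <= walk_trans p01 t k k.
  by have := walk_trans_bound p01 k None t01; rewrite mulr1.
rewrite /walks_trans; case: o => [[j b]|] /=; last first.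
  rewrite mulr1; apply: (le_trans (bernoulli_ineq N t1)).
  have := @ler_prod_const R 'I_N (fun i => walk_trans p01 t (x 0 i) (x 0 i)) (1 - t) xpredT t1'.
  by rewrite card_ord; apply => i _; exact: stay.
rewrite (bigD1 j)//= neighbourE eqxx /=.
have tr0 : 0 <= t * walk_rate p b (x 0 j) by rewrite mulr_ge0 ?walk_rate_ge0.
apply: (@le_trans _ _ ((1 - t) ^+ N * (t * walk_rate p b (x 0 j)))).
  by rewrite ler_wpM2r// bernoulli_ineq.
have NE : N = #|[pred i | i != j]|.+1.
  have N0 : (0 < N)%N := leq_ltn_trans (leq0n j) (ltn_ord j).
  have := cardC1 j; rewrite card_ord => h.
  by rewrite -[LHS](prednK N0) -h; congr _.+1; exact: eq_card.
(* One factor 1 - t is spent on the coordinate that moves, the other N - 1 on those that stay. *)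
rewrite [X in _ ^+ X]NE exprS mulrAC; apply: ler_pM.
- exact: mulr_ge0.
- exact: exprn_ge0.
- exact: (walk_trans_bound p01 (x 0 j) (Some b) t01).
apply: (ler_prod_const t1') => i ij.
by rewrite neighbourE /= (negbTE ij).
Qed.

Context (d : measure_display) (T : measurableType d) (Pr : V -> probability T R)
  (Y : R -> T -> V).
Hypothesis hY : forall x, independent_rws (Pr x) p x Y.
Hypothesis rY : forall w, right_cont (Y ^~ w).

Let mY t : 0 <= t -> measurable_fun setT (Y t) := @measurable_walks _ _ _ _ _ _ _ _ (hY 0) t.

Let mS s y : 0 <= s -> measurable [set w | Y s w = y].
Proof. exact: (measurable_walk_state hY). Qed.

Let mrc B : rc_event B -> measurable [set w | B (Y ^~ w)].
Proof. by apply: measurable_rc_event => //; exact: mY. Qed.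

Let hist_meas I C : history Y I C -> measurable C.
Proof. exact: history_measurable mY. Qed.

Lemma walks_rc_markov x0 r x C (B : set (R -> V)) : 0 <= r -> history Y `[0, r] C ->
  rc_event B ->
  pr (Pr x0) (C `&` [set w | Y r w = x] `&` [set w | B (fun s => Y (r + s) w)]) =
  pr (Pr x0) (C `&` [set w | Y r w = x]) * pr (Pr x) [set w | B (Y ^~ w)].
Proof.
move=> r0 hC [B' hB' BB'].
rewrite (_ : [set w | B (fun s => _)] = [set w | B' (fun s => Y (r + s) w)]); last first.
  by apply/seteqP; split=> w /=; move/(BB' _ (right_cont_shift r0 (rY w))).
rewrite (_ : [set w | B (Y ^~ w)] = [set w | B' (Y ^~ w)]); last first.
  by apply/seteqP; split=> w /=; move/(BB' _ (rY w)).
exact: (walks_path_markov p01 hY).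
Qed.

Lemma pr_start x C : measurable C -> pr (Pr x) (C `&` [set w | Y 0 w = x]) = pr (Pr x) C.
Proof.
by move=> mC; rewrite prI1//; [exact: mS|exact: walks_start (hY x)].
Qed.

Definition skeleton (A : set V) (del : R) (m : nat) : set T :=
  [set w | forall j, (j <= m)%N -> A (Y (j%:R * del) w)].

Lemma skeletonS A del m :
  skeleton A del m.+1 = skeleton A del m `&` [set w | A (Y (m.+1%:R * del) w)].
Proof.
apply/seteqP; split=> w.
  by move=> h; split=> [j jm|]; apply: h => //; exact: leqW.
by move=> [h1 h2] j; rewrite leq_eqVlt => /orP[/eqP ->//|]; exact: h1.
Qed.

Lemma history_skeleton A del m : 0 <= del -> history Y `[0, m%:R * del] (skeleton A del m).
Proof.
move=> del0; elim: m => [|m IH].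
  rewrite (_ : skeleton _ _ _ = Y 0 @^-1` A).
    by apply: history_state => //=; rewrite in_itv/= mul0r lexx.
  apply/seteqP; split=> w /=; first by move=> /(_ 0%N isT); rewrite mul0r.
  by move=> h [|//] _; rewrite mul0r.
rewrite skeletonS; apply: g_sigmaI.
  apply: history_mono IH => s /=; rewrite !in_itv/= => /andP[-> /le_trans ->]//.
  by rewrite ler_wpM2r// ler_nat.
have h : 0 <= m.+1%:R * del by rewrite mulr_ge0.
by apply: (history_state (A := A)) => //=; rewrite in_itv/= lexx h.
Qed.

Lemma skeleton_stay_ge x del m : 0 <= del <= 1 -> N%:R * del <= 1 ->
  (1 - N%:R * del) ^+ m <= pr (Pr x) (skeleton [set x] del m).
Proof.
move=> /andP[del0 del1] Nd.
have Nd0 : 0 <= 1 - N%:R * del by rewrite subr_ge0.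
elim: m => [|m IH].
  rewrite expr0 (_ : skeleton _ _ _ = [set w | Y 0 w = x]) ?(walks_start (hY x))//.
  apply/seteqP; split=> w /=; first by move=> /(_ 0%N isT); rewrite mul0r.
  by move=> h [|//] _; rewrite mul0r.
rewrite skeletonS.
have mdel : 0 <= m%:R * del by rewrite mulr_ge0.
have sE : skeleton [set x] del m = skeleton [set x] del m `&` [set w | Y (m%:R * del) w = x].
  by apply/seteqP; split=> w // h; [split=> //; exact: h|case: h].
rewrite sE.
have -> : m.+1%:R * del = m%:R * del + del by rewrite -natr1 mulrDl mul1r.
rewrite (walks_markov p01 (hY x))// -?sE; last exact: history_skeleton.
rewrite exprSr ler_pM ?exprn_ge0//.
have := @walks_trans_bound del x None; rewrite mulr1; apply.
by rewrite del0.
Qed.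

Lemma stay_skeletonE A e : 0 <= e ->
  [set w | stay A e (Y ^~ w)] = \bigcap_k (skeleton A (e / (2 ^ k)%:R) (2 ^ k)).
Proof.
move=> e0; apply/seteqP; split=> w /=.
  by move/(stay_gridP A e0 (rY w)) => h k _; exact: h.
by move=> h; apply/(stay_gridP A e0 (rY w)) => k; exact: h.
Qed.

Lemma skeleton_mono A e k : 0 <= e ->
  skeleton A (e / (2 ^ k.+1)%:R) (2 ^ k.+1) `<=` skeleton A (e / (2 ^ k)%:R) (2 ^ k).
Proof. by move=> e0 w; exact: (@grid_nonincreasing _ _ A e k (Y ^~ w) e0). Qed.

(** Rest along the grid of mesh e / 2^k has probability at least (1 - N e / 2^k)^(2^k) >= 1 - N e
    for every k, and these events decrease to rest at all times. *)
Lemma stay_start_ge x e : 0 <= e <= 1 -> N%:R * e <= 1 ->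
  1 - N%:R * e <= pr (Pr x) [set w | stay [set x] e (Y ^~ w)].
Proof.
move=> /andP[e0 e1] Ne; rewrite stay_skeletonE//; apply: pr_bigcap_ge.
- move=> k; have k0 : 0 <= e / (2 ^ k)%:R by rewrite divr_ge0.
  by apply: hist_meas; exact: history_skeleton.
- by move=> k; exact: skeleton_mono.
move=> k; set m := (2 ^ k)%N.
have m0 : 0 < m%:R :> R by rewrite ltr0n expn_gt0.
have m1 : 1 <= m%:R :> R by rewrite ler1n expn_gt0.
have em : e / m%:R <= e by rewrite ler_pdivrMr// ler_peMr.
have em0 : 0 <= e / m%:R by rewrite divr_ge0.
have Nem : N%:R * (e / m%:R) <= 1 by apply: le_trans Ne; rewrite ler_wpM2l.
apply: le_trans (skeleton_stay_ge x m _ Nem); last by rewrite em0 (le_trans em).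
apply: le_trans (bernoulli_ineq m Nem).
rewrite lerD2l lerN2 le_eqVlt; apply/orP; left; apply/eqP.
by field; rewrite gt_eqF.
Qed.

(** Recursion on the number of steps: the walks rest and jump in the last step, or are already at
    the neighbour and stay. The two cases are disjoint, and both keep the skeleton in [A]. *)
Lemma skeleton_jump_ge (A : set V) x ib del m : 0 <= del <= 1 -> m%:R * (N%:R * del) <= 1 ->
  A x -> A (neighbour ib x) -> (0 < m)%N ->
  m%:R * (1 - m%:R * (N%:R * del)) * ((1 - N%:R * del) * (del * neighbour_rate ib)) <=
  pr (Pr x) (skeleton A del m `&` [set w | Y (m%:R * del) w = neighbour ib x]).
Proof.
move=> /andP[del0 del1] + Ax Ay.
set y := neighbour ib x; set b := N%:R * del; set a := _ * (del * _).
have b0 : 0 <= b by rewrite mulr_ge0.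
have xy : x <> y by move=> h; have := @neighbour_target_inj x None (Some ib) h.
have tb : a <= walks_trans p01 del x y.
  by apply: (walks_trans_bound x (Some ib)); rewrite del0.
have mb1 n : (0 < n)%N -> n%:R * b <= 1 -> b <= 1.
  by move=> n0; apply: le_trans; rewrite ler_peMl// ler1n.
have step n : (n.+1)%:R * b <= 1 ->
    pr (Pr x) (skeleton A del n `&` [set w | Y (n%:R * del) w = y]) * (1 - b) +
    (1 - n%:R * b) * a <=
    pr (Pr x) (skeleton A del n.+1 `&` [set w | Y (n.+1%:R * del) w = y]).
  move=> nb; have b1 := mb1 _ (ltn0Sn n) nb.
  have ndel : 0 <= n%:R * del by rewrite mulr_ge0.
  have hs := @history_skeleton A del n del0.
  pose E z := skeleton A del n `&` [set w | Y (n%:R * del) w = z] `&`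
     [set w | Y (n%:R * del + del) w = y].
  have mE z : measurable (E z).
    apply: measurableI; last by apply: mS; rewrite addr_ge0.
    by apply: measurableI; [exact: hist_meas hs|exact: mS].
  have sk : E x `|` E y `<=` skeleton A del n.+1 `&` [set w | Y (n.+1%:R * del) w = y].
    rewrite skeletonS -natr1 mulrDl mul1r.
    by move=> w [[[h1 h2] h3]|[[h1 h2] h3]]; rewrite /= h3; split=> //; split=> //=; rewrite h3.
  apply: le_trans (pr_le (Pr x) _ _ sk); last 2 first.
  - exact: measurableU.
  - apply: measurableI; first by apply: hist_meas; exact: history_skeleton.
    by apply: mS; rewrite mulr_ge0.
  rewrite prU//; last first.
    apply/disj_set2P/seteqP; split=> // w [[[_ /= h1] _] [[_ /= h2] _]].
    by apply: xy; rewrite -h1 -h2.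
  rewrite addrC /E !(walks_markov p01 (hY x))//.
  have a0 : 0 <= a by rewrite mulr_ge0 ?subr_ge0// mulr_ge0// neighbour_rate_ge0.
  apply: lerD.
    apply: ler_pM => //; first by rewrite subr_ge0 (le_trans _ nb)// ler_wpM2r// ler_nat.
    apply: (@le_trans _ _ (pr (Pr x) (skeleton [set x] del n))).
      apply: le_trans (skeleton_stay_ge x n _ b1); last by rewrite del0.
      exact: bernoulli_ineq.
    apply: pr_le.
    - by apply: hist_meas; exact: history_skeleton.
    - by apply: measurableI; [exact: hist_meas hs|exact: mS].
    - move=> w h; split; last exact: h.
      by move=> j jn; rewrite (h j jn).
  rewrite ler_wpM2l ?pr_ge0//.
  have := @walks_trans_bound del y None; rewrite mulr1; apply; by rewrite del0.
elim: m => [//|[_ m1 _|m IH m1 _]].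
  apply: le_trans (step 0%N m1).
  rewrite mul1r in m1; rewrite !mul0r subr0 !mul1r.
  have a0 : 0 <= a by rewrite mulr_ge0 ?subr_ge0// mulr_ge0// neighbour_rate_ge0.
  apply: (@le_trans _ _ a); first by rewrite ler_piMl// gerBl.
  by rewrite lerDr mulr_ge0 ?pr_ge0// subr_ge0.
have b1 := mb1 _ (ltn0Sn m.+1) m1.
have m1' : m.+1%:R * b <= 1 by apply: le_trans m1; rewrite ler_wpM2r// ler_nat.
apply: le_trans (step m.+1 m1).
have {}IH := IH m1' isT.
have a0 : 0 <= a by rewrite mulr_ge0 ?subr_ge0// mulr_ge0// neighbour_rate_ge0.
apply: (@le_trans _ _ (m.+1%:R * (1 - m.+1%:R * b) * a * (1 - b) + (1 - m.+1%:R * b) * a)).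
  rewrite -[m.+2%:R]natr1 -subr_ge0.
  rewrite (_ : _ - _ = a * (b + (m.+1%:R * b) ^+ 2)); last by ring.
  by rewrite mulr_ge0// addr_ge0// sqr_ge0.
by rewrite lerD2r ler_wpM2r// subr_ge0.
Qed.

Lemma stay_jump_ge (A : set V) x ib e : 0 <= e <= 1 -> N%:R * e <= 1 ->
  A x -> A (neighbour ib x) ->
  (1 - 2 * (N%:R * e)) * (e * neighbour_rate ib) <=
  pr (Pr x) ([set w | stay A e (Y ^~ w)] `&` [set w | Y e w = neighbour ib x]).
Proof.
move=> /andP[e0 e1] Ne Ax Ay; rewrite stay_skeletonE//.
rewrite -bigcapIl; last by exists 0%N.
have mk k : measurable (skeleton A (e / (2 ^ k)%:R) (2 ^ k) `&` [set w | Y e w = neighbour ib x]).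
  apply: measurableI; last exact: mS.
  have k0 : 0 <= e / (2 ^ k)%:R by rewrite divr_ge0.
  by apply: hist_meas; exact: history_skeleton.
apply: pr_bigcap_ge => //.
  by move=> k w [h1 h2]; split=> //; exact: skeleton_mono h1.
move=> k; set m := (2 ^ k)%N.
have m0 : 0 < m%:R :> R by rewrite ltr0n expn_gt0.
have m1 : 1 <= m%:R :> R by rewrite ler1n expn_gt0.
have em : e / m%:R <= e by rewrite ler_pdivrMr// ler_peMr.
have em0 : 0 <= e / m%:R by rewrite divr_ge0.
have mE : m%:R * (e / m%:R) = e by rewrite mulrC divfK// gt_eqF.
have mNE : m%:R * (N%:R * (e / m%:R)) = N%:R * e by rewrite mulrCA mE.
have em01 : 0 <= e / m%:R <= 1 by rewrite em0 (le_trans em).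
have := @skeleton_jump_ge A x ib (e / m%:R) m em01.
have mp : (0 < m)%N by rewrite expn_gt0.
rewrite mNE mE => /(_ Ne Ax Ay mp); apply: le_trans.
have r0 := neighbour_rate_ge0 ib.
have Ne0 : 0 <= N%:R * e by rewrite mulr_ge0.
have Nem : N%:R * (e / m%:R) <= N%:R * e by rewrite ler_wpM2l.
(* The first factor pays for rest before and after the jump, the second for the coordinates that
   rest during it; together they cost at most 2 N e. *)
rewrite [leRHS](_ : _ = (1 - N%:R * e) * (1 - N%:R * (e / m%:R)) * (e * neighbour_rate ib)).
  rewrite ler_wpM2r ?mulr_ge0//; nra.
by field; rewrite gt_eqF.
Qed.

(** This is h_e; for e = L it is convertible to the [prob_path] of [no_collision L]. *)
Definition survival (e : R) (x : V) : R := pr (Pr x) [set w | stay Om e (Y ^~ w)].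

Definition rest_prob (e : R) (x : V) : R := pr (Pr x) [set w | stay [set x] e (Y ^~ w)].

Let mstay A e : 0 <= e -> measurable [set w | stay A e (Y ^~ w)].
Proof. by move=> e0; apply: mrc; apply: rc_event_stay => // B. Qed.

Let hstay A e : 0 <= e -> history Y `[0, e] [set w | stay A e (Y ^~ w)].
Proof. by move=> e0; apply: history_stay. Qed.

Lemma survival_ge0 e x : 0 <= survival e x. Proof. exact: pr_ge0. Qed.

Lemma survival_le1 e x : 0 <= e -> survival e x <= 1.
Proof. by move=> e0; apply: pr_le1; exact: mstay. Qed.

Lemma survival_nonincreasing e e' x : 0 <= e -> e <= e' -> survival e' x <= survival e x.
Proof.
move=> e0 ee'; apply: pr_le.
- by apply: mstay; exact: le_trans ee'.
- exact: mstay.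
- by move=> w; exact: stay_le.
Qed.

Lemma survival_outside e x : 0 <= e -> ~ Om x -> survival e x = 0.
Proof.
move=> e0 nx; rewrite /survival -(pr_start x (mstay Om e0)).
rewrite (_ : _ `&` _ = set0) ?pr0//; apply/seteqP; split=> // w [/= h Y0].
by apply: nx; rewrite -Y0; apply: h; rewrite lexx.
Qed.

Lemma rest_prob_ge x e : 0 <= e <= 1 -> N%:R * e <= 1 -> 1 - N%:R * e <= rest_prob e x.
Proof. exact: stay_start_ge. Qed.

Lemma rest_then x e (B : set (R -> V)) : 0 <= e -> rc_event B ->
  pr (Pr x) ([set w | stay [set x] e (Y ^~ w)] `&` [set w | B (fun s => Y (e + s) w)]) =
  rest_prob e x * pr (Pr x) [set w | B (Y ^~ w)].
Proof.
move=> e0 hB; have := walks_rc_markov x x e0 (hstay [set x] e0) hB.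
rewrite (_ : [set w | stay [set x] e (Y ^~ w)] `&` [set w | Y e w = x] =
  [set w | stay [set x] e (Y ^~ w)])//.
by apply/seteqP; split=> w; [case|move=> h; split=> //; apply: h; rewrite e0 lexx].
Qed.

Lemma rest_survival x e s : Om x -> 0 <= e -> 0 <= s ->
  pr (Pr x) ([set w | stay [set x] e (Y ^~ w)] `&` [set w | stay Om (e + s) (Y ^~ w)]) =
  rest_prob e x * survival s x.
Proof.
move=> ox e0 s0; rewrite -(@rest_then x e (stay Om s))//; last exact: rc_event_stay.
congr pr; apply/seteqP; split=> w [h1 /= h2]; split=> //.
  by move: h2 => /(@stayD _ _ Om e s (Y ^~ w) e0 s0)[].
apply/(@stayD _ _ Om e s (Y ^~ w) e0 s0); split=> //.
by move=> t te; have -> : Y t w = x := h1 t te.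
Qed.

Lemma survivalD_ge x e s : Om x -> 0 <= e -> 0 <= s ->
  rest_prob e x * survival s x <= survival (e + s) x.
Proof.
move=> ox e0 s0; rewrite -rest_survival//; have es0 := addr_ge0 e0 s0.
by apply: pr_le => //; [apply: measurableI|]; exact: mstay.
Qed.

Lemma stay_then x e z (B : set (R -> V)) A : 0 <= e -> rc_event B ->
  pr (Pr x) ([set w | stay A e (Y ^~ w)] `&` [set w | Y e w = z] `&`
     [set w | B (fun s => Y (e + s) w)]) =
  pr (Pr x) ([set w | stay A e (Y ^~ w)] `&` [set w | Y e w = z]) *
  pr (Pr z) [set w | B (Y ^~ w)].
Proof. by move=> e0 hB; apply: walks_rc_markov => //; exact: hstay. Qed.

(** Resting is a way to survive: [e] is cut into [m] pieces so short that each is spent at rest with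
    probability at least 1/2. *)
Lemma survival_gt0 x e : Om x -> 0 <= e -> 0 < survival e x.
Proof.
move=> ox e0; pose m := (Num.truncn (e * (N.+1)%:R *+ 2)).+1.
have mb : e * (N.+1)%:R *+ 2 < m%:R.
  by rewrite -truncn_lt_nat// mulrn_wge0// mulr_ge0.
have m0 : 0 < m%:R :> R by [].
pose del := e / m%:R; have del0 : 0 <= del by rewrite divr_ge0.
have Ndel : (N.+1)%:R * del *+ 2 <= 1.
  by rewrite /del mulrA -mulrnAl ler_pdivrMr// mul1r mulrC ltW.
have Nd : N%:R * del <= 1 / 2.
  have : N%:R * del <= N.+1%:R * del by rewrite ler_wpM2r// ler_nat.
  by move: Ndel; rewrite mulr2n; lra.
have del1 : del <= 1.
  have : 1 * del <= N.+1%:R * del by rewrite ler_wpM2r// ler1n.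
  by move: Ndel; rewrite mulr2n mul1r; lra.
have a1 : 1 / 2 <= rest_prob del x.
  apply: le_trans (rest_prob_ge x _ _); rewrite ?del0//; lra.
suff h n : (1 / 2) ^+ n.+1 <= survival (n.+1%:R * del) x.
  have := h m.-1; rewrite prednK//; have -> : m%:R * del = e by rewrite /del mulrC divfK// gt_eqF.
  by apply: lt_le_trans; rewrite exprn_gt0//; lra.
elim: n => [|n IH].
  rewrite expr1 [1 * del]mul1r; apply: (le_trans a1); apply: pr_le; try exact: mstay.
  by move=> w h t tdel; have -> : Y t w = x := h t tdel.
have -> : n.+2%:R * del = del + n.+1%:R * del by rewrite -[n.+2%:R]natr1; ring.
apply: le_trans (survivalD_ge ox del0 _); last by rewrite mulr_ge0.
by rewrite exprS ler_pM// ?exprn_ge0//; lra.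
Qed.

(** For [x] in Omega this is the total rate of the mRW with foresight [e] out of [x], multiplied by
    [survival e x]. *)
Definition survival_rate (e : R) (x : V) : R :=
  \sum_ib neighbour_rate ib * survival e (neighbour ib x).

Lemma survival_rate_ge0 e x : 0 <= survival_rate e x.
Proof. by apply: sumr_ge0 => ib _; rewrite mulr_ge0 ?neighbour_rate_ge0 ?survival_ge0. Qed.

Lemma jump_survival_le x ib e L : Om x -> 0 <= e <= 1 -> N%:R * e <= 1 -> 0 <= L ->
  (1 - 2 * (N%:R * e)) * (e * neighbour_rate ib) * survival L (neighbour ib x) <=
  pr (Pr x) ([set w | stay Om (e + L) (Y ^~ w)] `&` [set w | Y e w = neighbour ib x]).
Proof.
move=> ox /[dup] e01 /andP[e0 e1] Ne L0.
have [oy|ny] := pselect (Om (neighbour ib x)); last first.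
  by rewrite survival_outside// mulr0 pr_ge0.
apply: (@le_trans _ _ (pr (Pr x) ([set w | stay Om e (Y ^~ w)] `&`
    [set w | Y e w = neighbour ib x] `&` [set w | stay Om L (fun s => Y (e + s) w)]))).
  rewrite stay_then//; last exact: rc_event_stay.
  by rewrite ler_wpM2r ?survival_ge0// stay_jump_ge.
rewrite le_eqVlt; apply/orP; left; apply/eqP; congr pr; apply/seteqP; split=> w.
  by move=> [[h1 h2] h3]; split=> //; apply/(@stayD _ _ Om e L (Y ^~ w) e0 L0).
by move=> [/(@stayD _ _ Om e L (Y ^~ w) e0 L0)[]].
Qed.

(** Being at a given neighbour at time [e] and surviving for [L] more are disjoint ways of surviving
    until [L]. With e = 1 / (4 N + 1) one has 1 - 2 N e >= 1/2, which gives the constant 2 / e = 8 N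
    + 2. This bound on the rates is what makes uniformization possible. *)
Lemma survival_rate_le x L : 0 <= L ->
  survival_rate L x <= (8 * N%:R + 2) * survival L x \/ ~ Om x.
Proof.
move=> L0; have [ox|nx] := pselect (Om x); [left|by right].
pose e : R := (4 * N%:R + 1)^-1.
have D0 : 0 < 4 * N%:R + 1 :> R by rewrite ltr_wpDl// mulr_ge0.
have e0 : 0 < e by rewrite invr_gt0.
have e1 : e <= 1 by rewrite invf_le1// lerDr mulr_ge0.
have Ne : N%:R * e <= 1 / 4.
  by rewrite ler_pdivrMr//; lra.
have Ne1 : N%:R * e <= 1 by lra.
have e01 : 0 <= e <= 1 by rewrite (ltW e0).
have -> : 8 * N%:R + 2 = 2 * e^-1 :> R by rewrite invrK; ring.
rewrite -ler_pdivrMl ?mulr_gt0 ?invr_gt0// invfM invrK.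
have eL : 0 <= e + L by rewrite addr_ge0// ltW.
apply: (@le_trans _ _ (survival (e + L) x)); last first.
  by apply: survival_nonincreasing => //; rewrite lerDr ltW.
apply: le_trans (pr_sum_le (F := fun ib => [set w | stay Om (e + L) (Y ^~ w)] `&`
   [set w | Y e w = neighbour ib x]) (Pr x) _ _ _ _); last 4 first.
- exact: mstay.
- by move=> ib; apply: measurableI; [exact: mstay|apply: mS; exact: ltW].
- move=> ib ib' w [_ /= h] [_ /=]; rewrite h => h'.
  by have [] := @neighbour_target_inj x (Some ib) (Some ib') h'.
- by move=> ib; exact: subIsetl.
rewrite /survival_rate mulr_sumr; apply: ler_sum => ib _.
apply: le_trans (jump_survival_le ib ox e01 Ne1 L0).
rewrite [leLHS]mulrA ler_wpM2r ?survival_ge0// [leRHS]mulrA.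
rewrite ler_wpM2r ?neighbour_rate_ge0// ler_wpM2r ?(ltW e0)//; lra.
Qed.

(** Survival is decomposed according to the position at time [del]. Lower bounds on the transition
    probabilities suffice: the mass they leave, (N del)^2 in all, is counted as surviving. *)
Lemma survival_step x del s : Om x -> 0 <= del <= 1 -> 0 <= s ->
  survival (del + s) x <= (1 - N%:R * del) * survival s x +
    (1 - N%:R * del) * (del * survival_rate s x) + (N%:R * del) ^+ 2.
Proof.
move=> ox /[dup] d01 /andP[d0 d1] s0.
pose B := [set w | stay Om s (fun t => Y (del + t) w)].
have mB : measurable B.
  have h : rc_event [set f : R -> V | stay Om s (fun t => f (del + t))].
    by apply: rc_event_shift => //; exact: rc_event_stay.
  exact: (mrc h).
pose F o := [set w | Y del w = jump_target neighbour o x].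
have mF o : measurable (F o) by exact: mS.
have ds0 := addr_ge0 d0 s0.
apply: (@le_trans _ _ (pr (Pr x) B)).
  apply: pr_le => //; first exact: mstay.
  by move=> w /(@stayD _ _ Om del s (Y ^~ w) d0 s0)[].
have dF o o' w : F o w -> F o' w -> o = o'.
  by rewrite /F /= => -> h; exact: neighbour_target_inj h.
apply: (le_trans (pr_le_sum (Pr x) mB mF dF)).
have FE o : pr (Pr x) (F o) = walks_trans p01 del x (jump_target neighbour o x).
  have := @walks_markov R p N p01 d T (Pr x) x Y (hY x) 0 del setT x
    (jump_target neighbour o x) (lexx _) d0 (@g_sigmaT _ _).
  by rewrite !setTI add0r (walks_start (hY x)) mul1r => <-; rewrite setIC; exact/esym/(pr_start x (mF o)).
have FBE o : pr (Pr x) (F o `&` B) =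
    walks_trans p01 del x (jump_target neighbour o x) *
    survival s (jump_target neighbour o x).
  have := walks_rc_markov x (jump_target neighbour o x) d0 (@g_sigmaT _ _)
    (rc_event_stay (@measurable_rV N) Om s0).
  by rewrite setTI -/(F o) FE.
under eq_bigr do rewrite FBE.
under [X in _ - X]eq_bigr do rewrite FE.
rewrite addrAC -sumrB.
pose l o := (1 - N%:R * del) * (if o is Some ib then del * neighbour_rate ib else 1).
(* A transition probability is multiplied here by [survival s] minus 1, which is at most 0, so its
   lower bound yields an upper bound. *)
apply: (@le_trans _ _ (\sum_o (l o * survival s (jump_target neighbour o x) - l o) + 1)).
  rewrite lerD2r; apply: ler_sum => o _.
  have := walks_trans_bound x o d01; rewrite -/(l o).
  have := survival_le1 (jump_target neighbour o x) s0.
  by set a := l o; set b := walks_trans _ _ _ _; set h := survival _ _; nra.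
rewrite (bigD1 None)//= (reindex_omap Some id); last by case.
rewrite [X in _ + X + 1](eq_bigl xpredT); last by move=> j; rewrite eqxx.
rewrite /l /= sumrB.
have -> : \sum_ib (1 - N%:R * del) * (del * neighbour_rate ib) =
    (1 - N%:R * del) * (del * N%:R).
  by rewrite -sum_neighbour_rate !mulr_sumr.
have -> : \sum_ib (1 - N%:R * del) * (del * neighbour_rate ib) * survival s (neighbour ib x) =
   (1 - N%:R * del) * (del * survival_rate s x).
  by rewrite !mulr_sumr; apply: eq_bigr => ib _; rewrite !mulrA.
rewrite le_eqVlt; apply/orP; left; apply/eqP; ring.
Qed.

(* Integrating [survival_step] over [L - e, L]. *)
Lemma survival_back x e s : Om x -> 0 <= e <= 1 -> N%:R * e < 1 -> 0 <= s ->
  survival (e + s) x * (1 + N%:R * e) -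
    e * survival_rate (e + s) x / (1 - N%:R * e) <= survival s x.
Proof.
move=> ox /[dup] e01 /andP[e0 e1] Ne s0.
set L := e + s; have L0 : 0 <= L by rewrite addr_ge0.
have Ne' : 0 < 1 - N%:R * e by rewrite subr_gt0.
have Ne0 : 0 <= N%:R * e by rewrite mulr_ge0.
set rho := survival_rate L x / (1 - N%:R * e).
have rho0 : 0 <= rho by rewrite divr_ge0 ?survival_rate_ge0// ltW.
(* Resting for [e] and then surviving for [s] is a way to survive until [L], so the rates at all
   times from [s] on are bounded by the one at [L], up to the factor 1 - N e. *)
have rate_le t : s <= t -> survival_rate t x <= rho.
  move=> st; rewrite ler_pdivlMr// mulr_suml; apply: ler_sum => ib _.
  rewrite -mulrA ler_wpM2l ?neighbour_rate_ge0//.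
  have t0 := le_trans s0 st.
  have [oy|ny] := pselect (Om (neighbour ib x)); last first.
    by rewrite !survival_outside// mul0r.
  apply: le_trans (survivalD_ge oy e0 s0); rewrite mulrC.
  apply: ler_pM; rewrite ?survival_ge0 ?(ltW Ne')//.
    by apply: rest_prob_ge => //; exact: ltW.
  exact: survival_nonincreasing.
apply/ler_addgt0Pr => eta eta0.
(* The quadratic errors of [m] steps add up to (N e)^2 / m, which is at most [eta]. *)
pose m := (Num.truncn ((N%:R * e) ^+ 2 / eta)).+1.
have mb : (N%:R * e) ^+ 2 / eta < m%:R.
  by rewrite -truncn_lt_nat// divr_ge0 ?sqr_ge0// ltW.
have m0 : 0 < m%:R :> R by [].
pose del := e / m%:R; have del0 : 0 <= del by rewrite divr_ge0.
have dele : del <= e by rewrite ler_pdivrMr// ler_peMr// ler1n.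
have mdel : m%:R * del = e by rewrite /del mulrC divfK// gt_eqF.
have step n : (n <= m)%N ->
    survival (n%:R * del + s) x <= survival s x +
      n%:R * (del * rho - N%:R * del * survival L x + (N%:R * del) ^+ 2).
  elim: n => [|n IH] nm; first by rewrite !mul0r add0r addr0.
  have {}IH := IH (ltnW nm).
  have nd0 : 0 <= n%:R * del by rewrite mulr_ge0.
  have nds0 : 0 <= n%:R * del + s by rewrite addr_ge0.
  have -> : n.+1%:R * del + s = del + (n%:R * del + s) by rewrite -natr1; ring.
  have d01 : 0 <= del <= 1 by rewrite del0 (le_trans dele).
  apply: (le_trans (survival_step ox d01 nds0)).
  have h1 : survival_rate (n%:R * del + s) x <= rho by apply: rate_le; rewrite lerDr.
  have h2 : survival L x <= survival (n%:R * del + s) x.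
    apply: survival_nonincreasing => //; rewrite /L lerD2r -mdel ler_wpM2r// ler_nat ltnW//.
  have Nd0 : 0 <= N%:R * del by rewrite mulr_ge0.
  have h3 : del * survival_rate (n%:R * del + s) x <= del * rho by rewrite ler_wpM2l.
  have h4 : N%:R * del * survival L x <= N%:R * del * survival (n%:R * del + s) x.
    by rewrite ler_wpM2l.
  have h5 : 0 <= N%:R * del * (del * survival_rate (n%:R * del + s) x).
    by rewrite mulr_ge0// mulr_ge0// survival_rate_ge0.
  rewrite -natr1; lra.
have := step m (leqnn _); rewrite mdel -/L.
have -> : m%:R * (del * rho - N%:R * del * survival L x + (N%:R * del) ^+ 2) =
  e * rho - N%:R * e * survival L x + (N%:R * e) ^+ 2 / m%:R.
  by rewrite /del; field; rewrite gt_eqF.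
have h : (N%:R * e) ^+ 2 / m%:R <= eta.
  by rewrite ler_pdivrMr// [eta * _]mulrC -ler_pdivrMr// ltW.
have -> : e * survival_rate L x / (1 - N%:R * e) = e * rho by rewrite /rho mulrA.
lra.
Qed.

End walks_estimates.

(** * The algorithm on a single realization *)

Section algorithm_paths.
Context (R : realType) (N : nat) (L : R) (y : 'rV[int]_N).
Hypothesis L_gt0 : 0 < L.
Local Notation V := ('rV[int]_N).
Local Notation Om := (@Omega N).

Section one_realization.
Context (c : nat -> R -> V).
Hypothesis rc : forall n, right_cont (c n).
Local Notation tm := (renewal_time L y c).
Local Notation path n := (stage L y c n).2.
Local Notation state := (renewal_state L y c).

Lemma renewal_timeS n : tm n.+1 = (tm n + (collision_time (c n) - L%:E))%E.
Proof. by rewrite /renewal_time /=; case: (stage L y c n). Qed.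

Lemma stage_pathS n s :
  path n.+1 s = if (s%:E <= tm n)%E then path n s else c n (s - fine (tm n)).
Proof. by rewrite /renewal_time /=; case: (stage L y c n). Qed.

Lemma collision_time_ge0 (f : R -> V) : (0 <= collision_time f)%E.
Proof. by apply: le_ereal_inf_tmp => _ [t [t0 _] <-]; rewrite lee_fin ltW. Qed.

Lemma collision_time_gt (f : R -> V) e : 0 <= e -> right_cont f -> stay Om e f ->
  (e%:E < collision_time f)%E.
Proof.
move=> e0 rf sf; have [del del0 h] := rf e e0.
apply: (@lt_le_trans _ _ (e + del)%:E); first by rewrite lte_fin ltrDl.
apply: le_ereal_inf_tmp => _ [t [t0 nt] <-]; rewrite lee_fin leNgt; apply/negP => tedel.
apply: nt; have [te|et] := leP t e; first by apply: sf; rewrite te ltW.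
by rewrite h ?(ltW et)//; apply: sf; rewrite e0 lexx.
Qed.

Lemma before_collision (f : R -> V) s : 0 < s -> (s%:E < collision_time f)%E -> Om (f s).
Proof.
move=> s0 st; apply: contrapT => ns.
have : (collision_time f <= s%:E)%E by apply: ereal_inf_lbound; exists s.
by rewrite leNgt st.
Qed.

(** Right-continuity turns survival up to and including [e] into a strict inequality. The infimum
    sees only positive times, so time 0 is a separate assumption. *)
Lemma collision_time_gtP (f : R -> V) e : 0 <= e -> right_cont f -> Om (f 0) ->
  stay Om e f <-> (e%:E < collision_time f)%E.
Proof.
move=> e0 rf f0; split; first exact: collision_time_gt.
move=> ef t /andP[]; rewrite le_eqVlt => /orP[/eqP <-//|t0] te.
by apply: before_collision => //; apply: le_lt_trans ef; rewrite lee_fin.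
Qed.

(* What holds almost surely of the first [n] copies. *)
Definition good_copies n : Prop := forall m, (m < n)%N -> (tm m < +oo)%E ->
  c m 0 = state m /\ stay Om L (c m).

Lemma good_copies_le m n : (m <= n)%N -> good_copies n -> good_copies m.
Proof. by move=> mn gn k km; apply: gn; exact: leq_trans mn. Qed.

Lemma renewal_time_oo n : tm n = +oo%E -> tm n.+1 = +oo%E.
Proof.
rewrite renewal_timeS => ->; rewrite addye// gt_eqF//.
apply: (@lt_le_trans _ _ (- L%:E)%E); first exact: ltNyr.
by rewrite leeDr// collision_time_ge0.
Qed.

Lemma renewal_time_ge0 n : good_copies n -> (0 <= tm n)%E.
Proof.
elim: n => [//|n IH] gn; have t0 := IH (good_copies_le (leqnSn n) gn).
have [too|] := ltP (tm n) +oo%E; last first.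
  by rewrite leye_eq => /eqP /renewal_time_oo ->.
have [_ sn] := gn n (ltnSn n) too.
rewrite renewal_timeS adde_ge0// sube_ge0// ltW// collision_time_gt// ltW//.
Qed.

Lemma renewal_time_fin n : good_copies n -> (tm n < +oo)%E -> tm n = (fine (tm n))%:E.
Proof. by move=> /renewal_time_ge0 t0 too; rewrite fineK// ge0_fin_numE. Qed.

Lemma renewal_time_lt n : good_copies n.+1 -> (tm n < +oo)%E -> (tm n < tm n.+1)%E.
Proof.
move=> gn too; have [_ sn] := gn n (ltnSn n) too.
rewrite renewal_timeS (renewal_time_fin (good_copies_le (leqnSn n) gn) too).
by rewrite lteDl// sube_gt0 collision_time_gt// ltW.
Qed.

Lemma renewal_time_le n : good_copies n.+1 -> (tm n <= tm n.+1)%E.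
Proof.
move=> gn; have [too|] := ltP (tm n) +oo%E; first by rewrite ltW// renewal_time_lt.
by rewrite leye_eq => /eqP h; rewrite h renewal_time_oo.
Qed.

Lemma renewal_time_mono m n : (m <= n)%N -> good_copies n -> (tm m <= tm n)%E.
Proof.
elim: n => [|n IH]; first by rewrite leqn0 => /eqP ->.
rewrite leq_eqVlt => /orP[/eqP ->//|mn] gn.
by apply: (le_trans (IH mn (good_copies_le (leqnSn n) gn))); exact: renewal_time_le.
Qed.

Lemma stage_path_stable m n s : (m <= n)%N -> good_copies n -> (s%:E <= tm m)%E ->
  path n s = path m s.
Proof.
elim: n => [|n IH]; first by rewrite leqn0 => /eqP ->.
rewrite leq_eqVlt => /orP[/eqP ->//|mn] gn sm.
have gn' := good_copies_le (leqnSn n) gn.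
by rewrite stage_pathS (le_trans sm (@renewal_time_mono m n mn gn'))// IH.
Qed.

(** At s = t_n the definition reads the older path; the copy agrees with it there because it starts
    at the renewal state. *)
Lemma stage_path_copy n s : good_copies n.+1 -> (tm n <= s%:E)%E ->
  path n.+1 s = c n (s - fine (tm n)).
Proof.
move=> gn ts; have too := le_lt_trans ts (ltry s).
have tE := renewal_time_fin (good_copies_le (leqnSn n) gn) too.
rewrite stage_pathS; case: ifPn => // st.
have sE : s = fine (tm n) by apply: EFin_inj; rewrite -tE; apply/eqP; rewrite eq_le st ts.
by rewrite sE subrr; have [-> _] := gn n (ltnSn n) too.
Qed.

Lemma renewal_stateS n : good_copies n.+1 -> (tm n.+1 < +oo)%E ->
  state n.+1 = c n (fine (tm n.+1) - fine (tm n)).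
Proof.
move=> gn too; rewrite /renewal_state stage_path_copy//.
rewrite -renewal_time_fin// ltW// renewal_time_lt//.
exact: le_lt_trans (renewal_time_le gn) too.
Qed.

Lemma lt_renewal_timeS n s : good_copies n.+1 -> (tm n <= s%:E)%E ->
  (s%:E < tm n.+1)%E = ((s - fine (tm n) + L)%:E < collision_time (c n))%E.
Proof.
move=> gn ts; have too := le_lt_trans ts (ltry s).
have tE := renewal_time_fin (good_copies_le (leqnSn n) gn) too.
rewrite renewal_timeS tE /=; have := collision_time_ge0 (c n).
case: (collision_time (c n)) => [r| |]//=.
  by rewrite -EFinB -EFinD !lte_fin => _; apply/idP/idP; lra.
by rewrite addye// addey// !ltry.
Qed.

Lemma copy_start_Omega n : good_copies n.+1 -> (tm n < +oo)%E -> Om (c n 0).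
Proof. by move=> gn too; have [_] := gn n (ltnSn n) too; apply; rewrite lexx ltW. Qed.

(** The renewal comes [L] before the collision of the copy, whose own time at [s] is s - t_n. A
    statement about renewal times becomes one about a single path. *)
Lemma lt_renewal_time_stay n s : good_copies n.+1 -> (tm n <= s%:E)%E ->
  (s%:E < tm n.+1)%E <-> stay Om (s - fine (tm n) + L) (c n).
Proof.
move=> gn ts; have too := le_lt_trans ts (ltry s).
have tE := renewal_time_fin (good_copies_le (leqnSn n) gn) too.
rewrite lt_renewal_timeS//; apply: iff_sym; apply: collision_time_gtP => //.
  by rewrite addr_ge0 ?(ltW L_gt0)// subr_ge0 -lee_fin -tE.
exact: copy_start_Omega.
Qed.

(** At its renewal a copy is still [L] > 0 short of its collision time. *)
Lemma renewal_state_Omega n : Om y -> good_copies n -> (tm n < +oo)%E -> Om (state n).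
Proof.
case: n => [//|n] oy gn too; rewrite renewal_stateS//.
have tl := renewal_time_lt gn (le_lt_trans (renewal_time_le gn) too).
have tE := renewal_time_fin (good_copies_le (leqnSn n) gn) (lt_trans tl too).
have tE' := renewal_time_fin gn too.
have pos : 0 < fine (tm n.+1) - fine (tm n) by rewrite subr_gt0 -lte_fin -tE -tE'.
apply: before_collision => //.
have := renewal_timeS n; rewrite tE' tE /=; have := collision_time_ge0 (c n).
case: (collision_time (c n)) => [r| |]//= _.
by rewrite -EFinB -EFinD lte_fin => -[->]; have := L_gt0; lra.
Qed.

Lemma algorithm_pathE n s : (forall m, good_copies m) -> (s%:E <= tm n)%E ->
  algorithm_path L y c s = path n s.
Proof.
move=> gc sn; rewrite /algorithm_path.
set Q := [set n | _].
have exQ : exists m, (s%:E <= tm m)%E by exists n.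
have Qm : Q (ex_minn exQ).
  case: ex_minnP => m sm mmin; split=> // k km; rewrite ltNge; apply/negP => sk.
  by have := mmin k sk; rewrite leqNgt km.
have [m_s m_min] : Q (xget 0%N Q) by exact: xgetI Qm.
set m := xget 0%N Q in m_s m_min *.
have mn : (m <= n)%N.
  by rewrite leqNgt; apply/negP => /m_min; rewrite ltNge sn.
by rewrite (stage_path_stable mn).
Qed.

Lemma algorithm_path_copy n s : (forall m, good_copies m) ->
  (tm n <= s%:E)%E -> (s%:E <= tm n.+1)%E ->
  algorithm_path L y c s = c n (s - fine (tm n)).
Proof. by move=> gc ts st; rewrite (algorithm_pathE gc st) stage_path_copy. Qed.

Lemma renewal_index s : (forall s : R, exists n, (s%:E < tm n)%E) -> 0 <= s ->
  exists2 n, (tm n <= s%:E)%E & (s%:E < tm n.+1)%E.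
Proof.
move=> tmoo s0; have ex := tmoo s.
case: (ex_minnP ex) => -[|n] sn mmin; first by move: sn; rewrite lte_fin ltNge s0.
exists n => //; rewrite leNgt; apply/negP => sn'.
by have := mmin n sn'; rewrite ltnn.
Qed.

Hypothesis gc : forall n, good_copies n.
Hypothesis tmoo : forall s : R, exists n, (s%:E < tm n)%E.

Lemma algorithm_path_Omega s : 0 <= s -> Om (algorithm_path L y c s).
Proof.
move=> s0; have [n ts st] := renewal_index tmoo s0.
rewrite (algorithm_path_copy gc ts (ltW st)).
have too := le_lt_trans ts (ltry s).
have tE := renewal_time_fin (@gc n) too.
have sn0 : 0 <= s - fine (tm n) by rewrite subr_ge0 -lee_fin -tE.
have := (lt_renewal_time_stay (@gc n.+1) ts).1 st; apply; rewrite sn0 /=.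
by rewrite lerDl ltW.
Qed.

Lemma renewal_index_left s : 0 < s ->
  exists2 n, (tm n < s%:E)%E & (s%:E <= tm n.+1)%E.
Proof.
move=> s0; have ex : exists n, (s%:E <= tm n)%E by have [n /ltW] := tmoo s; exists n.
case: (ex_minnP ex) => -[|n] sn mmin; first by move: sn; rewrite lee_fin leNgt s0.
exists n => //; rewrite ltNge; apply/negP => sn'.
by have := mmin n sn'; rewrite ltnn.
Qed.

(** Right-continuity is read in the stage with t_n <= t < t_(n+1), left limits in the one with t_n <
    t <= t_(n+1); there the path is a shifted copy on the relevant side of [t]. *)
Lemma algorithm_path_cadlag : (forall n, cadlag (c n)) -> cadlag (algorithm_path L y c).
Proof.
move=> cc t t0; split.
  have [n tn nt] := renewal_index tmoo t0.
  have too := le_lt_trans tn (ltry t).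
  have tE := renewal_time_fin (@gc n) too.
  have r0 : 0 <= t - fine (tm n) by rewrite subr_ge0 -lee_fin -tE.
  have [del del0 h] := rc n r0.
  have [b tb bn] : exists2 b, t < b & (b%:E <= tm n.+1)%E.
    case E : (tm n.+1) => [b| |]; last by move: nt; rewrite E.
      by exists b; rewrite // -lte_fin -E.
    by exists (t + 1); rewrite ?ltrDl// leey.
  apply: near_rightI; exists (Num.min del (b - t)); first by rewrite lt_min del0 subr_gt0.
  move=> s /andP[ts]; rewrite -ltrBlDl lt_min => /andP[s1 s2].
  rewrite (algorithm_path_copy gc tn (ltW nt)).
  rewrite (@algorithm_path_copy n s gc).
  - by apply: h; rewrite lerD2r (ltW ts) /=; lra.
  - by apply: (le_trans tn); rewrite lee_fin ltW.
  - by apply: le_trans bn; rewrite lee_fin; lra.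
move=> {}t0; have [n tn nt] := renewal_index_left t0.
have too := lt_trans tn (ltry t).
have tE := renewal_time_fin (@gc n) too.
have r0 : 0 < t - fine (tm n) by rewrite subr_gt0 -lte_fin -tE.
have [_ /(_ r0)[x hx]] := cc n _ (ltW r0).
have [del del0 h] := near_left hx.
exists x; apply: near_leftI; exists (Num.min del (t - fine (tm n))).
  by rewrite lt_min del0.
move=> s /andP[+ st]; rewrite ltrBlDl -ltrBlDr lt_min => /andP[s1 s2].
rewrite (@algorithm_path_copy n s gc).
- by apply: h; apply/andP; split; lra.
- by rewrite tE lee_fin; lra.
- by apply: le_trans nt; rewrite lee_fin ltW.
Qed.

End one_realization.
End algorithm_paths.

(** * Measurability at random times *)

Section random_times.
Context (R : realType) (d d' : measure_display) (U : measurableType d)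
  (S : measurableType d').
Hypothesis allm : forall A : set S, measurable A.
Context (Z : R -> U -> S).
Hypothesis mZ : forall t, 0 <= t -> measurable_fun setT (Z t).
Hypothesis rZ : forall w, right_cont (Z ^~ w).

Lemma measurable_truncn (f : U -> R) j : measurable_fun setT f -> (forall w, 0 <= f w) ->
  measurable [set w | Num.truncn (f w) = j].
Proof.
move=> mf f0.
have -> : [set w | Num.truncn (f w) = j] = f @^-1` `[j%:R, j.+1%:R[%classic.
  apply/seteqP; split=> w /=; rewrite in_itv/=.
    by move=> /eqP; rewrite truncn_eq.
  exact: truncn_def.
by rewrite -[X in measurable X]setTI; exact: mf.
Qed.

(** [rho] is approximated from the right by multiples of 1 / (k + 1); by right-continuity the value
    at the approximation is the value at [rho] for all k from some [K] on. *)
Lemma measurable_random_time (rho : U -> R) z :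
  measurable_fun setT rho -> (forall w, 0 <= rho w) ->
  measurable [set w | Z (rho w) w = z].
Proof.
move=> mrho rho0.
pose tr k w := Num.truncn (rho w * k.+1%:R).
have -> : [set w | Z (rho w) w = z] =
    \bigcup_K \bigcap_k \bigcup_j ([set w | tr k w = j] `&`
      (if (K <= k)%N then [set w | Z (j.+1%:R / k.+1%:R) w = z] else setT)).
  have close w del : 0 < del -> exists K, forall k, (K <= k)%N ->
      rho w <= (tr k w).+1%:R / k.+1%:R < rho w + del.
    move=> del0; exists (Num.truncn del^-1) => k Kk.
    have k0 : 0 < k.+1%:R :> R by [].
    have x0 : 0 <= rho w * k.+1%:R by rewrite mulr_ge0.
    have /andP[h1 h2] := truncn_itv x0.
    rewrite ler_pdivlMr// (ltW h2) /= ltr_pdivrMr// mulrDl -natr1.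
    apply: ler_ltD => //; rewrite mulrC -ltr_pdivrMr// mul1r.
    rewrite -truncn_lt_nat ?invr_ge0 ?(ltW del0)//.
  apply/seteqP; split=> w.
    move=> /= wz; have [del del0 h] := rZ w (rho0 w).
    have [K hK] := close w del del0.
    exists K => // k _; exists (tr k w) => //; split=> //; case: ifP => // Kk /=.
    by rewrite h// hK.
  move=> [K _ hK] /=; have [del del0 h] := rZ w (rho0 w).
  have [K' hK'] := close w del del0.
  have [j _ [/= <-]] := hK (maxn K K') Logic.I.
  by rewrite leq_maxl /= h// hK'// leq_maxr.
apply: bigcupT_measurable => K; apply: bigcapT_measurable => k.
apply: bigcupT_measurable => j; apply: measurableI.
  apply: measurable_truncn => [|w]; last by rewrite mulr_ge0.
  exact: measurable_funM.
by case: ifP => // _; apply: (measurable_state allm mZ); rewrite divr_ge0.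
Qed.

Lemma rational_between (a b : R) : 0 <= a -> a < b ->
  exists j k : nat, a < j.+1%:R / k.+1%:R < b.
Proof.
move=> a0 ab; pose k := Num.truncn (b - a)^-1.
have k0 : 0 < k.+1%:R :> R by [].
have ba : 0 < b - a by rewrite subr_gt0.
have x0 : 0 <= a * k.+1%:R by rewrite mulr_ge0.
exists (Num.truncn (a * k.+1%:R)), k.
have /andP[h1 h2] := truncn_itv x0.
rewrite ltr_pdivlMr// h2 /= ltr_pdivrMr// -natr1.
have : (b - a)^-1 < k.+1%:R by rewrite -truncn_lt_nat// invr_ge0 ltW.
rewrite invf_plt ?posrE// => h3.
have : 1 < (b - a) * k.+1%:R by rewrite -ltr_pdivrMr ?invr_gt0// div1r.
by rewrite mulrBl; lra.
Qed.

End random_times.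

Section algorithm_measurability.
Context (R : realType) (N : nat) (L : R) (y : 'rV[int]_N).
Local Notation V := ('rV[int]_N).
Local Notation Om := (@Omega N).
Context (d : measure_display) (U : measurableType d) (c : nat -> R -> U -> V).
Hypothesis rc : forall n w, right_cont (c n ^~ w).
Local Notation tm n w := (renewal_time L y (fun k s => c k s w) n).
Local Notation path n w := (stage L y (fun k s => c k s w) n).2.

(** An exit before [r] lasts for a while by right-continuity, hence is seen at a positive rational
    time before [r]. *)
Lemma measurable_collision_time (Z : R -> U -> V) :
  (forall t, 0 <= t -> measurable_fun setT (Z t)) -> (forall w, right_cont (Z ^~ w)) ->
  measurable_fun setT (fun w => collision_time (Z ^~ w)).
Proof.
move=> mZ rZ; apply: (@measurability _ _ _ _ setT _ (@ErealGenCInfty.G R)).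
  exact: ErealGenCInfty.measurableE.
move=> _ [_ [r ->] <-]; rewrite setTI.
have -> : (fun w => collision_time (Z ^~ w)) @^-1` `[r%:E, +oo[%classic =
    ~` \bigcup_j \bigcup_k (if (j.+1%:R / k.+1%:R < r)
        then Z (j.+1%:R / k.+1%:R) @^-1` (~` Om) else set0).
  apply/seteqP; split=> w /=; rewrite in_itv/= andbT.
    move=> rle [j _ [k _]]; case: ifPn => // jk nO.
    have : (collision_time (Z ^~ w) <= (j.+1%:R / k.+1%:R)%:E)%E.
      by apply: ereal_inf_lbound; exists (j.+1%:R / k.+1%:R) => //; split=> //; rewrite divr_gt0.
    by move=> /(le_trans rle); rewrite lee_fin leNgt jk.
  move=> h; apply: le_ereal_inf_tmp => _ [t [t0 nt] <-]; rewrite lee_fin leNgt; apply/negP => tr.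
  apply: h; have [del del0 hdel] := rZ w t (ltW t0).
  have [|j [k /andP[h1 h2]]] := @rational_between R t (Num.min r (t + del)) (ltW t0).
    by rewrite lt_min tr ltrDl.
  move: h2; rewrite lt_min => /andP[h2 h3].
  by exists j => //; exists k => //; rewrite h2 /= hdel// (ltW h1) h3.
apply: measurableC; apply: bigcupT_measurable => j; apply: bigcupT_measurable => k.
case: ifP => // _; rewrite -[X in measurable X]setTI; exact: mZ.
Qed.

Variable n0 : nat.
Hypothesis mc : forall n t, (n < n0)%N -> 0 <= t -> measurable_fun setT (c n t).

(** [n0] counts the copies that are measurable for the ambient sigma-algebra. With the one generated
    by these copies, the lemma says that t_n is adapted. *)
Lemma measurable_renewal_time n : (n <= n0)%N -> measurable_fun setT (fun w => tm n w).
Proof.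
elim: n => [|n IH] nn0; first exact: measurable_cst.
under eq_fun do rewrite renewal_timeS.
apply: emeasurable_funD; first exact: IH (ltnW nn0).
apply: emeasurable_funB => //; apply: measurable_collision_time => // t; exact: mc.
Qed.

Lemma renewal_time_gtNy n w : tm n w != -oo%E.
Proof.
elim: n => [//|n IH]; rewrite renewal_timeS.
have := @collision_time_ge0 R N (c n ^~ w).
by case: collision_time => [r| |]//= _; case: (tm n w) IH => [t| |].
Qed.

Lemma measurable_stage_path n (rho : U -> R) z : (n <= n0)%N -> measurable_fun setT rho ->
  measurable [set w | path n w (rho w) = z].
Proof.
elim: n => [|n IH] nn0 mrho.
  have [->|yz] := eqVneq y z; first by rewrite (_ : [set _ | _] = setT)//; apply/seteqP; split.
  by rewrite (_ : [set _ | _] = set0)//; apply/seteqP; split=> // w /= h; rewrite h eqxx in yz.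
have mt := measurable_renewal_time (ltnW nn0).
pose A := [set w | ((rho w)%:E <= tm n w)%E].
have mA : measurable A.
  rewrite -[X in measurable X]setTI; apply: measurable_lee => //.
  exact/measurable_EFinP.
(* The maximum makes the time nonnegative for every outcome; off [A], where the copy is read, it
   changes nothing. *)
pose sg w := Num.max 0 (rho w - fine (tm n w)).
have msg : measurable_fun setT sg.
  apply: measurable_maxr; first exact: measurable_cst.
  by apply: measurable_funB => //; apply: measurableT_comp => //; exact: fine_measurable.
have -> : [set w | path n.+1 w (rho w) = z] =
    (A `&` [set w | path n w (rho w) = z]) `|` (~` A `&` [set w | c n (sg w) w = z]).
  have sgE w : ~ A w -> sg w = rho w - fine (tm n w).
    move=> /negP; rewrite -ltNge; have := renewal_time_gtNy n w; rewrite /sg.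
    case: (tm n w) => [t| |]//= _; rewrite ?lte_fin => h.
    by apply/max_idPr; rewrite subr_ge0 ltW.
  apply/seteqP; split=> w.
    rewrite /= stage_pathS; case: ifPn => h; first by left.
    have nA : ~ A w by apply/negP.
    by move=> h'; right; rewrite sgE.
  rewrite /= stage_pathS => -[[-> //]|[nA]].
  by rewrite sgE// (negbTE (introN idP nA)).
apply: measurableU; apply: measurableI => //; first exact: IH (ltnW nn0) mrho.
  exact: measurableC.
apply: measurable_random_time => // [t|w]; first exact: mc.
by rewrite /sg le_max lexx.
Qed.

Lemma measurable_renewal_state n z : (n <= n0)%N ->
  measurable [set w | renewal_state L y (fun k s => c k s w) n = z].
Proof.
move=> nn0; apply: measurable_stage_path => //; apply: measurableT_comp.
  exact: fine_measurable.
exact: measurable_renewal_time.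
Qed.

End algorithm_measurability.

(** The events on which [F k] and [A] agree for all k >= K increase to one of probability 1, and the
    probabilities differ by at most the mass outside. *)
Lemma cvg_pr_eventually (R : realType) d (T : measurableType d) (P : probability T R)
    (F : (set T)^nat) (A G : set T) : (forall k, measurable (F k)) -> measurable A ->
  measurable G -> pr P G = 1 ->
  (forall w, G w -> exists K, forall k, (K <= k)%N -> (F k w <-> A w)) ->
  pr P (F k) @[k --> \oo] --> pr P A.
Proof.
move=> mF mA mG G1 h.
pose E K := \bigcap_k (if (K <= k)%N then (F k `&` A) `|` (~` F k `&` ~` A) else setT).
have mE K : measurable (E K).
  apply: bigcapT_measurable => k; case: ifP => // _; apply: measurableU; apply: measurableI => //.
    exact: measurableC.
  exact: measurableC.
have ndE : {homo E : n m / (n <= m)%N >-> (n <= m)%O}.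
  move=> n m nm; apply/subsetPset => w hw k _; case: ifP => // mk.
  by have := hw k Logic.I; rewrite (leq_trans nm mk).
have mU : measurable (\bigcup_K E K) by exact: bigcupT_measurable.
have GU : G `<=` \bigcup_K E K.
  move=> w /h[K hK]; exists K => // k _; case: ifP => // Kk.
  have := hK k Kk; have [Aw|nAw] := pselect (A w); [left|right]; split=> //; rewrite /setC /=; tauto.
have U1 : pr P (\bigcup_K E K) = 1.
  by apply/eqP; rewrite eq_le pr_le1//= -G1 pr_le.
have cE : pr P (E k) @[k --> \oo] --> (1 : R).
  have : P (E k) @[k --> \oo] --> (pr P (\bigcup_K E K))%:E.
    by rewrite -prE//; exact: nondecreasing_cvg_mu.
  by rewrite U1 => /fine_cvg.
have clo k : pr P A - (1 - pr P (E k)) <= pr P (F k) <= pr P A + (1 - pr P (E k)).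
  have := prIC P (mF k) (mE k); have := prIC P mA (mE k); have := prIC P measurableT (mE k).
  rewrite prT !setTI.
  have -> : F k `&` E k = A `&` E k.
    apply/seteqP; split=> w [h1 h2]; split=> //.
      by have := h2 k Logic.I; rewrite leqnn => -[[]|[]].
    by have := h2 k Logic.I; rewrite leqnn => -[[]|[]].
  have mC := measurableC (mE k).
  have := pr_le P (measurableI _ _ (mF k) mC) mC (@subIsetr _ _ _).
  have := pr_le P (measurableI _ _ mA mC) mC (@subIsetr _ _ _).
  have := pr_ge0 P (F k `&` ~` E k); have := pr_ge0 P (A `&` ~` E k); lra.
apply: (@squeeze_cvgr _ _ _ _ (fun k => pr P A - (1 - pr P (E k)))
   (fun k => pr P A + (1 - pr P (E k)))).
- by apply: nearW => k; exact: clo.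
- rewrite -[X in _ --> X]subr0 -(subrr (1 : R)); apply: cvgB; first exact: cvg_cst.
  by apply: cvgB; [exact: cvg_cst|].
- rewrite -[X in _ --> X]addr0 -(subrr (1 : R)); apply: cvgD; first exact: cvg_cst.
  by apply: cvgB; [exact: cvg_cst|].
Qed.

Lemma eventually_all (I : eqType) (Q : I -> nat -> Prop) (l : seq I) :
  (forall i, i \in l -> exists K, forall k, (K <= k)%N -> Q i k) ->
  exists K, forall k i, (K <= k)%N -> i \in l -> Q i k.
Proof.
elim: l => [|i l IH] h; first by exists 0%N.
have [K1 h1] := h i (mem_head _ _).
have [|K2 h2] := IH; first by move=> j jl; apply: h; rewrite inE jl orbT.
exists (maxn K1 K2) => k j; rewrite geq_max inE => /andP[k1 k2] /orP[/eqP ->|]; first exact: h1.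
exact: h2.
Qed.

(** * Events stable under small shifts of time to the right *)

Section right_stability.
Context (R : realType) (S : Type).
Implicit Types (f : R -> S) (B : set (R -> S)).

(** Delays will be approximated from below, so that a copy is read from times slightly too late; for
    such [B] the truth value is eventually the one at the exact time. *)
Definition right_stable B : Prop :=
  forall f, right_cont f -> right_cont (fun r => B (fun s => f (r + s)) : Prop).

Lemma right_stableT : right_stable setT.
Proof. by move=> f rf t t0; exists 1. Qed.

Lemma right_stableI B1 B2 : right_stable B1 -> right_stable B2 -> right_stable (B1 `&` B2).
Proof.
move=> h1 h2 f rf t t0; have [e1 e10 k1] := h1 f rf t t0; have [e2 e20 k2] := h2 f rf t t0.
exists (Num.min e1 e2); first by rewrite lt_min e10.
move=> s /andP[ts]; rewrite -ltrBlDl lt_min => /andP[s1 s2].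
by rewrite /setI /= k1 ?k2// ts /= -ltrBlDl.
Qed.

Lemma right_stableC B : right_stable B -> right_stable (~` B).
Proof.
move=> h f rf t t0; have [e e0 k] := h f rf t t0.
by exists e => // s /k /= ->.
Qed.

Lemma right_stable_state A t : 0 <= t -> right_stable [set f | A (f t)].
Proof.
move=> t0 f rf r r0; have [e e0 h] := rf (r + t) (addr_ge0 r0 t0).
exists e => // s /andP[rs se] /=; rewrite h// lerD2r rs /=; lra.
Qed.

Lemma right_cont_stay A f : right_cont f -> right_cont (fun e => stay A e f : Prop).
Proof.
move=> rf t t0; have [e e0 h] := rf t t0.
exists e => // s /andP[ts se]; apply/propext; split; first exact: stay_le.
move=> st r /andP[r0 rs]; have [rt|tr] := leP r t; first by apply: st; rewrite r0.
rewrite h; first by apply: st; rewrite t0 lexx.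
by rewrite (ltW tr) (le_lt_trans rs).
Qed.

(** Sliding the window slightly to the right adds points where the path still has its value at the
    old end, and drops points where it has its value at the old beginning. *)
Lemma right_stable_stay A e : 0 <= e -> right_stable (stay A e).
Proof.
move=> e0 f rf r r0; have [d d0 h] := rf (r + e) (addr_ge0 r0 e0).
have [d' d'0 h'] := rf r r0.
exists (Num.min d d'); first by rewrite lt_min d0.
move=> s /andP[rs]; rewrite -ltrBlDl lt_min => /andP[s1 s2].
apply/propext; split=> st x /andP[x0 xe]; last first.
  have [xr|xr] := leP (s + x) (r + e).
    by have -> : s + x = r + (s - r + x) by [ring]; apply: st; apply/andP; split; lra.
  by rewrite h; [apply: st; rewrite e0 lexx|apply/andP; split; lra].
have [xr|xr] := leP s (r + x).
  by have -> : r + x = s + (r + x - s) by [ring]; apply: st; apply/andP; split; lra.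
rewrite h'; last by apply/andP; split; lra.
rewrite -(h' s); last by apply/andP; split; lra.
by rewrite -[s]addr0; apply: st; rewrite lexx.
Qed.

Definition lag (t : R) (k : nat) : R := t - (Num.truncn (t * k.+1%:R))%:R / k.+1%:R.

Lemma lag_itv t k : 0 <= t -> 0 <= lag t k < k.+1%:R^-1.
Proof.
move=> t0; have k0 : 0 < k.+1%:R :> R by [].
have /truncn_itv/andP[h1 h2] : 0 <= t * k.+1%:R by rewrite mulr_ge0.
rewrite subr_ge0 ler_pdivrMr// h1 /= ltrBlDl -[X in _ + X]mul1r -mulrDl.
by rewrite ltr_pdivlMr// natr1.
Qed.

Lemma right_cont_lag (g : R -> S) x t : right_cont g -> 0 <= x -> 0 <= t ->
  exists K, forall k, (K <= k)%N -> g (x + lag t k) = g x.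
Proof.
move=> rg x0 t0; have [e e0 h] := rg x x0.
exists (Num.truncn e^-1) => k Kk; have /andP[l0 lk] := lag_itv k t0.
apply: h; rewrite lerDl l0 ltrD2l (lt_trans lk)//.
rewrite invf_plt ?posrE// -truncn_lt_nat ?invr_ge0 ?(ltW e0)//.
Qed.

End right_stability.

(** The truth of [B] for the shifted path is a boolean process in the shift, right-continuous by
    stability, and can be evaluated at a random time. *)
Lemma measurable_random_shift (R : realType) d d' (U : measurableType d) (S : measurableType d')
    (Z : R -> U -> S) (B : set (R -> S)) (rho : U -> R) :
  (forall A : set S, measurable A) ->
  (forall t, 0 <= t -> measurable_fun setT (Z t)) -> (forall w, right_cont (Z ^~ w)) ->
  rc_event B -> right_stable B -> measurable_fun setT rho -> (forall w, 0 <= rho w) ->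
  measurable [set w | B (fun s => Z (rho w + s) w)].
Proof.
move=> allm mZ rZ hB sB mrho rho0.
have := @measurable_random_time R _ _ U bool _ (fun r w => `[< B (fun s => Z (r + s) w) >]) _ _
  rho true mrho rho0.
rewrite (_ : [set w | _ = true] = [set w | B (fun s => Z (rho w + s) w)]); last first.
  by apply/seteqP; split=> w /=; [move/asboolP|move=> h; exact/asboolP].
apply=> //.
- move=> r r0; apply: (measurable_fun_bool true); rewrite setTI.
  rewrite (_ : _ @^-1` _ = [set w | B (fun s => Z (r + s) w)]); last first.
    by apply/seteqP; split=> w /=; [move/asboolP|move=> h; exact/asboolP].
  exact: (measurable_rc_event mZ rZ (rc_event_shift allm r0 hB)).
- move=> w r r0; have [e e0 h] := sB _ (rZ w) r r0.
  by exists e => // s /h ->.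
Qed.

(** * The renewal times *)

Section algorithm_law.
Context (R : realType) (p : R) (N : nat) (L : R) (y : 'rV[int]_N).
Hypotheses (p01 : 0 <= p <= 1) (L_gt0 : 0 < L) (Oy : Omega y).
Local Notation V := ('rV[int]_N).
Local Notation Om := (@Omega N).
Context (d0 : measure_display) (T0 : measurableType d0)
  (Pr : V -> probability T0 R) (Y : R -> T0 -> V).
Hypothesis hY : forall x, independent_rws (Pr x) p x Y.
Hypothesis rY : forall w, right_cont (Y ^~ w).
Context (d : measure_display) (T : measurableType d) (P : probability T R)
  (Yc : nat -> R -> T -> V).
Hypothesis hYc : sampled_copies P L y
  (fun z B => cond_prob_path (Pr z) Y B (@no_collision R N L)) Yc.
Local Notation tm n w := (renewal_time L y (fun k s => Yc k s w) n).
Local Notation path n w := (stage L y (fun k s => Yc k s w) n).2.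
Local Notation state n w := (renewal_state L y (fun k s => Yc k s w) n).
Local Notation survival := (survival Pr Y).
Local Notation rest_prob := (rest_prob Pr Y).

Let mY t : 0 <= t -> measurable_fun setT (Y t) := @measurable_walks _ _ _ _ _ _ _ _ (hY 0) t.

Let mYc n t : 0 <= t -> measurable_fun setT (Yc n t).
Proof. by case: hYc => h _; exact: h. Qed.

Let rYc n w : right_cont (Yc n ^~ w).
Proof. by apply: cadlag_right_cont; case: hYc => _ []. Qed.

Let allm : forall A : set V, measurable A := @measurable_rV N.

Let L0 : 0 <= L. Proof. exact: ltW. Qed.

Let mrc B : rc_event B -> measurable [set w | B (Y ^~ w)].
Proof. by apply: measurable_rc_event => //; exact: mY. Qed.

Let mrcc n B : rc_event B -> measurable [set w | B (Yc n ^~ w)].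
Proof. by apply: measurable_rc_event => //; exact: mYc. Qed.

Let copies_generators n := \bigcup_(k in `I_n) history (Yc k) setT.
Let copies_algebra n := g_sigma_algebraType (copies_generators n).

Lemma copies_eventsE n C : copies_events Yc n C = @measurable _ (copies_algebra n) C.
Proof. by []. Qed.

Lemma copies_measurable n C : copies_events Yc n C -> measurable C.
Proof.
apply: smallest_sub; first exact: sigma_algebra_measurable.
by move=> A [k _]; apply: history_measurable; exact: mYc.
Qed.

Lemma copies_events_mono m n : (m <= n)%N -> copies_events Yc m `<=` copies_events Yc n.
Proof.
move=> mn; apply: g_sigma_sub => A [k /= km hA]; apply: g_sigma_gen.
by exists k => //=; exact: leq_trans mn.
Qed.

Let mcopy n k t : (k < n)%N -> 0 <= t ->
  measurable_fun (setT : set (copies_algebra n)) (Yc k t).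
Proof.
move=> kn t0 _ A mA; rewrite setTI; apply: g_sigma_gen; exists k => //.
exact: history_state.
Qed.

Lemma copies_renewal_time n :
  measurable_fun (setT : set (copies_algebra n)) (fun w => tm n w).
Proof.
apply: (@measurable_renewal_time _ _ L y _ (copies_algebra n) Yc rYc n) => // m t mn t0.
exact: mcopy.
Qed.

Lemma copies_renewal_state n z : copies_events Yc n [set w | state n w = z].
Proof.
apply: (@measurable_renewal_state _ _ L y _ (copies_algebra n) Yc rYc n) => // m t mn t0.
exact: mcopy.
Qed.

Lemma copies_stage_path n s z : copies_events Yc n [set w | path n w s = z].
Proof.
apply: (@measurable_stage_path _ _ L y _ (copies_algebra n) Yc rYc n _ n (cst s)) => // m t mn t0.
exact: mcopy.
Qed.

Lemma copies_renewal_time_le n (a : \bar R) : copies_events Yc n [set w | (tm n w <= a)%E].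
Proof.
rewrite copies_eventsE -[X in measurable X]setTI; apply: measurable_lee => //.
exact: copies_renewal_time.
Qed.

Lemma copies_renewal_time_ge n (a : \bar R) : copies_events Yc n [set w | (a <= tm n w)%E].
Proof.
rewrite copies_eventsE -[X in measurable X]setTI; apply: measurable_lee => //.
exact: copies_renewal_time.
Qed.

Lemma copies_renewal_time_fin n : copies_events Yc n [set w | (tm n w < +oo)%E].
Proof.
rewrite copies_eventsE -[X in measurable X]setTI; apply: measurable_lte => //.
exact: copies_renewal_time.
Qed.

Lemma copies_rc_event n k B : (k < n)%N -> rc_event B ->
  copies_events Yc n [set w | B (Yc k ^~ w)].
Proof.
move=> kn hB; rewrite copies_eventsE.
apply: (@measurable_rc_event _ _ _ _ (copies_algebra n)) => // t; exact: mcopy.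
Qed.

Definition renewal_at n z := [set w | (tm n w < +oo)%E /\ state n w = z].

Lemma copies_renewal_at n z : copies_events Yc n (renewal_at n z).
Proof. by apply: g_sigmaI; [exact: copies_renewal_time_fin|exact: copies_renewal_state]. Qed.

(** Numerator of the conditional probability given survival until [L]; the denominator
    [survival L z] is kept on the other side of the equations. *)
Definition conditioned_prob z (B : set (R -> V)) : R :=
  pr (Pr z) ([set w | B (Y ^~ w)] `&` [set w | stay Om L (Y ^~ w)]).

Lemma sampled_copies_rc n z C (B : set (R -> V)) : Om z -> copies_events Yc n C ->
  rc_event B ->
  pr P (C `&` renewal_at n z `&` [set w | B (Yc n ^~ w)]) * survival L z =
  pr P (C `&` renewal_at n z) * conditioned_prob z B.
Proof.
move=> Oz hC [B' hB' BB'].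
have -> : [set w | B (Yc n ^~ w)] = [set w | B' (Yc n ^~ w)].
  by apply/seteqP; split=> w; move/(BB' _ (rYc n w)).
have -> : conditioned_prob z B = conditioned_prob z B'.
  congr pr; apply/seteqP; split=> w [h1 h2]; split=> //; exact/(BB' _ (rY w)).
have [_ [_ /(_ n z C B' Oz hC hB')]] := hYc.
have mCD : measurable (C `&` renewal_at n z).
  by apply: (@copies_measurable n); apply: g_sigmaI => //; exact: copies_renewal_at.
rewrite /= -/(renewal_at n z) !prE//; last first.
  by apply: measurableI => //; apply: (measurable_path_event _ hB') => t; exact: mYc.
rewrite -EFinM => -[->].
rewrite /cond_prob_path /prob_path -mulrA divfK//.
by rewrite gt_eqF//; exact: (survival_gt0 p01 hY rY Oz L0).
Qed.

Lemma pr_null_le A B : measurable A -> measurable B -> A `<=` B -> pr P B = 0 -> pr P A = 0.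
Proof. by move=> mA mB AB B0; apply/eqP; rewrite eq_le pr_ge0 -B0 pr_le. Qed.

Lemma pr_fibres_null (S : countType) (g : T -> S) A : measurable A ->
  (forall z, measurable [set w | g w = z]) ->
  (forall z, pr P (A `&` [set w | g w = z]) = 0) -> pr P A = 0.
Proof.
move=> mA mg h; apply/eqP; rewrite eq_le pr_ge0 andbT.
have := @le_pr_fibres _ _ _ P S g A set0 1 0 ler01 (lexx 0) mA measurable0 mg.
by rewrite pr0 mulr0 mul1r; apply=> z; rewrite h mulr0 mul0r.
Qed.

Let mstate n z : measurable [set w | state n w = z].
Proof. exact: copies_measurable (@copies_renewal_state n z). Qed.

Definition good_event n := [set w | good_copies L y (fun k s => Yc k s w) n].

Lemma copies_good_event n : copies_events Yc n (good_event n).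
Proof.
(* The equality of two random states becomes a countable union over their common value, enumerated
   by [unpickle]. *)
have -> : good_event n = \bigcap_m (if (m < n)%N then
    ~` ([set w | (tm m w < +oo)%E] `&`
      ~` (\bigcup_k ([set w | state m w = odflt 0 (unpickle k)] `&`
           [set w | Yc m 0 w = odflt 0 (unpickle k)]) `&` [set w | stay Om L (Yc m ^~ w)]))
    else setT).
  apply/seteqP; split=> w.
    move=> gw m _; case: ifP => // mn [too]; apply; have [e s] := gw m mn too.
    by split=> //; exists (pickle (state m w)) => //; rewrite pickleK.
  move=> h m mn too; have := h m Logic.I; rewrite mn => /not_andP[//|].
  by move=> /contrapT [[k _ [/= -> ->]]].
apply: g_sigma_bigcap => m; case: ifP => mn; last exact: g_sigmaT.
apply: g_sigmaC; apply: g_sigmaI.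
  by apply: (copies_events_mono (ltnW mn)); exact: copies_renewal_time_fin.
apply: g_sigmaC; apply: g_sigmaI; last first.
  by apply: copies_rc_event => //; exact: rc_event_stay.
apply: g_sigma_bigcup => k; apply: g_sigmaI.
  by apply: (copies_events_mono (ltnW mn)); exact: copies_renewal_state.
by apply: (@copies_rc_event n m [set f | [set odflt 0 (unpickle k)] (f 0)]) => //; exact: rc_event_state.
Qed.

Let mgood n : measurable (good_event n).
Proof. exact: copies_measurable (@copies_good_event n). Qed.

(** Given the earlier copies and the state at t_n, the next copy has the conditioned law, which
    excludes a wrong start and a collision up to [L]. States outside Omega, to which the sampling
    does not refer, do not occur on the good event. *)
Lemma pr_good_event n : pr P (good_event n) = 1.
Proof.
elim: n => [|n IH].
  by rewrite (_ : good_event 0 = setT) ?prT//; apply/seteqP; split.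
have := prIC P (mgood n) (mgood n.+1); rewrite IH.
have -> : good_event n `&` good_event n.+1 = good_event n.+1.
  by apply/seteqP; split=> [w []//|w gw]; split=> //; exact: good_copies_le gw.
suff -> : pr P (good_event n `&` ~` good_event n.+1) = 0 by rewrite addr0.
apply: (@pr_fibres_null V (fun w => state n w)) => //.
  by apply: measurableI => //; exact: measurableC.
move=> z.
pose B : set (R -> V) := ~` ([set f | [set z] (f 0)] `&` stay Om L).
have hB : rc_event B.
  by apply: rc_eventC; apply: rc_eventI; [exact: rc_event_state|exact: rc_event_stay].
have sub : good_event n `&` ~` good_event n.+1 `&` [set w | state n w = z] `<=`
    good_event n `&` renewal_at n z `&` [set w | B (Yc n ^~ w)].
  move=> w [[gw ngw] wz]; have nn : ~ ((tm n w < +oo)%E -> Yc n 0 w = state n w /\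
      stay Om L (Yc n ^~ w)).
    move=> h; apply: ngw => m; rewrite ltnS leq_eqVlt => /orP[/eqP -> //|]; exact: gw.
  move: nn => /not_implyP[too nB]; split=> //.
  by move=> [/= f0 fs]; apply: nB; rewrite f0 wz.
have mD : measurable (good_event n `&` renewal_at n z).
  by apply: measurableI => //; exact: copies_measurable (@copies_renewal_at n z).
apply: pr_null_le sub _.
- by apply: measurableI => //; apply: measurableI => //; exact: measurableC.
- by apply: measurableI => //; exact: mrcc.
have [Oz|nOz] := pselect (Om z); last first.
  rewrite (_ : _ `&` _ = set0) ?pr0//; apply/seteqP; split=> // w [[gw [too wz]] _].
  by apply: nOz; rewrite -wz; exact: (renewal_state_Omega L_gt0 (rYc^~ w) Oy gw too).
have := sampled_copies_rc Oz (@copies_good_event n) hB.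
rewrite (_ : conditioned_prob z B = 0).
  have := survival_gt0 p01 hY rY Oz L0; rewrite mulr0 => s0 /eqP.
  by rewrite mulf_eq0 (gt_eqF s0) orbF => /eqP.
have mB := mrc hB; have mLs := mrc (rc_event_stay allm Om L0).
rewrite /conditioned_prob -(pr_start hY); last exact: measurableI.
rewrite (_ : _ `&` _ = set0) ?pr0//; apply/seteqP; split=> // w [[nB sL] w0].
exact: nB.
Qed.

(** Chosen so that N delta <= 1/2: from any state the walks rest for time [delta] with probability
    at least 1/2. *)
Let delta : R := (2 * N%:R + 1)^-1.

Let delta_gt0 : 0 < delta.
Proof. by rewrite invr_gt0 ltr_wpDl// mulr_ge0. Qed.

Let delta_half : N%:R * delta <= 1 / 2.
Proof.
have n0 : 0 <= N%:R :> R by [].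
by rewrite /delta ler_pdivrMr; lra.
Qed.

Lemma survival_delta_ge z : Om z -> survival L z / 2 <= survival (delta + L) z.
Proof.
move=> Oz; have s0 := survival_gt0 p01 hY rY Oz L0.
have d1 : delta <= 1.
  by rewrite invf_le1 ?lerDr ?mulr_ge0// ltr_wpDl// mulr_ge0.
have h1 := survivalD_ge p01 hY rY Oz (ltW delta_gt0) L0.
have h2 : 1 - N%:R * delta <= rest_prob delta z.
  apply: (rest_prob_ge p01 hY rY); first by rewrite d1 ltW.
  by apply: (le_trans delta_half); lra.
apply: le_trans h1; have := delta_half; nra.
Qed.

(** The sampled law applies on each fibre of the state at t_n, where a copy survives [delta] beyond
    [L] with probability at least 1/2 by [survival_delta_ge]. *)
Lemma pr_early_collision n C : copies_events Yc n C ->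
  C `<=` [set w | (tm n w < +oo)%E] ->
  pr P (C `&` ~` [set w | stay Om (delta + L) (Yc n ^~ w)]) <= pr P C / 2.
Proof.
move=> hC Coo; have dL0 : 0 <= delta + L by rewrite addr_ge0// ltW.
have mC := copies_measurable hC.
have hB : rc_event (~` (stay Om (delta + L) : set (R -> V))).
  by apply: rc_eventC; exact: rc_event_stay.
have mB := mrcc n hB.
rewrite -(prI1 _ (mgood n) (pr_good_event n)); last exact: measurableI.
rewrite -(prI1 mC (mgood n) (pr_good_event n)) mulrC -[leLHS]mul1r.
apply: (@le_pr_fibres _ _ _ P V (fun w => state n w)) => //.
- by apply: measurableI => //; exact: measurableI.
- exact: measurableI.
move=> z; rewrite mul1r.
have [Oz|nOz] := pselect (Om z); last first.
  rewrite (_ : _ `&` _ = set0) ?pr0 ?mulr_ge0 ?invr_ge0 ?pr_ge0//.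
  apply/seteqP; split=> // w [[[Cw _] gw] wz].
  by apply: nOz; rewrite -wz; exact: (renewal_state_Omega L_gt0 (rYc^~ w) Oy gw (Coo w Cw)).
  have hCg : copies_events Yc n (C `&` good_event n).
    by apply: g_sigmaI => //; exact: copies_good_event.
  have E A : C `&` A `&` good_event n `&` [set w | state n w = z] =
      C `&` good_event n `&` renewal_at n z `&` A.
    apply/seteqP; split=> [w [[[Cw Aw] gw] wz]|w [[[Cw gw] [_ wz]] Aw]] //.
    by do !split=> //; exact: Coo.
  have E' : C `&` good_event n `&` [set w | state n w = z] = C `&` good_event n `&` renewal_at n z.
    by have := E setT; rewrite !setIT.
  rewrite E E'.
  have s0 := survival_gt0 p01 hY rY Oz L0.
  have := sampled_copies_rc Oz hCg hB.
  have -> : conditioned_prob z (~` stay Om (delta + L)) = survival L z - survival (delta + L) z.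
    have := prIC (Pr z) (mrc (rc_event_stay allm Om L0)) (mrc (rc_event_stay allm Om dL0)).
    rewrite -/(survival L z) => ->.
    rewrite (_ : _ `&` [set w | stay Om (delta + L) (Y ^~ w)] =
      [set w | stay Om (delta + L) (Y ^~ w)]).
      by rewrite /conditioned_prob setIC -/(survival (delta + L) z) addrAC subrr add0r.
    apply/seteqP; split=> [w []//|w h]; split=> //; apply: stay_le h.
    by rewrite lerDr ltW.
  have := survival_delta_ge Oz.
  have := pr_ge0 P (C `&` good_event n `&` renewal_at n z).
  set a := pr P _; set b := pr P _; set s := survival _ _; set s' := survival _ _.
  move=> a0 ss' bE; rewrite -(ler_pM2r s0) -/s bE; nra.
Qed.

(* A copy survives until [delta + L] with probability at least 1/2, which gives
   g(n+1, j+1) <= (g(n, j+1) + g(n, j)) / 2 for the left-hand side g(n, j). *)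
Lemma pr_renewal_time_le n j :
  pr P [set w | (tm n w <= ((j%:R - 1) * delta)%:E)%E] <= 2 ^+ j * (3 / 4) ^+ n.
Proof.
have mle k a : measurable [set w | (tm k w <= a)%E].
  exact: copies_measurable (@copies_renewal_time_le k a).
(* The level of index 0 is negative, so no renewal time lies below it; this starts the recursion in
   [j]. *)
have g0 k : pr P [set w | (tm k w <= ((0%:R - 1) * delta)%:E)%E] = 0.
  rewrite -(prI1 (mle k _) (mgood k) (pr_good_event k)).
  rewrite (_ : _ `&` _ = set0) ?pr0//; apply/seteqP; split=> // w [/= tw gw].
  have := le_trans (renewal_time_ge0 L_gt0 (rYc^~ w) gw) tw.
  by rewrite lee_fin sub0r mulN1r oppr_ge0 leNgt delta_gt0.
elim: n j => [|n IH] j.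
  by rewrite expr0 mulr1 (le_trans (pr_le1 P (mle _ _)))// exprn_ege1// ler1n.
case: j => [|j]; first by rewrite g0 mulr_ge0// exprn_ge0.
set a := ((j%:R - 1) * delta)%:E; set b := ((j.+1%:R - 1) * delta)%:E.
have ab : (a <= b)%E by rewrite lee_fin ler_pM2r// lerD2r ler_nat.
pose C := [set w | (tm n w <= b)%E] `&` ~` [set w | (tm n w <= a)%E].
have hC : copies_events Yc n C.
  by apply: g_sigmaI; [|apply: g_sigmaC]; exact: copies_renewal_time_le.
have Coo : C `<=` [set w | (tm n w < +oo)%E].
  by move=> w [/= tb _]; apply: (le_lt_trans tb); exact: ltry.
have hCe := pr_early_collision hC Coo.
have mC := copies_measurable hC.
have dL0 : 0 <= delta + L by rewrite addr_ge0// ltW.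
have mD : measurable (C `&` ~` [set w | stay Om (delta + L) (Yc n ^~ w)]).
  by apply: measurableI => //; apply: measurableC; apply: mrcc; exact: rc_event_stay.
have : pr P ([set w | (tm n.+1 w <= b)%E] `&` good_event n.+1) <=
    pr P [set w | (tm n w <= a)%E] + pr P (C `&` ~` [set w | stay Om (delta + L) (Yc n ^~ w)]).
  rewrite -prU//; last first.
    by apply/disj_setPS => w [wa [[_ nwa] _]].
  apply: pr_le; [exact: measurableI|exact: measurableU|].
  move=> w [/= tb gw].
  have [ta|ta] := leP (tm n w) a; first by left.
  right; have tn := renewal_time_le L_gt0 (rYc^~ w) gw.
  have tnb := le_trans tn tb.
  split; first by split=> //; apply/negP; rewrite -ltNge.
  move=> st; have : (b < tm n.+1 w)%E.
    have tE := renewal_time_fin L_gt0 (rYc^~ w) (good_copies_le (leqnSn n) gw) (le_lt_trans tnb (ltry _)).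
    apply/(lt_renewal_time_stay L_gt0 (rYc^~ w) gw tnb); apply: stay_le st.
    rewrite lerD2r; move: ta; rewrite /a tE lte_fin -natr1; lra.
  by rewrite ltNge tb.
rewrite (prI1 (mle n.+1 b) (mgood n.+1) (pr_good_event n.+1)).
have := prIC P (mle n b) (mle n a).
rewrite (_ : _ `&` [set w | (tm n w <= a)%E] = [set w | (tm n w <= a)%E]); last first.
  by apply/seteqP; split=> [w []//|w h]; split=> //; exact: le_trans ab.
rewrite -/C => hb h; apply: (le_trans h).
have := IH j; have := IH j.+1; rewrite -/a -/b hb => h1 h2.
have := pr_ge0 P C.
(* The mean of 2^(j+1) and 2^j is 3/4 of 2^(j+1), whence the base 3/4. *)
have -> : 2 ^+ j.+1 * (3 / 4) ^+ n.+1 =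
  (2 ^+ j.+1 * (3 / 4) ^+ n + 2 ^+ j * (3 / 4) ^+ n) / 2 :> R by rewrite !exprS; field.
lra.
Qed.

Definition full_event := [set w | (forall n, good_copies L y (fun k s => Yc k s w) n) /\
  (forall s : R, exists n, (s%:E < tm n w)%E)].

Let full_eventE : full_event =
  (\bigcap_n good_event n) `&` \bigcap_j ~` \bigcap_n [set w | (tm n w <= j%:R%:E)%E].
Proof.
apply/seteqP; split=> w.
  move=> [gw ow]; split=> [n _|j _ h]; first exact: gw.
  by have [n] := ow j%:R; rewrite ltNge; have /= -> := h n Logic.I.
move=> [gw ow]; split=> [n|s]; first exact: gw.
apply: contrapT => /forallNP h; pose j := (Num.truncn `|s|).+1.
apply: (ow j Logic.I) => n _ /=; move: (h n) => /negP; rewrite -leNgt => /le_trans; apply.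
rewrite lee_fin (le_trans (ler_norm s))// ltW//.
by have := normr_ge0 s => /truncn_itv/andP[].
Qed.

Let mle n a : measurable [set w | (tm n w <= a)%E].
Proof. exact: copies_measurable (@copies_renewal_time_le n a). Qed.

Lemma measurable_full_event : measurable full_event.
Proof.
rewrite full_eventE; apply: measurableI; apply: bigcapT_measurable => // j.
by apply: measurableC; apply: bigcapT_measurable.
Qed.

Lemma pr_bigcap1 (F : (set T)^nat) : (forall n, measurable (F n)) ->
  (forall n, pr P (F n) = 1) -> pr P (\bigcap_n F n) = 1.
Proof.
move=> mF F1; have mI : measurable (\bigcap_n F n) by exact: bigcapT_measurable.
pose H k := \big[setI/setT]_(i < k) F i.
have mH k : measurable (H k) by apply: bigsetI_measurable.
apply/eqP; rewrite eq_le pr_le1//=.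
rewrite (_ : \bigcap_n F n = \bigcap_k H k).
  apply: pr_bigcap_ge => // [k|k].
    by rewrite /H big_ord_recr /= => w [].
  elim: k => [|k IH]; first by rewrite /H big_ord0 prT.
  by rewrite /H big_ord_recr /= -/(H k) (prI1 (mH k) (mF k) (F1 k)).
apply/seteqP; split=> w h.
  move=> k _; elim: k => [|k IH]; first by rewrite /H big_ord0.
  by rewrite /H big_ord_recr; split=> //; exact: h.
by move=> n _; have := h n.+1 Logic.I; rewrite /H big_ord_recr => -[].
Qed.

(** For a fixed level the bound of [pr_renewal_time_le] is geometric in [n], so all renewal times
    remain below it with probability 0. *)
Lemma pr_full_event : pr P full_event = 1.
Proof.
have m1 : measurable (\bigcap_n good_event n) by exact: bigcapT_measurable.
have mb j : measurable (\bigcap_n [set w | (tm n w <= j%:R%:E)%E]).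
  exact: bigcapT_measurable.
rewrite full_eventE prI1//; first by apply: pr_bigcap1 => //; exact: pr_good_event.
  by apply: bigcapT_measurable => j; exact: measurableC.
apply: pr_bigcap1 => j; first exact: measurableC.
have := prIC P measurableT (mb j); rewrite prT !setTI => jE.
suff : pr P (\bigcap_n [set w | (tm n w <= j%:R%:E)%E]) = 0 by lra.
pose j' := (Num.truncn (j%:R / delta)).+2.
have jj' : j%:R <= (j'%:R - 1) * delta.
  rewrite -ler_pdivrMr// /j' -(natr1 _.+1) addrK ltW//.
  by have /truncn_itv/andP[] : 0 <= j%:R / delta by rewrite divr_ge0// ltW.
apply/eqP; rewrite eq_le pr_ge0 andbT.
have cv : (2 ^+ j' * (3 / 4) ^+ n @[n --> \oo] --> (2 ^+ j' * 0 : R)).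
  by apply: cvgMr; apply: cvg_expr; rewrite ger0_norm; lra.
rewrite mulr0 in cv; rewrite -(cvg_lim _ cv)//.
apply: limr_ge; first by apply/cvg_ex; exists 0.
apply: nearW => n; apply: le_trans (pr_renewal_time_le n j').
apply: pr_le => // w h; apply: (le_trans (h n Logic.I)).
by rewrite lee_fin.
Qed.


(** * Conditioning on the past at a fixed time *)

Let hT : rc_event (setT : set (R -> V)).
Proof. exact: rc_eventT. Qed.

Let sT : right_stable (setT : set (R -> V)).
Proof. exact: right_stableT. Qed.

Let mrenewal n z : measurable (renewal_at n z).
Proof. exact: copies_measurable (@copies_renewal_at n z). Qed.

Lemma pr_renewal_outside n x A : ~ Om x -> measurable A -> pr P (A `&` renewal_at n x) = 0.
Proof.
move=> nOx mA; rewrite -(prI1 (measurableI _ _ mA (mrenewal n x)) (mgood n) (pr_good_event n)).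
rewrite (_ : _ `&` _ = set0) ?pr0//; apply/seteqP; split=> // w [[_ [too wx]] gw].
by apply: nOx; rewrite -wx; exact: (renewal_state_Omega L_gt0 (rYc^~ w) Oy gw too).
Qed.

(** A nonnegative real for every outcome, as the evaluation of paths at random times requires; it is
    t_n itself when t_n is finite and nonnegative. *)
Definition clock n w : R := Num.max 0 (fine (tm n w)).

Let clock_ge0 n w : 0 <= clock n w.
Proof. by rewrite /clock le_max lexx. Qed.

Let clockE n w : (0 <= tm n w)%E -> (tm n w < +oo)%E -> tm n w = (clock n w)%:E.
Proof.
by move=> t0 too; rewrite /clock; case: (tm n w) t0 too => [t| |]//= t0 _; rewrite (max_idPr _).
Qed.

Lemma copies_clock n : measurable_fun (setT : set (copies_algebra n)) (clock n).
Proof.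
apply: measurable_maxr; first exact: measurable_cst.
apply: measurableT_comp; [exact: fine_measurable|exact: copies_renewal_time].
Qed.

Lemma copies_all (I : eqType) n (Q : I -> set T) (l : seq I) :
  (forall i, i \in l -> copies_events Yc n (Q i)) ->
  copies_events Yc n [set w | forall i, i \in l -> Q i w].
Proof.
elim: l => [|i l IH] h.
  rewrite (_ : [set w | _] = setT); first exact: g_sigmaT.
  by apply/seteqP; split.
rewrite (_ : [set w | _] = Q i `&` [set w | forall i, i \in l -> Q i w]).
  apply: g_sigmaI; first by apply: h; rewrite mem_head.
  by apply: IH => j jl; apply: h; rewrite inE jl orbT.
apply/seteqP; split=> w.
  by move=> hw; split=> [|j jl]; apply: hw; rewrite ?mem_head// inE jl orbT.
by move=> [hi hl] j; rewrite inE => /orP[/eqP ->//|]; exact: hl.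
Qed.

Section freezing.
Context (n : nat) (v : R) (l : seq (R * V)) (z : V).
Hypotheses (v0 : 0 <= v) (Oz : Om z).
Hypothesis lv : forall tz, tz \in l -> 0 <= tz.1 <= v.

(* The path of the copy [n] is read with the delay [q] instead of [t_n]. *)
Definition frozen (B : set (R -> V)) (t q : R) (g f : R -> V) : Prop :=
  [/\ forall tz, tz \in l -> (if tz.1 <= t then g tz.1 else f (tz.1 - q)) = tz.2,
      stay Om (v - q) f, f (v - q) = z, stay Om L (fun s => f (v - q + s)) &
      B (fun s => f (v - q + s))].

Definition frozen_event (q : T -> R) (B : set (R -> V)) : set T :=
  [set w | (0 <= tm n w)%E /\ (tm n w <= v%:E)%E /\
     frozen B (clock n w) (q w) (path n w) (Yc n ^~ w)].

(* The delay [q] runs through the approximations of [t_n] from below by multiples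
   of [1 / k.+1]: it takes countably many values, and right-continuity recovers
   [q = t_n] in the limit. *)
Section discretized.
Variable k : nat.

Let count w : nat := Num.truncn (clock n w * k.+1%:R).
Let q w : R := clock n w - lag (clock n w) k.
(** Countably many values that fix the starting state of the copy, the delay, and which constraints
    of [l] are read before t_n. *)
Let cell w : V * (nat * seq bool) := (state n w, (count w, [seq tz.1 <= clock n w | tz <- l])).

Let qE w : q w = (count w)%:R / k.+1%:R.
Proof. by rewrite /q /lag opprB addrC subrK. Qed.

Let copies_count j : copies_events Yc n [set w | count w = j].
Proof.
apply: (@measurable_truncn _ _ (copies_algebra n)) => [|w]; last by rewrite mulr_ge0.
by apply: measurable_funM; [exact: copies_clock|exact: measurable_cst].
Qed.

Let copies_clock_ge s (b : bool) : copies_events Yc n [set w | (s <= clock n w) = b].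
Proof.
have h : copies_events Yc n [set w | s <= clock n w].
  rewrite (_ : [set w | _] = setT `&` clock n @^-1` `[s, +oo[%classic).
    exact: (@copies_clock n measurableT).
  by apply/seteqP; split=> w /=; rewrite in_itv/= andbT => // -[].
case: b; first exact: h.
rewrite (_ : [set w | _] = ~` [set w | s <= clock n w]); first exact: g_sigmaC.
by apply/seteqP; split=> w /=; [move=> ->|move/negP/negbTE].
Qed.

Let copies_mask m : copies_events Yc n [set w | [seq tz.1 <= clock n w | tz <- l] = m].
Proof.
elim: l m => [|tz l' IH] [|b m] /=.
- by rewrite (_ : [set w | _] = setT); [exact: g_sigmaT|apply/seteqP; split].
- by rewrite (_ : [set w | _] = set0); [exact: (@measurable0 _ (copies_algebra n))|apply/seteqP; split].
- by rewrite (_ : [set w | _] = set0); [exact: (@measurable0 _ (copies_algebra n))|apply/seteqP; split].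
rewrite (_ : [set w | _] = [set w | (tz.1 <= clock n w) = b] `&`
    [set w | [seq tz.1 <= clock n w | tz <- l'] = m]); last first.
  by apply/seteqP; split=> w /=; [case=> -> ->|case=> -> ->].
by apply: g_sigmaI; [exact: copies_clock_ge|exact: IH].
Qed.

Let copies_cell x : copies_events Yc n [set w | cell w = x].
Proof.
rewrite (_ : [set w | _] = [set w | state n w = x.1] `&` ([set w | count w = x.2.1] `&`
  [set w | [seq tz.1 <= clock n w | tz <- l] = x.2.2])).
  apply: g_sigmaI; [exact: copies_renewal_state|apply: g_sigmaI; [exact: copies_count|exact: copies_mask]].
case: x => a [b c]; apply/seteqP; split=> w; first by case=> <- <- <-.
by case=> /= <- [<- <-].
Qed.

(** On a cell the delay and the split of [l] are constant, so the event is an event of the first [n]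
    copies intersected with one of copy [n] at deterministic times. The sampled law, then the Markov
    property of the walks at time [v - r], separate off [B]; the other factor is the same for [B]
    and [setT]. *)
Lemma frozen_cell B x : rc_event B ->
  measurable (frozen_event q B `&` [set w | cell w = x]) /\
  pr P (frozen_event q B `&` [set w | cell w = x]) * survival L z =
  pr P (frozen_event q setT `&` [set w | cell w = x]) * conditioned_prob z B.
Proof.
move=> hB; have [[w0 [t00 [t0v cw0]]]|empty] :=
    pselect (exists w, (0 <= tm n w)%E /\ (tm n w <= v%:E)%E /\ cell w = x); last first.
  have e A : frozen_event q A `&` [set w | cell w = x] = set0.
    apply/seteqP; split=> // w [[h1 [h2 _]] h3]; apply: empty.
    by exists w.
  by rewrite !e pr0 !mul0r.
have t0E := clockE t00 (le_lt_trans t0v (ltry v)).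
set t0 := clock n w0 in t0E; have t0ge : 0 <= t0 := clock_ge0 n w0.
have tv : t0 <= v by move: t0v; rewrite t0E lee_fin.
pose r := q w0; have [lag0 _] := andP (lag_itv k t0ge).
have rt : r <= t0 by rewrite /r /q lerBlDr lerDl.
have r0 : 0 <= r by rewrite /r qE divr_ge0.
have vr0 : 0 <= v - r by rewrite subr_ge0 (le_trans rt).
(* [l0] is read on the path before t_n, [l1] on the new copy, with times shifted by the delay
   [r]. *)
pose l0 := [seq tz <- l | tz.1 <= t0].
pose l1 := [seq (tz.1 - r, tz.2) | tz <- l & t0 < tz.1].
have l1v tz : tz \in l1 -> 0 <= tz.1 <= v - r.
  case/mapP => tz'; rewrite mem_filter => /andP[h1 h2] -> /=.
  have /andP[_ h3] := lv h2; rewrite lerD2r h3 andbT subr_ge0.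
  exact: le_trans rt (ltW h1).
pose C := [set w | (0 <= tm n w)%E] `&` [set w | (tm n w <= v%:E)%E] `&`
  [set w | count w = x.2.1] `&` [set w | [seq tz.1 <= clock n w | tz <- l] = x.2.2] `&`
  [set w | forall tz, tz \in l0 -> path n w tz.1 = tz.2].
have hC : copies_events Yc n C.
  apply: g_sigmaI; last by apply: copies_all => tz _; exact: copies_stage_path.
  apply: g_sigmaI; last exact: copies_mask.
  apply: g_sigmaI; last exact: copies_count.
  by apply: g_sigmaI; [exact: copies_renewal_time_ge|exact: copies_renewal_time_le].
pose H : set (R -> V) := cylinder (fun s f => f s) l1 `&` stay Om (v - r) `&` [set f | [set z] (f (v - r))].
pose K A : set (R -> V) := stay Om L `&` A.
pose B1 A : set (R -> V) := H `&` [set f | K A (fun s => f (v - r + s))].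
have rcl (l' : seq (R * V)) : (forall tz, tz \in l' -> 0 <= tz.1 <= v - r) ->
    rc_event (cylinder (fun s (f : R -> V) => f s) l').
  elim: l' => [|tz l' IH] h.
    by rewrite cylinder_nil; exact: rc_eventT.
  rewrite cylinder_cons; apply: rc_eventI.
    apply: (@rc_event_state _ _ _ allm _ [set tz.2]); by have /andP[] := h tz (mem_head _ _).
  by apply: IH => tz' tzl; apply: h; rewrite inE tzl orbT.
have hK A : rc_event A -> rc_event (K A).
  by move=> hA; apply: rc_eventI => //; exact: rc_event_stay.
have hB1 A : rc_event A -> rc_event (B1 A).
  move=> hA; apply: rc_eventI; last exact: rc_event_shift (hK _ hA).
  apply: rc_eventI; last exact: rc_event_state.
  by apply: rc_eventI; [exact: rcl|exact: rc_event_stay].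
have cellE A : frozen_event q A `&` [set w | cell w = x] =
    C `&` renewal_at n x.1 `&` [set w | B1 A (Yc n ^~ w)].
  have common w : cell w = x -> q w = r /\
      (forall tz, tz \in l -> (tz.1 <= clock n w) = (tz.1 <= t0)).
    rewrite -cw0 => -[_ cE mE]; split; first by rewrite /r !qE cE.
    by apply/eq_in_map; exact: mE.
  apply/seteqP; split=> w.
    move=> [[h1 [h2 [h3 h4 h5 h6 h7]]] cw].
    have [qr me] := common w cw; rewrite qr in h3 h4 h5 h6 h7.
    have too := le_lt_trans h2 (ltry v).
    split; first split.
    - do !split=> //; [by rewrite -cw|by rewrite -cw|].
      by move=> tz; rewrite mem_filter => /andP[tt tl]; have := h3 tz tl; rewrite me// tt.
    - by split=> //; rewrite -cw.
    - do !split=> //.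
      move=> _ /mapP[tz + ->] /=; rewrite mem_filter => /andP[tt tl].
      by have := h3 tz tl; rewrite me// leNgt tt.
  move=> [[[[[[h1 h2] h3] h4] h5] [too h6]] [[[h7 h8] h9] [h10 h11]]].
  have cw : cell w = x by rewrite /cell; case: (x) h3 h4 h6 => a [b c] /= -> -> ->.
  have [qr me] := common w cw.
  split=> //; split=> //; split=> //; split; rewrite ?qr//.
  move=> tz tl; rewrite me//; case: leP => tt.
    by apply: h5; rewrite mem_filter tt.
  by apply: (h7 (tz.1 - r, tz.2)); apply/mapP; exists tz; rewrite // mem_filter tt.
have mC := copies_measurable hC.
split; first by rewrite cellE; apply: measurableI; [exact: measurableI|apply: mrcc; exact: hB1].
have [Ox|nOx] := pselect (Om x.1); last first.
  have e A : rc_event A -> pr P (frozen_event q A `&` [set w | cell w = x]) = 0.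
    move=> hA; rewrite cellE setIAC pr_renewal_outside//.
    by apply: measurableI => //; apply: mrcc; exact: hB1.
  by rewrite !e ?mul0r//; exact: rc_eventT.
have key A : rc_event A -> pr P (frozen_event q A `&` [set w | cell w = x]) * survival L x.1 =
    pr P (C `&` renewal_at n x.1) * pr (Pr x.1) [set w | H (Y ^~ w)] * conditioned_prob z A.
  move=> hA; rewrite cellE (sampled_copies_rc Ox hC (hB1 A hA)) -mulrA; congr (_ * _).
  (* Survival until [v - r] and then for [L] more implies survival until [L], so the conditioning of
     the copy is absorbed by [B1]. *)
  have -> : conditioned_prob x.1 (B1 A) = pr (Pr x.1)
      ((cylinder Y l1 `&` [set w | stay Om (v - r) (Y ^~ w)]) `&` [set w | Y (v - r) w = z] `&`
       [set w | K A (fun s => Y (v - r + s) w)]).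
    congr pr; apply/seteqP; split=> w; first by case.
    move=> [[[h1 h2] h3] [h4 h5]]; split=> //.
    by apply: (@stay_le _ _ _ _ (v - r + L)); [rewrite lerDr|exact/stayD].
  rewrite (walks_rc_markov p01 hY rY)//; last exact: hK.
    by congr (_ * _); rewrite /conditioned_prob setIC.
  apply: g_sigmaI; last by apply: history_stay => //.
  elim: (l1) l1v => [|tz l' IH] h; first by rewrite cylinder_nil; exact: g_sigmaT.
  rewrite cylinder_cons; apply: g_sigmaI.
    have h' := h tz (mem_head _ _); have /andP[tz0 _] := h'.
    by apply: (history_state (A := [set tz.2])) => //=; rewrite in_itv.
  by apply: IH => tz' tzl; apply: h; rewrite inE tzl orbT.
(* The copy is normalized at its starting point, the state at t_n, and not at [z]; this factor is
   cancelled. *)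
have sx : survival L x.1 != 0 by rewrite gt_eqF//; exact: (survival_gt0 p01 hY rY Ox L0).
apply: (mulIf sx); rewrite mulrAC (key B hB) [RHS]mulrAC (key setT hT).
have -> : conditioned_prob z setT = survival L z.
  by congr pr; rewrite (_ : [set w | setT _] = setT) ?setTI//.
by rewrite -!mulrA; congr (_ * (_ * _)); rewrite mulrC.
Qed.

Lemma frozen_lag B : rc_event B -> measurable (frozen_event q B) /\
  pr P (frozen_event q B) * survival L z = pr P (frozen_event q setT) * conditioned_prob z B.
Proof.
have mF A : rc_event A -> measurable (frozen_event q A).
  by move=> hA; apply: (measurable_fibres (pcan_inj pickleK) (g := cell)) => x; have [] := frozen_cell x hA.
move=> hB; split; first exact: mF.
have mcell x : measurable [set w | cell w = x] by exact: copies_measurable (copies_cell x).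
have s0 : 0 <= survival L z by exact: survival_ge0.
have c0 : 0 <= conditioned_prob z B by exact: pr_ge0.
(* The equality on the cells is summed as two inequalities. *)
apply/eqP; rewrite eq_le ![_ * survival L z]mulrC ![_ * conditioned_prob z B]mulrC.
have e x : survival L z * pr P (frozen_event q B `&` [set w | cell w = x]) =
    conditioned_prob z B * pr P (frozen_event q setT `&` [set w | cell w = x]).
  by rewrite mulrC (frozen_cell x hB).2 mulrC.
have mB := mF _ hB; have mT := mF _ hT.
by apply/andP; split; apply: (le_pr_fibres (g := cell)) => // x; rewrite e.
Qed.

End discretized.
(** The truncation at 0 makes the shift nonnegative for every outcome; on the event t_n <= v, and it
    has no effect. *)
Definition current_event (B : set (R -> V)) : set T :=
  [set w | (tm n w <= v%:E)%E] `&` [set w | (v%:E < tm n.+1 w)%E] `&`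
  [set w | forall tz, tz \in l -> path n.+1 w tz.1 = tz.2] `&` [set w | path n.+1 w v = z] `&`
  [set w | B (fun s => Yc n (Num.max 0 (v - clock n w) + s) w)].

Lemma copies_current_event B : rc_event B -> right_stable B ->
  copies_events Yc n.+1 (current_event B).
Proof.
move=> hB sB; apply: g_sigmaI; last first.
  apply: (@measurable_random_shift R _ _ (copies_algebra n.+1) V (Yc n) B
    (fun w => Num.max 0 (v - clock n w))) => //.
  - by move=> t; exact: mcopy.
  - apply: measurable_maxr; first exact: measurable_cst.
    apply: measurable_funB; first exact: measurable_cst.
    move=> _ A mA; apply: (copies_events_mono (leqnSn n)).
    exact: (@copies_clock n (@measurableT _ (copies_algebra n)) A mA).
  - by move=> w; rewrite le_max lexx.
apply: g_sigmaI; last exact: copies_stage_path.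
apply: g_sigmaI; last by apply: copies_all => tz _; exact: copies_stage_path.
apply: g_sigmaI; first by apply: (copies_events_mono (leqnSn n)); exact: copies_renewal_time_le.
rewrite (_ : [set w | _] = ~` [set w | (tm n.+1 w <= v%:E)%E]).
  by apply: g_sigmaC; exact: copies_renewal_time_le.
by apply/seteqP; split=> w /=; rewrite ltNge => /negP.
Qed.

(** The condition v < t_(n+1) splits at the own time v - t_n of the copy into survival up to it and
    survival for [L] after it; the latter concerns the continuation alone. *)
Lemma current_eventE B w : full_event w ->
  current_event B w <-> frozen_event (clock n) B w.
Proof.
move=> [gw ow]; have t0 := renewal_time_ge0 L_gt0 (rYc^~ w) (gw n).
have pathE s : (tm n w <= v%:E)%E -> path n.+1 w s =
    if s <= clock n w then path n w s else Yc n (s - clock n w) w.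
  move=> tv; have tE := clockE t0 (le_lt_trans tv (ltry v)).
  by rewrite stage_pathS tE lee_fin.
have copyE s : (tm n w <= v%:E)%E -> clock n w <= s -> path n.+1 w s = Yc n (s - clock n w) w.
  move=> tv ts; have tE := clockE t0 (le_lt_trans tv (ltry v)).
  by rewrite (stage_path_copy L_gt0 (rYc^~ w) (gw n.+1)) tE// lee_fin.
have stayE : (tm n w <= v%:E)%E -> (v%:E < tm n.+1 w)%E <->
    stay Om (v - clock n w) (Yc n ^~ w) /\ stay Om L (fun s => Yc n (v - clock n w + s) w).
  move=> tv; have tE := clockE t0 (le_lt_trans tv (ltry v)).
  have ctv : clock n w <= v by move: tv; rewrite tE lee_fin.
  rewrite (lt_renewal_time_stay L_gt0 (rYc^~ w) (gw n.+1) tv) tE /= stayD// subr_ge0//.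
split.
  move=> [[[[tv vt] pl] pv] Bw]; have tE := clockE t0 (le_lt_trans tv (ltry v)).
  have ctv : clock n w <= v by move: tv; rewrite /= tE lee_fin.
  have [s1 s2] := (stayE tv).1 vt.
  split=> //; split=> //; split=> //.
  - by move=> tz tl; rewrite -pathE//; exact: pl.
  - by rewrite -copyE.
  - by move: Bw; rewrite /= (max_idPr _)// subr_ge0.
move=> [_ [tv [pl s1 pv s2 Bw]]]; have tE := clockE t0 (le_lt_trans tv (ltry v)).
have ctv : clock n w <= v by move: tv; rewrite tE lee_fin.
do !split=> //=.
- exact/stayE.
- by move=> tz tl; rewrite pathE//; exact: pl.
- by rewrite copyE.
- by rewrite (max_idPr _)// subr_ge0.
Qed.

(** Lowering the delay by the lag moves all readings of the copy to the right by the lag. The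
    finitely many readings and the two survival events are right-continuous in the shift, and so is
    [B] by stability. *)
Lemma frozen_event_lag B w : right_stable B -> exists K, forall k, (K <= k)%N ->
  frozen_event (fun w => clock n w - lag (clock n w) k) B w <-> frozen_event (clock n) B w.
Proof.
move=> sB; set t := clock n w; have t0 : 0 <= t := clock_ge0 n w.
have [[tw0 twv]|nt] := pselect ((0 <= tm n w)%E /\ (tm n w <= v%:E)%E); last first.
  by exists 0%N => k _; split=> -[h1 [h2 _]]; case: nt.
have tv : t <= v.
  by have := twv; rewrite (clockE tw0 (le_lt_trans twv (ltry v))) lee_fin.
have vt0 : 0 <= v - t by rewrite subr_ge0.
have shift x k : x - (t - lag t k) = x - t + lag t k by ring.
have [|K1 h1] := @eventually_all _ (fun tz k => t < tz.1 ->
    Yc n (tz.1 - (t - lag t k)) w = Yc n (tz.1 - t) w) l.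
  move=> tz _; have [tt|tt] := leP tz.1 t; first by exists 0%N.
  have [|K hK] := right_cont_lag (x := tz.1 - t) (rYc n w) _ t0; first by rewrite subr_ge0 ltW.
  by exists K => k Kk _; rewrite shift hK.
have [K2 h2] := right_cont_lag (right_cont_stay Om (rYc n w)) vt0 t0.
have [K3 h3] := right_cont_lag (rYc n w) vt0 t0.
have [K4 h4] := right_cont_lag (right_stable_stay Om L0 (rYc n w)) vt0 t0.
have [K5 h5] := right_cont_lag (sB _ (rYc n w)) vt0 t0.
exists (maxn K1 (maxn K2 (maxn K3 (maxn K4 K5)))) => k.
rewrite !geq_max => /andP[k1 /andP[k2 /andP[k3 /andP[k4 k5]]]].
rewrite /frozen_event /= /frozen -/t shift h2// h3// h4// h5//.
split=> -[_ [_ [g1 g2 g3 g4 g5]]]; (do 2!split=> //); split=> // tz tl; have := g1 tz tl;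
  by case: leP => // tt; rewrite (h1 k tz k1 tl tt).
Qed.

Lemma pr_current_event B : rc_event B -> right_stable B ->
  pr P (current_event B) * survival L z = pr P (current_event setT) * conditioned_prob z B.
Proof.
have cv A : rc_event A -> right_stable A ->
    pr P (frozen_event (fun w => clock n w - lag (clock n w) k) A) @[k --> \oo] -->
    pr P (current_event A).
  move=> hA sA; apply: (cvg_pr_eventually (G := full_event)).
  - by move=> k; have [] := frozen_lag k hA.
  - exact: copies_measurable (copies_current_event hA sA).
  - exact: measurable_full_event.
  - exact: pr_full_event.
  move=> w fw; have [K hK] := frozen_event_lag w sA.
  by exists K => k Kk; rewrite current_eventE//; exact: hK.
move=> hB sB.
have cM A c : rc_event A -> right_stable A ->
    pr P (frozen_event (fun w => clock n w - lag (clock n w) k) A) * c @[k --> \oo] -->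
    pr P (current_event A) * c.
  by move=> hA sA; apply: cvgM; [exact: cv|exact: cvg_cst].
rewrite -(cvg_lim _ (cM B (survival L z) hB sB))// -(cvg_lim _ (cM setT (conditioned_prob z B) hT sT))//.
by congr (lim (_ @ \oo)); apply/funext => k /=; rewrite (frozen_lag k hB).2.
Qed.


(** * Short-time bounds for the algorithm *)

Local Notation X s w := (algorithm_path L y (fun k u => Yc k u w) s).

Let hrest e : 0 <= e -> rc_event (stay [set z] e : set (R -> V)).
Proof. exact: rc_event_stay. Qed.

Let hstay e : 0 <= e -> rc_event (stay Om e : set (R -> V)).
Proof. exact: rc_event_stay. Qed.

Lemma conditioned_probE B : B `<=` stay Om L ->
  conditioned_prob z B = pr (Pr z) [set w | B (Y ^~ w)].
Proof.
move=> BL; congr pr; apply/seteqP; split=> [w []//|w Bw]; split=> //.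
exact: BL.
Qed.

Lemma current_event_sub B : current_event B `<=` current_event setT.
Proof. by move=> w [h _]; split. Qed.

Lemma current_event_clock B w : full_event w -> current_event B w ->
  [/\ 0 <= clock n w <= v, tm n w = (clock n w)%:E, stay Om (v - clock n w) (Yc n ^~ w),
      B (fun s => Yc n (v - clock n w + s) w) & forall s, v <= s -> (s%:E <= tm n.+1 w)%E ->
      X s w = Yc n (v - clock n w + (s - v)) w].
Proof.
move=> fw cw; have [gw ow] := fw.
have [t0 [tv [_ h2 _ _ h5]]] := (current_eventE B fw).1 cw.
have tE := clockE t0 (le_lt_trans tv (ltry v)).
have ctv : clock n w <= v by move: tv; rewrite tE lee_fin.
split=> //; first by rewrite clock_ge0.
move=> s vs st; rewrite (algorithm_path_copy L_gt0 (rYc^~ w) gw _ st).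
  by rewrite tE /=; congr Yc; ring.
by rewrite tE lee_fin (le_trans ctv).
Qed.

Lemma current_event_stay B w e : full_event w -> current_event B w -> 0 <= e ->
  stay Om (e + L) (fun s => Yc n (v - clock n w + s) w) <-> ((v + e)%:E < tm n.+1 w)%E.
Proof.
move=> fw cw e0; have [/andP[t0 tv] tE st _ _] := current_event_clock fw cw; have [gw _] := fw.
have -> : ((v + e)%:E < tm n.+1 w)%E <-> stay Om (v - clock n w + (e + L)) (Yc n ^~ w).
  rewrite (lt_renewal_time_stay L_gt0 (rYc^~ w) (gw n.+1)) tE.
    by rewrite /= (_ : v + e - _ + L = v - clock n w + (e + L))//; ring.
  by rewrite lee_fin ler_wpDr.
have vt0 : 0 <= v - clock n w by rewrite subr_ge0.
have eL0 : 0 <= e + L by rewrite addr_ge0.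
have D := @stayD _ _ Om _ _ (Yc n ^~ w) vt0 eL0.
by split=> [h|/D[]//]; exact/D.
Qed.

Let prD := pr P (current_event setT).

Let hz0 : 0 < survival L z. Proof. exact: (survival_gt0 p01 hY rY Oz L0). Qed.

Let measurable_current B : rc_event B -> right_stable B -> measurable (current_event B).
Proof. by move=> hB sB; exact: copies_measurable (copies_current_event hB sB). Qed.

Let pr_le_full A B : measurable A -> measurable B -> A `&` full_event `<=` B -> pr P A <= pr P B.
Proof.
move=> mA mB AB; rewrite -(prI1 mA measurable_full_event pr_full_event).
by apply: pr_le => //; apply: measurableI => //; exact: measurable_full_event.
Qed.

Hypothesis mX : forall s a, 0 <= s -> measurable [set w | X s w = a].

(** A copy that survives until [e + L] after [v] is still in use at [v + e], so its position there
    is that of the constructed path. *)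
Lemma current_event_jump e ib : 0 <= e <= 1 -> N%:R * e <= 1 ->
  prD * ((1 - 2 * (N%:R * e)) * (e * neighbour_rate p ib) * survival L (neighbour ib z)) <=
  pr P (current_event setT `&` [set w | X (v + e) w = neighbour ib z]) * survival L z.
Proof.
move=> e01 Ne; have /andP[e0 _] := e01; have eL0 : 0 <= e + L by rewrite addr_ge0// ltW.
pose B : set (R -> V) := stay Om (e + L) `&` [set f | [set neighbour ib z] (f e)].
have hB : rc_event B by apply: rc_eventI; [exact: hstay|exact: rc_event_state].
have sB : right_stable B.
  by apply: right_stableI; [exact: right_stable_stay|exact: right_stable_state].
have mB := measurable_current hB sB.
have mT : measurable (current_event setT).
  exact: (measurable_current hT sT).
apply: (@le_trans _ _ (pr P (current_event B) * survival L z)); last first.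
  rewrite ler_pM2r//; apply: pr_le_full => //.
    by apply: measurableI => //; apply: mX; rewrite addr_ge0.
  move=> w [cw fw]; split; first exact: current_event_sub cw.
  have [_ _ _ [Bs Be] h] := current_event_clock fw cw.
  have ve := (current_event_stay fw cw e0).1 Bs.
  rewrite /= h ?lerDl ?(ltW ve)//.
  by rewrite (_ : v + e - v = e)//; ring.
rewrite pr_current_event// ler_wpM2l ?pr_ge0// conditioned_probE.
  exact: (jump_survival_le p01 hY rY).
by move=> f [st _]; apply: stay_le st; rewrite lerDr.
Qed.

(* The path is at [z] at time [v + e] if the copy rests and survives until [e + L],
   or if it rests and does not survive but the next copy, started at [z], does. *)
Lemma current_event_rest e : 0 <= e <= 1 -> e <= L ->
  prD * (rest_prob e z * survival L z +
    rest_prob e z ^+ 2 * (survival (L - e) z - survival L z)) <=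
  pr P (current_event setT `&` [set w | X (v + e) w = z]) * survival L z.
Proof.
move=> /andP[e0 e1] eL; set a := rest_prob e z; have eL0 : 0 <= e + L by rewrite addr_ge0// ltW.
pose B1 : set (R -> V) := stay [set z] e `&` stay Om (e + L).
pose B2 : set (R -> V) := stay [set z] e `&` ~` stay Om (e + L).
have hB1 : rc_event B1 by apply: rc_eventI; [exact: hrest|exact: hstay].
have hB2 : rc_event B2 by apply: rc_eventI; [exact: hrest|apply: rc_eventC; exact: hstay].
have sB1 : right_stable B1 by apply: right_stableI; exact: right_stable_stay.
have sB2 : right_stable B2.
  by apply: right_stableI; [|apply: right_stableC]; exact: right_stable_stay.
have m1 := measurable_current hB1 sB1; have m2 := measurable_current hB2 sB2.
have mT : measurable (current_event setT).
  exact: (measurable_current hT sT).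
have c1 : conditioned_prob z B1 = a * survival L z.
  rewrite conditioned_probE; first exact: (rest_survival p01 hY rY).
  by move=> f [_ st]; apply: stay_le st; rewrite lerDr.
(* Resting for [e] and surviving until [L] has probability a h_(L-e); resting for [e] and surviving
   until [e + L] has probability a h_L. *)
have c2 : conditioned_prob z B2 = a * (survival (L - e) z - survival L z).
  have Le0 : 0 <= L - e by rewrite subr_ge0.
  have := rest_survival p01 hY rY Oz e0 Le0; rewrite subrKC -/a mulrBr => <-.
  rewrite -(rest_survival p01 hY rY Oz e0 L0).
  have := prIC (Pr z) (mrc (rc_eventI (hrest e0) (hstay L0))) (mrc (hstay eL0)); move=> /= ->.
  rewrite (_ : _ `&` [set w | stay Om (e + L) (Y ^~ w)] =
    [set w | stay [set z] e (Y ^~ w)] `&` [set w | stay Om (e + L) (Y ^~ w)]); last first.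
    apply/seteqP; split=> w; first by move=> [[h1 h2] h3].
    by move=> [h1 h2]; do !split=> //; apply: stay_le h2; rewrite lerDr.
  rewrite addrAC subrr add0r; congr pr.
  by apply/seteqP; split=> w [[h1 h2] h3].
pose E2 := current_event B2 `&` renewal_at n.+1 z `&` [set w | B1 (Yc n.+1 ^~ w)].
have mE2 : measurable E2.
  by apply: measurableI; [exact: measurableI|exact: mrcc].
(* A copy that rests from [v] to [v + e] without surviving for [L] beyond is replaced in this
   interval, at the state [z]. *)
have late w : full_event w -> current_event B2 w ->
    [/\ (tm n.+1 w <= (v + e)%:E)%E, state n.+1 w = z & tm n.+1 w = (clock n.+1 w)%:E].
  move=> fw cw; have [gw _] := fw.
  have [/andP[t0 tv] tE st [Bz nB] _] := current_event_clock fw cw.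
  have le : (tm n.+1 w <= (v + e)%:E)%E.
    by rewrite leNgt; apply/negP => /(current_event_stay fw cw e0).
  have too := le_lt_trans le (ltry _).
  have tE' := clockE (renewal_time_ge0 L_gt0 (rYc^~ w) (gw n.+1)) too.
  split=> //; rewrite (renewal_stateS L_gt0 (rYc^~ w) (gw n.+1) too) tE tE' /=.
  have [[[[_ +] _] _] _] := cw; rewrite /= tE' lte_fin => vt.
  move: le; rewrite tE' lee_fin => le.
  have := Bz (clock n.+1 w - v); rewrite (_ : v - _ + _ = clock n.+1 w - clock n w); last by ring.
  by apply; rewrite subr_ge0 (ltW vt) lerBlDl.
have pE2 : pr P E2 = pr P (current_event B2) * a.
  have hzn : survival L z != 0 by rewrite gt_eqF.
  apply: (mulIf hzn).
  rewrite (sampled_copies_rc Oz (copies_current_event hB2 sB2) hB1) c1 mulrA; congr (_ * _ * _).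
  apply/eqP; rewrite eq_le pr_le//=; try exact: measurableI.
  apply: pr_le_full => //; first exact: measurableI.
  move=> w [cw fw]; split=> //; have [le st _] := late w fw cw.
  by split=> //; exact: le_lt_trans le (ltry _).
have d12 : [disjoint current_event B1 & E2].
  by apply/disj_setPS => w [[_ [_ h1]] [[[_ [_ h2]] _] _]]; exact: h2.
apply: (@le_trans _ _ ((pr P (current_event B1) + pr P E2) * survival L z)); last first.
  rewrite ler_pM2r// -prU//; apply: pr_le_full; first exact: measurableU.
    by apply: measurableI => //; apply: mX; rewrite addr_ge0.
  move=> w [[cw|[[cw _] [Bz Bs]]] fw]; (split; first exact: current_event_sub cw).
    have [_ _ _ [Bz Bs] h] := current_event_clock fw cw.
    have ve := (current_event_stay fw cw e0).1 Bs.
    rewrite /= h ?lerDl ?(ltW ve)// (_ : v + e - v = e); last by ring.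
    by apply: Bz; rewrite e0 lexx.
  have [gw _] := fw; have [le _ tE] := late w fw cw.
  have [[[[_ vt] _] _] _] := cw; rewrite /= tE lte_fin in vt.
  have cle : clock n.+1 w <= v + e by rewrite -lee_fin -tE.
  rewrite /= (algorithm_path_copy L_gt0 (rYc^~ w) gw le).
    by rewrite tE /=; apply: Bz; apply/andP; split; lra.
  (* The next copy starts after [v], so its own time at [v + e] is below [e], and survival until
     [e + L] keeps it in use. *)
  apply: ltW; apply/(lt_renewal_time_stay L_gt0 (rYc^~ w) (gw n.+2) le); rewrite tE /=.
  by apply: stay_le Bs; lra.
rewrite mulrDl (pr_current_event hB1 sB1) c1 pE2 [pr P (current_event B2) * a * _]mulrAC (pr_current_event hB2 sB2) c2 /prD.
by rewrite le_eqVlt; apply/orP; left; apply/eqP; ring.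
Qed.

Definition mrw_rate ib x : R := neighbour_rate p ib * (survival L (neighbour ib x) / survival L x).

Lemma mrw_rate_ge0 ib x : 0 <= mrw_rate ib x.
Proof. by rewrite mulr_ge0 ?neighbour_rate_ge0// divr_ge0 ?survival_ge0. Qed.

Let Lam : R := 8 * N%:R + 2.

Let Lam_gt0 : 0 < Lam.
Proof. by rewrite ltr_wpDl// mulr_ge0. Qed.

Lemma sum_mrw_rate x : \sum_ib mrw_rate ib x = survival_rate p Pr Y L x / survival L x.
Proof. by rewrite /survival_rate mulr_suml; apply: eq_bigr => ib _; rewrite /mrw_rate mulrA. Qed.

Lemma sum_mrw_rate_le x : \sum_ib mrw_rate ib x <= Lam.
Proof.
rewrite sum_mrw_rate; have [Ox|nOx] := pselect (Om x); last first.
  by rewrite (survival_outside hY rY L0 nOx) invr0 mulr0 ltW.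
rewrite ler_pdivrMr ?(survival_gt0 p01 hY rY Ox L0)//.
by have [] := survival_rate_le p01 hY rY x L0.
Qed.

(** The first term is the second-order error of staying; the second is that of a jump, where 1 - 2 N
    e multiplies a rate of at most [Lam]. *)
Let K : R := 2 * N%:R ^+ 2 + 2 * N%:R * Lam.

Lemma current_event_local_bound e o : 0 <= e <= Num.min L (N%:R + 1)^-1 ->
  prD * jump_lower_bound mrw_rate K e o z <=
  pr P (current_event setT `&` [set w | X (v + e) w = jump_target (@neighbour N) o z]).
Proof.
rewrite le_min => /andP[e0 /andP[eL eN]].
have N1 : 0 < N%:R + 1 :> R by rewrite ltr_wpDl.
have Ne : (N%:R + 1) * e <= 1 by rewrite mulrC -ler_pdivlMr// div1r.
have Ne0 : 0 <= N%:R * e by rewrite mulr_ge0.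
have e1 : e <= 1 by rewrite mulrDl mul1r in Ne; lra.
have Ne1 : N%:R * e <= 1 by rewrite mulrDl mul1r in Ne; lra.
have e01 : 0 <= e <= 1 by rewrite e0.
have D0 : 0 <= prD := pr_ge0 _ _.
have N0 : 0 <= N%:R :> R by [].
have h0 := hz0; have Lam0 := ltW Lam_gt0.
rewrite -(ler_pM2r h0).
case: o => [ib|].
  apply: le_trans (current_event_jump ib e01 Ne1) => /=.
  rewrite -[leLHS]mulrA ler_wpM2l// /jump_lower_bound.
  have rle : mrw_rate ib z <= Lam.
    apply: le_trans (sum_mrw_rate_le z); rewrite (bigD1 ib)//= lerDl.
    by apply: sumr_ge0 => *; exact: mrw_rate_ge0.
  have -> : (1 - 2 * (N%:R * e)) * (e * neighbour_rate p ib) * survival L (neighbour ib z) =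
      (1 - 2 * (N%:R * e)) * e * mrw_rate ib z * survival L z.
    by rewrite /mrw_rate; field; rewrite gt_eqF.
  rewrite ler_pM2r// /K.
  have : 2 * N%:R * e ^+ 2 * mrw_rate ib z <= 2 * N%:R * e ^+ 2 * Lam.
    by rewrite ler_wpM2l// !mulr_ge0// exprn_ge0.
  have : 0 <= 2 * N%:R ^+ 2 * e ^+ 2 by rewrite !mulr_ge0// exprn_ge0.
  lra.
apply: le_trans (current_event_rest e01 eL) => /=.
rewrite -[leLHS]mulrA ler_wpM2l// /jump_lower_bound sum_mrw_rate.
have Ne1' : N%:R * e < 1.
  by have [->|en0] := eqVneq e 0; [rewrite mulr0|rewrite mulrDl mul1r in Ne; have : 0 < e by [rewrite lt_neqAle eq_sym en0]; lra].
have Le0 : 0 <= L - e by rewrite subr_ge0.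
have := survival_back p01 hY rY Oz e01 Ne1' Le0.
rewrite subrKC; set SR := survival_rate _ _ _ _ _; set h := survival L z in h0 *.
set h' := survival (L - e) z => back.
have hh' : h <= h' by apply: (survival_nonincreasing hY rY) => //; lra.
have a_ge := rest_prob_ge p01 hY rY z e01 Ne1.
set a := rest_prob e z in a_ge *.
have SR0 : 0 <= SR by exact: survival_rate_ge0.
set x := N%:R * e in Ne0 Ne1' Ne1 a_ge back *.
have b0 : 0 <= 1 - x by lra.
have a2 : (1 - x) ^+ 2 * (h' - h) <= a ^+ 2 * (h' - h).
  by apply: ler_wpM2r; [lra|apply: lerXn2r => //; rewrite nnegrE; lra].
have a1 : (1 - x) * h <= a * h by rewrite ler_pM2r.
(* The loss x h in the bound (1 - x) h is compensated to first order by the term x h that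
   [survival_back] gives for h' - h; what remains is - e SR. *)
have step : (1 - x) ^+ 2 * (x * h - e * SR / (1 - x)) <= (1 - x) ^+ 2 * (h' - h).
  by apply: ler_wpM2l; [rewrite exprn_ge0|lra].
have stepE : (1 - x) ^+ 2 * (x * h - e * SR / (1 - x)) = (1 - x) ^+ 2 * (x * h) - (1 - x) * (e * SR).
  by field; rewrite gt_eqF// subr_gt0.
have KE : (1 - e * (SR / h) - K * e ^+ 2) * h = h - e * SR - (K * e ^+ 2) * h.
  by field; rewrite gt_eqF.
have Kx : 2 * x ^+ 2 <= K * e ^+ 2.
  rewrite (_ : 2 * x ^+ 2 = 2 * N%:R ^+ 2 * e ^+ 2); last by rewrite /x; ring.
  by rewrite [K * _]mulrDl lerDl !mulr_ge0// exprn_ge0.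
have Kh : 2 * x ^+ 2 * h <= K * e ^+ 2 * h by rewrite ler_pM2r.
have xx : (1 - x) ^+ 2 * (x * h) = x * h - 2 * x ^+ 2 * h + x ^+ 3 * h by ring.
have x3 : 0 <= x ^+ 3 * h by rewrite mulr_ge0 ?exprn_ge0// ltW.
have xe : 0 <= x * (e * SR) by rewrite !mulr_ge0.
rewrite KE; lra.
Qed.

End freezing.

(** * The law of the algorithm *)

Local Notation X s w := (algorithm_path L y (fun k u => Yc k u w) s).

Let first_stage (s : R) n : set T :=
  [set w | (s%:E <= tm n w)%E /\ forall m, (m < n)%N -> (tm m w < s%:E)%E].

Let first_stage_inj s n m w : first_stage s n w -> first_stage s m w -> n = m.
Proof.
move=> [h1 h2] [h3 h4]; case: (ltngtP n m) => // nm.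
  by have := h4 n nm; rewrite ltNge h1.
by have := h2 m nm; rewrite ltNge h3.
Qed.

Let measurable_first_stage s n : measurable (first_stage s n).
Proof.
rewrite (_ : first_stage s n = [set w | (s%:E <= tm n w)%E] `&`
    \bigcap_m (if (m < n)%N then ~` [set w | (s%:E <= tm m w)%E] else setT)).
  apply: measurableI; first exact: copies_measurable (@copies_renewal_time_ge n s%:E).
  apply: bigcapT_measurable => m; case: ifP => // _; apply: measurableC.
  exact: copies_measurable (@copies_renewal_time_ge m s%:E).
apply/seteqP; split=> w [h1 h2]; split=> // m.
  by move=> _; case: ifP => // /h2 /=; rewrite ltNge => /negP.
by move=> mn; have := h2 m Logic.I; rewrite mn => /negP; rewrite -ltNge.
Qed.

Lemma algorithm_path_first_stage s n w : first_stage s n w -> X s w = path n w s.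
Proof.
move=> fn; rewrite /algorithm_path; set Q := [set n | _].
have : Q (xget 0%N Q) by exact: xgetI (fn : Q n).
by move=> /first_stage_inj /(_ fn) ->.
Qed.

(** If no stage reaches [s], [xget] falls back on stage 0, which accounts for the second set of the
    union. *)
Lemma measurable_algorithm_path_state s a : measurable [set w | X s w = a].
Proof.
rewrite (_ : [set w | _] =
    (\bigcup_n (first_stage s n `&` [set w | path n w s = a])) `|`
    (\bigcap_n ~` first_stage s n `&` [set w | path 0%N w s = a])).
  have mp n : measurable [set w | path n w s = a] by exact: copies_measurable (@copies_stage_path n s a).
  apply: measurableU; first by apply: bigcupT_measurable => n; exact: measurableI.
  by apply: measurableI => //; apply: bigcapT_measurable => n; exact: measurableC.
have none w : (\bigcap_n ~` first_stage s n) w -> X s w = path 0%N w s.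
  by move=> h; rewrite /algorithm_path xgetPN// => n; exact: h.
apply/seteqP; split=> w /=.
  have [[n fn]|nf] := pselect (exists n, first_stage s n w).
    by move=> wa; left; exists n => //; split=> //=; rewrite -(algorithm_path_first_stage fn).
  have hn : (\bigcap_n ~` first_stage s n) w by move=> n _ fn; apply: nf; exists n.
  by move=> wa; right; split=> //; rewrite -wa none.
move=> [[n _ [fn /= <-]]|[hn /= <-]]; [exact: algorithm_path_first_stage|exact: none].
Qed.

Lemma measurable_algorithm_path s : measurable_fun setT (fun w => X s w).
Proof.
move=> _ A mA; rewrite setTI.
exact: (@measurable_countable_preimage V pickle (pcan_inj pickleK) _ _ _ A
  (measurable_algorithm_path_state s)).
Qed.

Lemma algorithm_path_start w : X 0 w = y.
Proof. by rewrite (@algorithm_path_first_stage 0 0%N)//; split=> //=; rewrite lexx. Qed.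

Let K : R := 2 * N%:R ^+ 2 + 2 * N%:R * (8 * N%:R + 2).

Section cylinder_bound.
Context (u : R) (l : seq (R * V)).
Hypotheses (u0 : 0 <= u) (lu : forall tz, tz \in l -> 0 <= tz.1 <= u).
Local Notation C := (cylinder (fun s w => X s w) l).

Lemma measurable_algorithm_cylinder : measurable C.
Proof.
elim: (l) => [|tz l' IH]; first by rewrite cylinder_nil.
by rewrite cylinder_cons; apply: measurableI => //; exact: measurable_algorithm_path_state.
Qed.

(** All of t_0, ..., t_n are required to be at most [v], so that the stages are disjoint for every
    outcome, even where the renewal times fail to increase. *)
Let stage_of (v : R) n : set T :=
  [set w | forall m, (m <= n)%N -> (tm m w <= v%:E)%E] `&` ~` [set w | (tm n.+1 w <= v%:E)%E].

Let stage_of_inj v n m w : stage_of v n w -> stage_of v m w -> n = m.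
Proof.
move=> [h1 h2] [h3 h4]; case: (ltngtP n m) => // nm.
  by case: h2; exact: h3.
by case: h4; exact: h1.
Qed.

Let measurable_stage_of v n : measurable (stage_of v n).
Proof.
apply: measurableI; last by apply: measurableC; exact: mle.
rewrite (_ : [set w | _] = \bigcap_m (if (m <= n)%N then [set w | (tm m w <= v%:E)%E] else setT)).
  by apply: bigcapT_measurable => m; case: ifP.
apply/seteqP; split=> w h m; first by move=> _; case: ifP => // /h.
by move=> mn; have := h m Logic.I; rewrite mn.
Qed.

Let current_stage v w : option nat :=
  if pselect (exists n, stage_of v n w) is left h then Some (projT1 (cid h)) else None.

Let current_stageP v n w : current_stage v w = Some n <-> stage_of v n w.
Proof.
rewrite /current_stage; case: pselect => [h|nh]; last first.
  by split=> // sn; case: nh; exists n.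
split=> [[<-]|sn]; first exact: projT2 (cid h).
by congr Some; exact: stage_of_inj (projT2 (cid h)) sn.
Qed.

Let measurable_current_stage v o : measurable [set w | current_stage v w = o].
Proof.
case: o => [n|].
  rewrite (_ : [set w | _] = stage_of v n)//.
  by apply/seteqP; split=> w /=; [move/current_stageP|move=> h; exact/current_stageP].
rewrite (_ : [set w | _] = \bigcap_n ~` stage_of v n).
  by apply: bigcapT_measurable => n; exact: measurableC.
apply/seteqP; split=> w /=; first by move=> h n _ /current_stageP; rewrite h.
by case E : current_stage => [n|]// h; case: (h n Logic.I); exact/current_stageP.
Qed.

(** On [full_event] exactly one stage is in use at time [v], and the bounds for the individual
    stages add up over it. *)
Lemma algorithm_local_bound v z e o : u <= v -> 0 <= e <= Num.min L (N%:R + 1)^-1 ->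
  pr P (C `&` [set w | X v w = z]) * jump_lower_bound mrw_rate K e o z <=
  pr P (C `&` [set w | X v w = z] `&` [set w | X (v + e) w = jump_target (@neighbour N) o z]).
Proof.
move=> uv e_itv; have v0 : 0 <= v := le_trans u0 uv.
set D := C `&` _; set x := jump_target _ _ _.
have mD : measurable D.
  by apply: measurableI; [exact: measurable_algorithm_cylinder|exact: measurable_algorithm_path_state].
have mDx : measurable (D `&` [set w | X (v + e) w = x]).
  by apply: measurableI => //; exact: measurable_algorithm_path_state.
have mf := measurable_full_event.
rewrite -(prI1 mD mf pr_full_event).
(* A nonpositive lower bound is trivial; the sum over fibres takes nonnegative constants. *)
have [neg|pos] := leP (jump_lower_bound mrw_rate K e o z) 0.
  by apply: (@le_trans _ _ 0); [rewrite mulr_ge0_le0 ?pr_ge0|exact: pr_ge0].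
rewrite mulrC -[leRHS]mul1r.
apply: (le_pr_fibres (g := current_stage v)) => //; first exact: ltW.
  exact: measurableI.
move=> [n|]; last first.
  rewrite (_ : D `&` _ `&` _ = set0) ?pr0 ?mulr0 ?mul1r ?pr_ge0//.
  apply/seteqP; split=> // w [[_ [gw ow]] wn].
  have [n tn nt] := renewal_index ow v0.
  suff : current_stage v w = Some n by rewrite wn.
  apply/current_stageP; split=> [m mn|/= h]; last by move: nt; rewrite ltNge h.
  exact: le_trans (renewal_time_mono L_gt0 (rYc^~ w) mn (gw n)) tn.
have [Oz|nOz] := pselect (Om z); last first.
  rewrite (_ : D `&` _ `&` _ = set0) ?pr0 ?mulr0 ?mul1r ?pr_ge0//.
  apply/seteqP; split=> // w [[[_ Xz] [gw ow]] _]; apply: nOz; rewrite -Xz.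
  exact: (algorithm_path_Omega L_gt0 (rYc^~ w) gw ow).
have lv tz : tz \in l -> 0 <= tz.1 <= v.
  by move=> /lu/andP[-> tu] /=; exact: le_trans uv.
have mcur : measurable (current_event n v l z setT).
  apply: (@copies_measurable n.+1); exact: copies_current_event.
have e0 : 0 <= e by have /andP[] := e_itv.
have curE w : full_event w ->
    current_event n v l z setT w <-> D w /\ current_stage v w = Some n.
  move=> [gw ow].
  have pathE s : (s%:E <= tm n.+1 w)%E -> X s w = path n.+1 w s.
    exact: (algorithm_pathE L_gt0 (rYc^~ w) gw).
  split.
    move=> [[[[tn nt] pl] pv] _]; have lnt s : s <= v -> (s%:E <= tm n.+1 w)%E.
      by move=> sv; apply: le_trans (ltW nt); rewrite lee_fin.
    split; first split.
    - by move=> tz tl; rewrite pathE; [exact: pl|apply: lnt; have /andP[] := lv tz tl].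
    - by rewrite /= pathE// lnt.
    apply/current_stageP; split=> [m mn|/= h]; last by move: nt; rewrite /= ltNge h.
    exact: le_trans (renewal_time_mono L_gt0 (rYc^~ w) mn (gw n)) tn.
  move=> [[Cw Xz] /current_stageP[tn /negP]]; rewrite -ltNge => nt.
  have lnt s : s <= v -> (s%:E <= tm n.+1 w)%E.
    by move=> sv; apply: le_trans (ltW nt); rewrite lee_fin.
  do !split=> //.
  - exact: tn.
  - by move=> tz tl; rewrite -pathE; [exact: Cw|apply: lnt; have /andP[] := lv tz tl].
  - by rewrite /= -pathE// lnt.
have := current_event_local_bound n v0 Oz lv (fun s a _ => measurable_algorithm_path_state s a) o e_itv.
rewrite mulrC => bound; rewrite mul1r.
apply: le_trans (le_trans bound _).
  rewrite ler_pM2l//; apply: pr_le => //.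
    by apply: measurableI; [exact: measurableI|exact: measurable_current_stage].
  by move=> w [[Dw fw] sw]; exact/(curE w fw).
have mcx : measurable (current_event n v l z setT `&` [set w | X (v + e) w = x]).
  by apply: measurableI => //; exact: measurable_algorithm_path_state.
rewrite -(prI1 mcx mf pr_full_event); apply: pr_le; first exact: measurableI.
  by apply: measurableI => //; exact: measurable_current_stage.
by move=> w [[cw xw] fw]; have [Dw sw] := (curE w fw).1 cw; split.
Qed.

End cylinder_bound.

Let Lam_gt0 : 0 < 8 * N%:R + 2 :> R.
Proof. by rewrite ltr_wpDl// mulr_ge0. Qed.

Definition mrw_kernel : R -> R.-pker V ~> V :=
  unif_kernel allm (@neighbour N) mrw_rate_ge0 Lam_gt0 sum_mrw_rate_le.

(** A move out of Omega has rate 0 because [survival L] vanishes there, so Omega is closed under the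
    chain. *)
Lemma mrw_kernel_semigroup : transition_semigroup Om mrw_kernel /\
  semigroup_generator Om mrw_kernel (jump_generator (@neighbour N) mrw_rate).
Proof.
apply: unif_kernel_semigroup => x ib _; apply: contra_neqP => nO.
by rewrite /mrw_rate (survival_outside hY rY L0 nO) mul0r mulr0.
Qed.

Lemma mrw_generatorE : mrw_generator p (fun x => prob_path (Pr x) Y (@no_collision R N L)) =
  jump_generator (@neighbour N) mrw_rate.
Proof.
apply/funext => F; apply/funext => x; rewrite /mrw_generator /jump_generator.
rewrite -(pair_bigA _ (fun i b => mrw_rate (i, b) x * (F (neighbour (i, b) x) - F x))) /=.
apply: eq_bigr => i _; rewrite big_bool /mrw_rate /neighbour_rate /neighbour /=.
by rewrite /prob_path -![fine _]/(survival L _); ring.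
Qed.

Let history_cylinders (u : R) : set (set T) :=
  [set C | exists2 l : seq (R * V), (forall tz, tz \in l -> 0 <= tz.1 <= u) &
    C = cylinder (fun s w => X s w) l].

Let mX s z : measurable [set w | X s w = z] := measurable_algorithm_path_state s z.

(** With the state at [u] fixed, both sides are finite measures in [C]. They agree on cylinders,
    where the local bound is available, and cylinders generate the history up to [u]. *)
Lemma algorithm_markov_state u t z C A : 0 <= u -> 0 <= t ->
  history (fun s w => X s w) `[0, u] C ->
  (P (C `&` [set w | X u w = z] `&` [set w | A (X (u + t) w)]) =
   P (C `&` [set w | X u w = z]) * mrw_kernel t z A)%E.
Proof.
move=> u0 t0 hC.
have mA : measurable [set w | A (X (u + t) w)].
  exact: (@measurable_countable_preimage V pickle (pcan_inj pickleK) _ _ _ A (mX (u + t))).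
have mzA := measurableI _ _ (mX u z) mA.
have k0 : 0 <= fine (mrw_kernel t z A) by exact: fine_ge0.
have kE : mrw_kernel t z A = (fine (mrw_kernel t z A))%:E.
  exact: unif_kernel_fin.
pose m1 : {measure set T -> \bar R} := mrestr P mzA.
pose m2 : {measure set T -> \bar R} := mscale (NngNum k0) (mrestr P (mX u z)).
suff : m1 C = m2 C.
  by rewrite /m1 /m2 /= /mscale/= /mrestr/= setIA kE muleC.
have mcyl l := measurable_algorithm_cylinder l.
have G0 : history_cylinders u setT by exists [::] => //; rewrite cylinder_nil.
apply: (@g_sigma_algebra_measure_unique _ _ _ (history_cylinders u) _ (fun=> setT) (fun=> G0)).
- by move=> _ [l _ ->]; exact: mcyl.
- by apply/seteqP; split=> // w _; exists 0%N.
- move=> _ _ [l hl ->] [l' hl' ->]; exists (l ++ l'); last by rewrite cylinder_cat.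
  by move=> tz; rewrite mem_cat => /orP[/hl|/hl'].
- move=> _ [l hl ->]; rewrite /m1 /m2 /= /mscale/= /mrestr/= setIA -kE.
  (* The present state is one more constraint of the cylinder, at time [u] itself. *)
  pose l1 := (u, z) :: l.
  have hl1 tz : tz \in l1 -> 0 <= tz.1 <= u.
    by rewrite inE => /orP[/eqP ->|/hl//]; rewrite u0 lexx.
  have l1E : cylinder (fun s w => X s w) l `&` [set w | X u w = z] =
      cylinder (fun s w => X s w) l1 by rewrite cylinder_cons setIC.
  have := @markov_of_local_bound R _ _ T V P allm pickle (pcan_inj pickleK) _ (@neighbour N)
    mrw_rate _ mrw_rate_ge0 Lam_gt0 sum_mrw_rate_le (@neighbour_target_inj N)
    (fun s w => X s w) (cylinder (fun s w => X s w) l1) u K (Num.min L (N%:R + 1)^-1).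
  move=> /(_ (fun s _ => measurable_algorithm_path s) (mcyl _) u0).
  have KK : 0 <= K by rewrite addr_ge0 ?mulr_ge0 ?exprn_ge0// ltW.
  have e0 : 0 < Num.min L (N%:R + 1)^-1 by rewrite lt_min L_gt0 invr_gt0 ltr_wpDl.
  move=> /(_ KK e0) markov.
  have lb v x e o : u <= v -> 0 <= e <= Num.min L (N%:R + 1)^-1 -> _ :=
    fun uv he => @algorithm_local_bound u l1 u0 hl1 v x e o uv he.
  rewrite l1E [LHS](markov lb)//.
  rewrite (eq_integral (fun=> mrw_kernel t z A)); last first.
    by move=> w; rewrite inE -l1E => -[_ ->].
  by rewrite kE integral_cst//= -kE muleC.
- move=> _; rewrite /m1/= /mrestr setTI (prE P mzA); exact: ltry.
- move: hC; apply: g_sigma_sub => _ [s [B [su s0 _ ->]]].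
  rewrite (bigcup_fibres pickle (fun w => X s w) (_ @^-1` B)).
  apply: g_sigma_bigcup => n; have [[x xE]|->] :=
      @fibreE V pickle (pcan_inj pickleK) T (fun w => X s w) n; last first.
    by rewrite setI0; exact: (@measurable0 _ (g_sigma_algebraType (history_cylinders u))).
  rewrite xE; have [Bx|nBx] := pselect (B x); last first.
    rewrite (_ : _ `&` _ = set0); first exact: (@measurable0 _ (g_sigma_algebraType (history_cylinders u))).
    by apply/seteqP; split=> // w [/= Bw wx]; apply: nBx; rewrite -wx.
  apply: g_sigma_gen; exists [:: (s, x)].
    by move=> tz; rewrite inE => /eqP ->; move: su; rewrite /= in_itv.
  rewrite cylinder_cons cylinder_nil setIT.
  by apply/seteqP; split=> [w []//|w /= wx]; split=> //=; rewrite wx.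
Qed.

Lemma algorithm_markov u t C A : 0 <= u -> 0 <= t ->
  history (fun s w => X s w) `[0, u] C ->
  (P (C `&` [set w | A (X (u + t) w)]) = \int[P]_(w in C) mrw_kernel t (X u w) A)%E.
Proof.
move=> u0 t0 hC.
have mC : measurable C.
  by apply: history_measurable hC => s _; exact: measurable_algorithm_path.
have mA : measurable [set w | A (X (u + t) w)].
  exact: (@measurable_countable_preimage V pickle (pcan_inj pickleK) _ _ _ A (mX (u + t))).
have mf : measurable_fun setT (fun w => mrw_kernel t (X u w) A).
  apply: (@measurableT_comp _ _ _ _ _ _ (fun x => mrw_kernel t x A)).
    by move=> _ B mB; exact: allm.
  exact: measurable_algorithm_path.
have enc_inj : injective (pickle : V -> nat) := pcan_inj pickleK.
rewrite (@integral_fibres R V pickle enc_inj _ _ P (fun w => X u w) C)//; last first.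
  exact: measurable_funTS.
rewrite (@measure_fibres R V pickle enc_inj _ _ P (fun w => X u w))//; last exact: measurableI.
apply: eq_eseriesr => n _; have [[z zE]|->] := @fibreE V pickle enc_inj T (fun w => X u w) n.
  rewrite zE setIAC [LHS](algorithm_markov_state z A u0 t0 hC).
  rewrite (eq_integral (fun=> mrw_kernel t z A)); last by move=> w; rewrite inE => -[_ ->].
  by rewrite integral_cst; [exact: muleC|exact: measurableI].
by rewrite !setI0 measure0 integral_set0.
Qed.

End algorithm_law.

Theorem proposition3p4 (R : realType) (N : nat) (p L : R) (y : 'rV[int]_N)
  (hp : 0 <= p <= 1) (hL : 0 < L) (hy : Omega y)
  (* the system Y of independent random walks, started from x under Pr x *)
  (d0 : measure_display) (T0 : measurableType d0)
  (Pr : 'rV[int]_N -> probability T0 R) (Y : R -> T0 -> 'rV[int]_N)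
  (hY : forall x : 'rV[int]_N, independent_rws (Pr x) p x Y)
  (hYcadlag : forall w : T0, cadlag (Y ^~ w))
  (* the copies of the conditioned process sampled by the algorithm *)
  (d : measure_display) (T : measurableType d) (P : probability T R)
  (Yc : nat -> R -> T -> 'rV[int]_N)
  (hYc : sampled_copies P L y
     (fun z B => cond_prob_path (Pr z) Y B (no_collision L)) Yc) :
  {ae P, forall w,
    let t := renewal_time L y (fun k s => Yc k s w) in
    (forall n : nat, (t n < +oo)%E -> (t n < t n.+1)%E) /\
    t n @[n --> \oo] --> +oo%E} /\
  markov_chain P (@Omega N)
    (mrw_generator p (fun x => prob_path (Pr x) Y (no_collision L)))
    y (fun s w => algorithm_path L y (fun k u => Yc k u w) s).
Proof.
have rY w : right_cont (Y ^~ w) by exact: cadlag_right_cont.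
have [mYc [cYc _]] := hYc.
have rYc n w : right_cont (Yc n ^~ w) by exact: cadlag_right_cont.
have full1 := pr_full_event hp hL hy hY rY hYc.
have mfull := measurable_full_event hL hYc.
have full : {ae P, forall w, full_event L y Yc w}.
  exists (~` full_event L y Yc); split.
  - exact: measurableC.
  - rewrite prE; last exact: measurableC.
    have := prIC P measurableT mfull; rewrite prT !setTI full1 => h.
    by congr EFin; lra.
  - by move=> w.
split.
  apply: filterS full => w [gw ow]; split=> [n|].
    exact: (renewal_time_lt hL (rYc^~ w) (gw n.+1)).
  apply/cvgeyPge => A; have [n nA] := ow A.
  exists n => // m /= nm; apply: (le_trans (ltW nA)).
  exact: (renewal_time_mono hL (rYc^~ w) nm (gw m)).
rewrite mrw_generatorE; exists (mrw_kernel hp hL hY rY).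
have [sg gen] := mrw_kernel_semigroup hp hL hY rY.
do 2!split=> //; split; [|split; [|split]].
- by move=> t _; exact: (measurable_algorithm_path hYc).
- rewrite (_ : [set w | _] = setT) ?probability_setT//.
  by apply/seteqP; split=> // w _; exact: algorithm_path_start.
- apply: filterS full => w [gw ow]; split.
    exact: (algorithm_path_cadlag hL (rYc^~ w)).
  by move=> t t0; exact: (algorithm_path_Omega hL (rYc^~ w)).
- move=> s t C A s0 t0 hC _.
  exact: (algorithm_markov hp hL hy hY rY hYc).
Qed.
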